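(* The map $$\theta\in(0,1)\setminus\mathbb Q\longmapsto(\mathfrak A_\theta,\mathsf L_\theta),$$ where $\mathfrak A_\theta$ is the Effros–Shen algebra associated to $\theta$ and $\mathsf L_\theta$ is a strongly Leibniz L-seminorm on $\mathfrak A_\theta$ (with $A=1,B=0,C=1$) satisfying $$\mathsf{\Lambda}^\ast_{SL}((\mathfrak A_\theta,\mathsf L_\theta),(\mathfrak A_{\theta,n},\mathsf L_{\theta,n}))\leq 4\sum_{j=n}^\infty\beta_\theta(j)\quad\text{for all }n\in\mathbb N,$$ is continuous with respect to the usual topology on $(0,1)\setminus\mathbb Q$ and the topology induced by $\mathsf{\Lambda}^\ast_{SL}$.
   Context: $\mathbb N=\{0,1,2,\dots\}$. Quantum compact metric space with $(A,B)=(1,0)$: a pair $(\mathfrak A,\mathsf L)$ of a unital C*-algebra $\mathfrak A$ (with self-adjoint part $\mathfrak{sa}(\mathfrak A)$, invertible group $\mathrm{GL}(\mathfrak A)$, state space $\mathscr S(\mathfrak A)$) and a seminorm $\mathsf L$ (an L-seminorm) defined on a dense Jordan-Lie subalgebra $\mathrm{dom}(\mathsf L)$ of $\mathfrak{sa}(\mathfrak A)$ (a real subspace closed under $(ab+ba)/2$ and $(ab-ba)/(2i)$) such that: (1) $\{a\in\mathrm{dom}(\mathsf L):\mathsf L(a)=0\}=\mathbb R 1_{\mathfrak A}$; (2) $\mathsf{mk}_{\mathsf L}(\varphi,\psi)=\sup\{|\varphi(a)-\psi(a)|:a\in\mathrm{dom}(\mathsf L),\ \mathsf L(a)\leq 1\}$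 metrizes the weak* topology of $\mathscr S(\mathfrak A)$; (3) for all $a,b\in\mathrm{dom}(\mathsf L)$, $\max\{\mathsf L(\frac{ab+ba}{2}),\mathsf L(\frac{ab-ba}{2i})\}\leq \mathsf L(a)\|b\|_{\mathfrak A}+\|a\|_{\mathfrak A}\mathsf L(b)$; (4) $\{a\in\mathrm{dom}(\mathsf L):\mathsf L(a)\leq 1\}$ is closed in $\mathfrak A$. It is strongly Leibniz (with $C=1$) if for all $a\in\mathrm{dom}(\mathsf L)\cap\mathrm{GL}(\mathfrak A)$, $a^{-1}\in\mathrm{dom}(\mathsf L)$ and $\mathsf L(a^{-1})\leq\|a^{-1}\|_{\mathfrak A}^2\mathsf L(a)$. Seminorms given on all of a finite-dimensional C*-algebra are restricted to its self-adjoint part. A quantum isometry $\pi:(\mathfrak A,\mathsf L_{\mathfrak A})\to(\mathfrak B,\mathsf L_{\mathfrak B})$ is a surjective *-morphism with $\pi(\mathrm{dom}(\mathsf L_{\mathfrak A}))\subseteq\mathrm{dom}(\mathsf L_{\mathfrak B})$ and $\mathsf L_{\mathfrak B}(b)=\inf\{\mathsf L_{\mathfrak A}(a):a\in\mathrm{dom}(\mathsf L_{\mathfrak A}),\pi(a)=b\}$ for all $b\in\mathrm{dom}(\mathsf L_{\mathfrak B})$. A tunnel $(\mathfrak D,\mathsf L_{\mathfrak D},\pi_1,\pi_2)$ from $(\mathfrak A_1,\mathsf L_1)$ to $(\mathfrak A_2,\mathsf L_2)$ is a quantum compact metric space $(\mathfrak D,\mathsf L_{\mathfrak D})$ with quantum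 isometries $\pi_j:(\mathfrak D,\mathsf L_{\mathfrak D})\to(\mathfrak A_j,\mathsf L_j)$; its extent is $\max_{j\in\{1,2\}}\mathsf{Haus}_{\mathsf{mk}_{\mathsf L_{\mathfrak D}}}(\mathscr S(\mathfrak D),\{\varphi\circ\pi_j:\varphi\in\mathscr S(\mathfrak A_j)\})$ ($\mathsf{Haus}$ the Hausdorff distance). $\mathsf{\Lambda}^\ast_{SL}$ between two strongly Leibniz quantum compact metric spaces ($(A,B,C)=(1,0,1)$) is the infimum of extents of tunnels between them with $(\mathfrak D,\mathsf L_{\mathfrak D})$ strongly Leibniz ($(A,B,C)=(1,0,1)$); it is a metric up to full quantum isometry ( *-isomorphism $\pi$ such that $\pi$ and $\pi^{-1}$ are quantum isometries). Effros–Shen algebras. For $\theta\in(0,1)\setminus\mathbb Q$ let $(r_n^\theta)_{n\in\mathbb N}$ be its continued fraction expansion: $r_0^\theta=0$, $r_n^\theta\in\mathbb N\setminus\{0\}$ for $n\ge1$, $\theta=\lim_n [r_0^\theta;r_1^\theta,\dots,r_n^\theta]$. Set $p_{-1}^\theta=1,q_{-1}^\theta=0$, $p_0^\theta=0,q_0^\theta=1$, $p_1^\theta=1,q_1^\theta=r_1^\theta$, and $p_{n+1}^\theta=r_{n+1}^\theta p_n^\theta+p_{n-1}^\theta$, $q_{n+1}^\theta=r_{n+1}^\theta q_n^\theta+q_{n-1}^\theta$ for $n\ge 1$. Let $\mathfrak A_{\theta,0}=\mathbb C$, $\mathfrak A_{\theta,n}=M_{q_n^\theta}(\mathbb C)\oplus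 M_{q_{n-1}^\theta}(\mathbb C)$ for $n\geq1$, with unital *-monomorphisms $\alpha_{\theta,n}:\mathfrak A_{\theta,n}\to\mathfrak A_{\theta,n+1}$, $a\oplus b\mapsto\mathrm{diag}(a,\ldots,a,b)\oplus a$ ($r_{n+1}^\theta$ copies of $a$ in the first summand) for $n\ge1$, and $\alpha_{\theta,0}(\lambda)=\mathrm{diag}(\lambda,\ldots,\lambda)\oplus\lambda$. Then $\mathfrak A_\theta=\varinjlim(\mathfrak A_{\theta,n},\alpha_{\theta,n})$, with canonical unital *-monomorphisms $\alpha_\theta^{(n)}:\mathfrak A_{\theta,n}\to\mathfrak A_\theta$. There is a unique faithful tracial state $\tau_\theta$ on $\mathfrak A_\theta$ with, for all $n\geq1$, $\tau_\theta\circ\alpha_\theta^{(n)}(a,b)=t(\theta,n)\frac1{q_n^\theta}\mathrm{Tr}(a)+(1-t(\theta,n))\frac1{q_{n-1}^\theta}\mathrm{Tr}(b)$, $t(\theta,n)=(-1)^{n-1}q_n^\theta(\theta q_{n-1}^\theta-p_{n-1}^\theta)\in(0,1)$. Seminorms. Let $E_m^{\tau_\theta}:\mathfrak A_\theta\to\alpha_\theta^{(m)}(\mathfrak A_{\theta,m})$ be the unique $\tau_\theta$-preserving faithful conditional expectation and $\|a\|_{E_m^{\tau_\theta}}=\sqrt{\|E_m^{\tau_\theta}(a^*a)\|_{\mathfrak A_\theta}}$. For $m\in\mathbb N$ put $\beta_\theta(m)=1/\dim(\mathfrak A_{\theta,m})=1/((q_m^\theta)^2+(q_{m-1}^\theta)^2)$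 and $$\kappa_{\theta,m}=\sqrt{\frac{\theta q_{m+1}^\theta-p_{m+1}^\theta}{(\theta q_{m-1}^\theta-p_{m-1}^\theta)\,r_{m+1}^\theta(r_{m+1}^\theta+1)^2}}.$$ For $n\geq1$ and $a\in\alpha_\theta^{(n)}(\mathfrak A_{\theta,n})$ set $$\mathsf L_{\theta,n}(a)=\max_{m\in\{0,\ldots,n-1\}}\frac{\max\{\|a-E_m^{\tau_\theta}(a)\|_{E_m^{\tau_\theta}},\|a^*-E_m^{\tau_\theta}(a^* )\|_{E_m^{\tau_\theta}}\}}{\kappa_{\theta,m}\beta_\theta(m)},$$ and $\mathsf L_{\theta,0}=0$. Here $\mathfrak A_{\theta,n}$ is identified with $\alpha_\theta^{(n)}(\mathfrak A_{\theta,n})$. An $\mathsf L_\theta$ with the property required in the claim exists for each $\theta$, and that property determines $(\mathfrak A_\theta,\mathsf L_\theta)$ up to full quantum isometry. *)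

(* Defs.v *)
From HB Require Import structures.
From mathcomp Require Import all_boot all_order all_algebra.
From mathcomp Require Import all_classical all_reals all_analysis.
From mathcomp Require Import complex ring lra.
Set Implicit Arguments.
Unset Strict Implicit.
Unset Printing Implicit Defensive.
Import Order.TTheory GRing.Theory Num.Theory.
Import numFieldNormedType.Exports.
Local Open Scope classical_set_scope.
Local Open Scope ring_scope.
Local Open Scope complex_scope.
Local Notation normc := Normc.normc.

HB.mixin Record isPreCStar (R : realType) A & GRing.Algebra R[i] A := {
  star : A -> A;
  cnorm : A -> R;
  starK : involutive star;
  starD : {morph star : x y / x + y};
  starZ : forall (c : R[i]) (x : A), star (c *: x) = c^* *: star x;
  starM : forall x y : A, star (x * y) = star y * star x;
  cnormD : forall x y : A, cnorm (x + y) <= cnorm x + cnorm y;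
  cnormZ : forall (c : R[i]) (x : A), cnorm (c *: x) = normc c * cnorm x;
  cnorm_eq0 : forall x : A, cnorm x = 0 -> x = 0;
  cnormM : forall x y : A, cnorm (x * y) <= cnorm x * cnorm y;
  cnorm_star : forall x : A, cnorm (star x * x) = cnorm x ^+ 2
}.

#[short(type="preCStarType")]
HB.structure Definition PreCStar (R : realType) :=
  {A of isPreCStar R A & GRing.Algebra R[i] A}.

(* A pre-C*-algebra with the topology of its norm. An alias is needed because
   the hierarchy has no common substructure of rings and normed modules other
   than numDomainType. *)
Definition ntop (R : realType) (A : preCStarType R) : Type := A.

Section NormTopology.
Variables (R : realType) (A : preCStarType R).

HB.instance Definition _ := GRing.Lmodule.on (ntop A).

Lemma ntop_normD (x y : ntop A) :
  (@cnorm R A (x + y))%:C <= (@cnorm R A x)%:C + (@cnorm R A y)%:C.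
Proof. by rewrite -rmorphD lecR cnormD. Qed.

Lemma ntop_normZ (c : R[i]) (x : ntop A) :
  (@cnorm R A (c *: x))%:C = `|c| * (@cnorm R A x)%:C.
Proof. by rewrite [in LHS]cnormZ rmorphM. Qed.

Lemma ntop_norm_eq0 (x : ntop A) : (@cnorm R A x)%:C = 0 -> x = 0.
Proof. by move=> /(congr1 (@complex.Re R)) /cnorm_eq0. Qed.

HB.instance Definition _ := Lmodule_isNormed.Build R[i] (ntop A)
  ntop_normD ntop_normZ ntop_norm_eq0.

End NormTopology.

HB.mixin Record PreCStar_isComplete (R : realType) A & PreCStar R A := {
  cstar_complete : forall F : set_system (ntop A),
    ProperFilter F -> cauchy F -> cvg F
}.

#[short(type="cstarType")]
HB.structure Definition CStar (R : realType) :=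
  {A of PreCStar_isComplete R A & PreCStar R A}.
HB.instance Definition _ (R : realType) (A : cstarType R) :=
  Uniform_isComplete.Build (ntop A) (@cstar_complete R A).

Section CompleteCoordinates.
Variables (R : realType) (V : normedModType R[i]) (K : finType).
Variable f : K -> V -> R[i].
Hypothesis fB : forall k x y, f k (x - y) = f k x - f k y.
Hypothesis f_le : forall k x, `|f k x| <= `|x|.
Hypothesis le_f : forall x, `|x| <= \sum_k `|f k x|.
Hypothesis f_surj : forall c : K -> R[i], exists x, forall k, f k x = c k.

Lemma real_coord_cvg (g : V -> R) (F : set_system V) :
  (forall x y, `|g x - g y|%:C <= `|x - y|) ->
  ProperFilter F -> cauchy F -> exists l : R, g y @[y --> F] --> l.
Proof.
move=> g_le FF /cauchy_ballP Fc; apply/cvg_ex.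
apply: R_complete; apply/cauchy_ballP => e e0.
have e0' : 0 < e%:C by rewrite ltcR.
rewrite near_map2.
apply: filterS (Fc _ e0') => -[x y] /=.
rewrite -!ball_normE /ball_ /= => xy.
by rewrite -ltcR (le_lt_trans _ xy).
Qed.

Lemma normc_ReIm (z : R[i]) : `|z| <= (`|complex.Re z| + `|complex.Im z|)%:C.
Proof.
rewrite [X in `|X|]complexE (le_trans (ler_normD _ _))// normrM rmorphD /=.
by rewrite normCi mul1r !normc_def /= !expr0n /= !addr0 !sqrtr_sqr.
Qed.

Lemma normc_ge_Im (z : R[i]) : `|complex.Im z|%:C <= `|z|.
Proof.
by rewrite normc_def lecR -sqrtr_sqr ler_sqrt ?addr_ge0 ?sqr_ge0// lerDr sqr_ge0.
Qed.

Lemma complete_coord (F : set_system V) : ProperFilter F -> cauchy F -> cvg F.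
Proof.
move=> FF Fc.
have cRe k : exists l : R, complex.Re (f k y) @[y --> F] --> l.
  apply: (@real_coord_cvg (fun y => complex.Re (f k y))) => // x y.
  rewrite -raddfB -fB; exact: le_trans (normc_ge_Re _) (f_le _ _).
have cIm k : exists l : R, complex.Im (f k y) @[y --> F] --> l.
  apply: (@real_coord_cvg (fun y => complex.Im (f k y))) => // x y.
  rewrite -raddfB -fB; exact: le_trans (normc_ge_Im _) (f_le _ _).
have [a aP] := choice cRe; have [b bP] := choice cIm.
have [x xP] := f_surj (fun k => a k +i* b k).
apply/cvg_ex; exists x; apply/cvgrPdist_lt => e e0.
have eE : e = (complex.Re e)%:C.
  by have := ger0_Im (ltW e0); case: (e) => u v /= ->.
have r0 : 0 < complex.Re e by rewrite -ltcR -eE.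
set d := complex.Re e / 2 / (#|K|.+1)%:R.
have d0 : 0 < d by rewrite !divr_gt0.
have H : F [set y | forall k, `|a k - complex.Re (f k y)| < d /\
     `|b k - complex.Im (f k y)| < d].
  apply: filter_forall => k; apply: filterI.
    by move/cvgrPdist_lt : (aP k); apply.
  by move/cvgrPdist_lt : (bP k); apply.
apply: filterS H => y yP /=.
apply: (le_lt_trans (le_f _)); rewrite eE.
apply: (@le_lt_trans _ _ (\sum_(k : K) (d + d)%:C)).
  apply: ler_sum => k _; rewrite fB xP.
  apply: (le_trans (normc_ReIm _)); rewrite lecR raddfB raddfB /=.
  by have [/ltW ? /ltW ?] := yP k; rewrite lerD.
rewrite sumr_const -rmorphMn ltcR.
have -> : d + d = complex.Re e / (#|K|.+1)%:R.
  by rewrite /d -mulrDl -splitr.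
rewrite -mulr_natr -mulrA gtr_pMr// mulrC ltr_pdivrMr// mul1r ltr_nat.
by [].
Qed.

End CompleteCoordinates.

Section OperatorNorm.
Variable R : realType.

Definition l2norm (n : nat) (x : 'cV[R[i]]_n) : R :=
  Num.sqrt (\sum_i normc (x i 0) ^+ 2).

Definition adjmx (m n : nat) (A : 'M[R[i]]_(m, n)) : 'M[R[i]]_(n, m) :=
  map_mx (@conjc R) A^T.

Definition opnorm (n : nat) (A : 'M[R[i]]_n) : R :=
  sup [set l2norm (A *m x) | x in [set x : 'cV_n | l2norm x <= 1]].

Lemma normc_ge0 (z : R[i]) : 0 <= normc z.
Proof. by case: z => a b; rewrite sqrtr_ge0. Qed.

Lemma normcTr (y z : R[i]) : normc (y + z) <= normc y + normc z.
Proof. exact: le_normcD. Qed.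

Lemma normc_sum (I : finType) (F : I -> R[i]) :
  normc (\sum_i F i) <= \sum_i normc (F i).
Proof.
elim/big_ind2: _ => [|x y x' y' h h'|//]; first by rewrite Normc.normc0.
exact: le_trans (normcTr _ _) (lerD h h').
Qed.

Lemma CauchySchwarz_sum n (a b : 'I_n -> R) :
  \sum_i a i * b i <= Num.sqrt (\sum_i a i ^+ 2) * Num.sqrt (\sum_i b i ^+ 2).
Proof.
set P := \sum_i a i * b i; set A := \sum_i a i ^+ 2; set B := \sum_i b i ^+ 2.
have A0 : 0 <= A by apply: sumr_ge0 => i _; rewrite sqr_ge0.
have B0 : 0 <= B by apply: sumr_ge0 => i _; rewrite sqr_ge0.
rewrite -sqrtrM//; apply: (le_trans (ler_norm _)).
rewrite -sqrtr_sqr ler_sqrt ?mulr_ge0//.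
have [Bz|Bn] := eqVneq B 0.
  have b0 i : b i = 0.
    move/eqP: Bz; rewrite psumr_eq0; last by move=> j _; rewrite sqr_ge0.
    by move/allP/(_ i (mem_index_enum _)) => /=; rewrite sqrf_eq0 => /eqP.
  by rewrite /P big1 ?expr0n ?mulr_ge0// => i _; rewrite b0 mulr0.
have Bp : 0 < B by rewrite lt_def Bn.
have : 0 <= \sum_i (B * a i - P * b i) ^+ 2.
  by apply: sumr_ge0 => i _; rewrite sqr_ge0.
have -> : \sum_i (B * a i - P * b i) ^+ 2 = B * (A * B - P ^+ 2).
  transitivity (\sum_i (B ^+ 2 * a i ^+ 2 - 2 * B * P * (a i * b i)
     + P ^+ 2 * b i ^+ 2)).
    by apply: eq_bigr => i _; ring.
  rewrite big_split big_split /= -!mulr_sumr -/A -/B sumrN -mulr_sumr -/P.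
  by ring.
by rewrite pmulr_rge0// subr_ge0.
Qed.

Section Vectors.
Variable n : nat.
Implicit Types x y : 'cV[R[i]]_n.

Lemma l2norm_ge0 x : 0 <= l2norm x. Proof. exact: sqrtr_ge0. Qed.

Lemma l2normE x : l2norm x ^+ 2 = \sum_i normc (x i 0) ^+ 2.
Proof. by rewrite sqr_sqrtr// sumr_ge0// => i _; rewrite sqr_ge0. Qed.

Lemma l2norm_coord x i : normc (x i 0) <= l2norm x.
Proof.
rewrite -[leLHS](ger0_norm (normc_ge0 _)) -sqrtr_sqr ler_sqrt.
  by rewrite (bigD1 i)//= lerDl sumr_ge0// => j _; rewrite sqr_ge0.
by rewrite sumr_ge0// => j _; rewrite sqr_ge0.
Qed.

Lemma l2norm_le_sum x : l2norm x <= \sum_i normc (x i 0).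
Proof.
have S0 : 0 <= \sum_i normc (x i 0).
  by rewrite sumr_ge0// => i _; rewrite normc_ge0.
rewrite -[leRHS](ger0_norm S0) -sqrtr_sqr ler_sqrt ?sqr_ge0//.
suff [] : 0 <= \sum_i normc (x i 0) /\
  \sum_i normc (x i 0) ^+ 2 <= (\sum_i normc (x i 0)) ^+ 2 by [].
elim/big_ind2: _ => [|a b c d [b0 ab] [d0 cd]|i _]; first by rewrite expr0n.
  by split; [rewrite addr_ge0|nra].
by split; [exact: normc_ge0|].
Qed.

Lemma l2norm_eq0 x : l2norm x = 0 -> x = 0.
Proof.
move=> x0; apply/matrixP => i j; rewrite ord1 mxE.
apply: Normc.eq0_normc; apply/le_anti; rewrite normc_ge0 andbT -x0.
exact: l2norm_coord.
Qed.

Lemma l2norm0 : l2norm (0 : 'cV_n) = 0.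
Proof.
rewrite /l2norm big1 ?sqrtr0// => i _.
by rewrite mxE Normc.normc0 expr0n.
Qed.

Lemma l2normZ c x : l2norm (c *: x) = normc c * l2norm x.
Proof.
rewrite /l2norm; under eq_bigr do rewrite mxE Normc.normcM exprMn.
by rewrite -mulr_sumr sqrtrM ?sqr_ge0// sqrtr_sqr ger0_norm// normc_ge0.
Qed.

Lemma l2normD x y : l2norm (x + y) <= l2norm x + l2norm y.
Proof.
have h : 0 <= l2norm x + l2norm y by rewrite addr_ge0// l2norm_ge0.
rewrite -[leRHS](ger0_norm h) -sqrtr_sqr ler_sqrt ?sqr_ge0//.
have le1 : \sum_i normc ((x + y) i 0) ^+ 2 <=
    \sum_i (normc (x i 0) + normc (y i 0)) ^+ 2.
  apply: ler_sum => i _; rewrite ler_pXn2r ?nnegrE ?addr_ge0 ?normc_ge0//.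
  by rewrite mxE normcTr.
apply: (le_trans le1).
have -> : \sum_i (normc (x i 0) + normc (y i 0)) ^+ 2 =
    l2norm x ^+ 2 + 2 * (\sum_i normc (x i 0) * normc (y i 0)) + l2norm y ^+ 2.
  rewrite !l2normE mulr_sumr -!big_split /=; apply: eq_bigr => i _; ring.
rewrite sqrrD lerD2r lerD2l -[leRHS]mulr_natl ler_wpM2l//.
exact: CauchySchwarz_sum.
Qed.

Lemma l2norm_delta j : l2norm (delta_mx j 0 : 'cV_n) <= 1.
Proof.
rewrite -sqrtr1 ler_sqrt// (bigD1 j)//= big1 ?addr0.
  by rewrite mxE !eqxx Normc.normc1 expr1n.
by move=> i ij; rewrite mxE (negbTE ij) (_ : false%:R = 0)// Normc.normc0 expr0n.
Qed.

Lemma adjmx_mul_le x y : normc ((adjmx x *m y) 0 0) <= l2norm x * l2norm y.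
Proof.
rewrite mxE; apply: (le_trans (normc_sum _)).
apply: le_trans (CauchySchwarz_sum _ _).
apply: ler_sum => i _; rewrite !mxE Normc.normcM.
by case: (x i 0) => a b /=; rewrite sqrrN.
Qed.

Lemma adjmx_mul_self x : (adjmx x *m x) 0 0 = (l2norm x ^+ 2)%:C.
Proof.
rewrite mxE l2normE rmorph_sum; apply: eq_bigr => i _; rewrite !mxE mulrC.
by rewrite -sqr_normc rmorphXn.
Qed.

End Vectors.

Lemma adjmxM m n p (A : 'M[R[i]]_(m, n)) (B : 'M[R[i]]_(n, p)) :
  adjmx (A *m B) = adjmx B *m adjmx A.
Proof. by rewrite /adjmx trmx_mul map_mxM. Qed.

Lemma adjmxK m n : cancel (@adjmx m n) (@adjmx n m).
Proof. by move=> A; apply/matrixP => i j; rewrite !mxE conjcK. Qed.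

Section Matrices.
Variable n : nat.
Implicit Types A B : 'M[R[i]]_n.

Lemma l2norm_mulmx_le A x :
  l2norm (A *m x) <= (\sum_i \sum_j normc (A i j)) * l2norm x.
Proof.
apply: (le_trans (l2norm_le_sum _)); rewrite mulr_suml; apply: ler_sum => i _.
rewrite mxE; apply: (le_trans (normc_sum _)).
rewrite mulr_suml; apply: ler_sum => j _.
by rewrite Normc.normcM ler_wpM2l ?normc_ge0 ?l2norm_coord.
Qed.

Lemma sum_normc_ge0 A : 0 <= \sum_i \sum_j normc (A i j).
Proof. by do 2!rewrite sumr_ge0// => ? _; exact: normc_ge0. Qed.

Lemma opnorm_le A (K : R) : 0 <= K ->
  (forall x, l2norm (A *m x) <= K * l2norm x) -> opnorm A <= K.
Proof.
move=> K0 AK; apply: ge_sup.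
  by exists (l2norm (A *m 0)); exists 0 => //=; rewrite l2norm0.
move=> _ [x /= x1 <-]; apply: (le_trans (AK x)).
by rewrite -[leRHS]mulr1 ler_wpM2l.
Qed.

Lemma opnorm_ub A x : l2norm x <= 1 -> l2norm (A *m x) <= opnorm A.
Proof.
move=> x1; apply: ub_le_sup; last by exists x.
exists (\sum_i \sum_j normc (A i j)) => _ [y /= y1 <-].
apply: (le_trans (l2norm_mulmx_le _ _)).
by rewrite -[leRHS]mulr1 ler_wpM2l// sum_normc_ge0.
Qed.

Lemma opnorm_ge0 A : 0 <= opnorm A.
Proof.
by apply: le_trans (@opnorm_ub A 0 _); rewrite ?l2norm_ge0// l2norm0.
Qed.

Lemma l2norm_opnorm A x : l2norm (A *m x) <= opnorm A * l2norm x.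
Proof.
have [/l2norm_eq0 ->|x0] := eqVneq (l2norm x) 0.
  by rewrite mulmx0 !l2norm0 mulr0.
have xp : 0 < l2norm x by rewrite lt_def x0 l2norm_ge0.
rewrite -ler_pdivrMr//.
have nE : normc ((l2norm x)^-1)%:C = (l2norm x)^-1.
  by rewrite /= expr0n /= addr0 sqrtr_sqr gtr0_norm ?invr_gt0.
have := @opnorm_ub A (((l2norm x)^-1)%:C *: x).
rewrite -scalemxAr !l2normZ nE mulVf// => /(_ (lexx _)).
by rewrite mulrC.
Qed.

Lemma opnorm_entry A i j : normc (A i j) <= opnorm A.
Proof.
apply: le_trans (opnorm_ub A (l2norm_delta j)).
apply: le_trans (l2norm_coord _ i).
by rewrite -colE mxE.
Qed.

Lemma opnorm_le_sum A : opnorm A <= \sum_i \sum_j normc (A i j).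
Proof. by apply: opnorm_le; [exact: sum_normc_ge0|exact: l2norm_mulmx_le]. Qed.

Lemma opnorm_eq0 A : opnorm A = 0 -> A = 0.
Proof.
move=> A0; apply/matrixP => i j; rewrite mxE; apply: Normc.eq0_normc.
by apply/le_anti; rewrite normc_ge0 andbT -A0 opnorm_entry.
Qed.

Lemma opnormD A B : opnorm (A + B) <= opnorm A + opnorm B.
Proof.
apply: opnorm_le => [|x]; first by rewrite addr_ge0// opnorm_ge0.
rewrite mulmxDl mulrDl (le_trans (l2normD _ _))//.
by rewrite lerD// l2norm_opnorm.
Qed.

Lemma opnormZ_le c A : opnorm (c *: A) <= normc c * opnorm A.
Proof.
apply: opnorm_le => [|x]; first by rewrite mulr_ge0// ?normc_ge0 ?opnorm_ge0.
by rewrite -scalemxAl l2normZ -mulrA ler_wpM2l ?normc_ge0// l2norm_opnorm.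
Qed.

Lemma opnormZ c A : opnorm (c *: A) = normc c * opnorm A.
Proof.
apply/le_anti; rewrite opnormZ_le /=.
have [->|c0] := eqVneq c 0; first by rewrite Normc.normc0 mul0r opnorm_ge0.
have nc0 : 0 < normc c.
  rewrite lt_def normc_ge0 andbT; apply: contra c0 => /eqP h.
  by apply/eqP/Normc.eq0_normc.
have := opnormZ_le c^-1 (c *: A).
by rewrite scalerA mulVf// scale1r Normc.normcV mulrC ler_pdivlMr// mulrC.
Qed.

Lemma opnormM A B : opnorm (A *m B) <= opnorm A * opnorm B.
Proof.
apply: opnorm_le => [|x]; first by rewrite mulr_ge0// opnorm_ge0.
rewrite -mulmxA (le_trans (l2norm_opnorm _ _))//.
by rewrite -mulrA ler_wpM2l ?opnorm_ge0// l2norm_opnorm.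
Qed.

Lemma opnorm_sqr_le A : opnorm A ^+ 2 <= opnorm (adjmx A *m A).
Proof.
set K := opnorm (adjmx A *m A).
have K0 : 0 <= K by exact: opnorm_ge0.
rewrite -(sqr_sqrtr K0) ler_pXn2r ?nnegrE ?opnorm_ge0 ?sqrtr_ge0//.
apply: opnorm_le => [|x]; first exact: sqrtr_ge0.
have h : 0 <= Num.sqrt K * l2norm x by rewrite mulr_ge0 ?sqrtr_ge0 ?l2norm_ge0.
rewrite -(@ler_pXn2r _ 2) ?nnegrE ?l2norm_ge0// exprMn (sqr_sqrtr K0).
have -> : l2norm (A *m x) ^+ 2 = normc ((adjmx (A *m x) *m (A *m x)) 0 0).
  by rewrite adjmx_mul_self /= expr0n /= addr0 sqrtr_sqr ger0_norm ?sqr_ge0.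
rewrite adjmxM -mulmxA (mulmxA _ A).
apply: (le_trans (adjmx_mul_le _ _)).
rewrite expr2 mulrA mulrC ler_wpM2r ?l2norm_ge0//.
exact: l2norm_opnorm.
Qed.

Lemma opnorm_le_adj A : opnorm A <= opnorm (adjmx A).
Proof.
have [->|A0] := eqVneq (opnorm A) 0; first exact: opnorm_ge0.
have Ap : 0 < opnorm A by rewrite lt_def A0 opnorm_ge0.
by rewrite -(ler_pM2r Ap) -expr2 (le_trans (opnorm_sqr_le _))// opnormM.
Qed.

Lemma opnorm_cstar A : opnorm (adjmx A *m A) = opnorm A ^+ 2.
Proof.
apply/le_anti; rewrite opnorm_sqr_le andbT (le_trans (opnormM _ _))// expr2.
by rewrite ler_wpM2r ?opnorm_ge0// -[in leRHS](adjmxK A) opnorm_le_adj.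
Qed.

End Matrices.
End OperatorNorm.

(* M_k (+) M_l with its C*-norm. The summand M_l may be the zero algebra; the
   proof argument makes the sum a nonzero ring. *)
Definition mxsum (R : realType) (k l : nat) (k_gt0 : (0 < k)%N) : Type :=
  ('M[R[i]]_k * 'M[R[i]]_l)%type.

Section MatrixSum.
Variables (R : realType) (k l : nat) (k_gt0 : (0 < k)%N).
Local Notation T := (mxsum R l k_gt0).

HB.instance Definition _ := GRing.Lmodule.copy T ('M[R[i]]_k * 'M[R[i]]_l)%type.

Definition mxsum_mul (x y : T) : T := (x.1 *m y.1, x.2 *m y.2).
Definition mxsum_one : T := (1%:M, 1%:M).

Lemma mxsum_mulA : associative mxsum_mul.
Proof. by move=> x y z; rewrite /mxsum_mul /= !mulmxA. Qed.
Lemma mxsum_mul1 : left_id mxsum_one mxsum_mul.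
Proof. by case=> a b; rewrite /mxsum_mul /= !mul1mx. Qed.
Lemma mxsum_mulr1 : right_id mxsum_one mxsum_mul.
Proof. by case=> a b; rewrite /mxsum_mul /= !mulmx1. Qed.
Lemma mxsum_mulDl : left_distributive mxsum_mul +%R.
Proof. by move=> x y z; rewrite /mxsum_mul /= !mulmxDl. Qed.
Lemma mxsum_mulDr : right_distributive mxsum_mul +%R.
Proof. by move=> x y z; rewrite /mxsum_mul /= !mulmxDr. Qed.
Lemma mxsum_one_neq0 : mxsum_one != 0.
Proof.
apply/eqP => /(congr1 fst) /matrixP /(_ (Ordinal k_gt0) (Ordinal k_gt0)).
by rewrite !mxE eqxx => /eqP; rewrite oner_eq0.
Qed.

HB.instance Definition _ := GRing.Zmodule_isNzRing.Build T
  mxsum_mulA mxsum_mul1 mxsum_mulr1 mxsum_mulDl mxsum_mulDr mxsum_one_neq0.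

Lemma mxsum_scaleAl (c : R[i]) (x y : T) : c *: (x * y) = c *: x * y.
Proof. by congr pair; rewrite -scalemxAl. Qed.
Lemma mxsum_scaleAr (c : R[i]) (x y : T) : c *: (x * y) = x * (c *: y).
Proof. by congr pair; rewrite -scalemxAr. Qed.

HB.instance Definition _ := GRing.Lmodule_isLalgebra.Build R[i] T mxsum_scaleAl.
HB.instance Definition _ := GRing.Lalgebra_isAlgebra.Build R[i] T mxsum_scaleAr.

Definition mxsum_star (x : T) : T := (adjmx x.1, adjmx x.2).
Definition mxsum_norm (x : T) : R := Num.max (opnorm x.1) (opnorm x.2).

Lemma mxsum_starK : involutive mxsum_star.
Proof. by case=> a b; rewrite /mxsum_star /= !adjmxK. Qed.
Lemma mxsum_starD : {morph mxsum_star : x y / x + y}.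
Proof. by move=> x y; rewrite /mxsum_star /adjmx /= !linearD /= !map_mxD. Qed.
Lemma mxsum_starZ (c : R[i]) (x : T) : mxsum_star (c *: x) = c^* *: mxsum_star x.
Proof. by rewrite /mxsum_star /adjmx /= !linearZ /= !map_mxZ. Qed.
Lemma mxsum_starM (x y : T) : mxsum_star (x * y) = mxsum_star y * mxsum_star x.
Proof. by congr pair; rewrite adjmxM. Qed.

Lemma mxsum_normD (x y : T) : mxsum_norm (x + y) <= mxsum_norm x + mxsum_norm y.
Proof.
rewrite /mxsum_norm ge_max; apply/andP; split;
  by rewrite (le_trans (opnormD _ _))// lerD// le_max lexx ?orbT.
Qed.
Lemma mxsum_normZ (c : R[i]) (x : T) :
  mxsum_norm (c *: x) = normc c * mxsum_norm x.
Proof. by rewrite /mxsum_norm /= !opnormZ maxr_pMr// normc_ge0. Qed.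
Lemma mxsum_norm_eq0 (x : T) : mxsum_norm x = 0 -> x = 0.
Proof.
case: x => a b n0.
have h : (opnorm a <= 0) && (opnorm b <= 0) by rewrite -ge_max -n0.
by move: h => /andP[ha hb]; congr pair; apply: opnorm_eq0;
  apply/le_anti; rewrite ?ha ?hb opnorm_ge0.
Qed.
Lemma mxsum_norm_ge0 (x : T) : 0 <= mxsum_norm x.
Proof. by rewrite le_max opnorm_ge0. Qed.
Lemma mxsum_normM (x y : T) : mxsum_norm (x * y) <= mxsum_norm x * mxsum_norm y.
Proof.
rewrite [leLHS]/mxsum_norm ge_max; apply/andP; split;
  by rewrite (le_trans (opnormM _ _))// ler_pM ?opnorm_ge0// le_max lexx ?orbT.
Qed.
Lemma mxsum_norm_star (x : T) : mxsum_norm (mxsum_star x * x) = mxsum_norm x ^+ 2.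
Proof.
rewrite /mxsum_norm /= !opnorm_cstar.
case: (leP (opnorm x.1) (opnorm x.2)) => h.
  by rewrite max_r// ler_pXn2r ?nnegrE ?opnorm_ge0.
by rewrite max_l// ler_pXn2r ?nnegrE ?opnorm_ge0// ltW.
Qed.

HB.instance Definition _ := isPreCStar.Build R T mxsum_starK mxsum_starD
  mxsum_starZ mxsum_starM mxsum_normD mxsum_normZ mxsum_norm_eq0 mxsum_normM
  mxsum_norm_star.

Let entry (e : 'I_k * 'I_k + 'I_l * 'I_l) (x : ntop T) : R[i] :=
  match e with inl e => x.1 e.1 e.2 | inr e => x.2 e.1 e.2 end.

Lemma mxsum_complete (F : set_system (ntop T)) :
  ProperFilter F -> cauchy F -> cvg F.
Proof.
apply: (@complete_coord R (ntop T) _ entry) => [[] e x y|[] e x|x|c].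
- by rewrite /entry (_ : (x - y).1 = x.1 - y.1)// !mxE.
- by rewrite /entry (_ : (x - y).2 = x.2 - y.2)// !mxE.
- by rewrite lecR le_max opnorm_entry.
- by rewrite lecR le_max opnorm_entry orbT.
- rewrite big_sumType /= -rmorph_sum -rmorph_sum -rmorphD lecR.
  have -> : \sum_(i : 'I_k * 'I_k) normc (x.1 i.1 i.2) =
    \sum_i \sum_j normc (x.1 i j) by rewrite pair_big.
  have -> : \sum_(i : 'I_l * 'I_l) normc (x.2 i.1 i.2) =
    \sum_i \sum_j normc (x.2 i j) by rewrite pair_big.
  rewrite ge_max; apply/andP; split.
    by rewrite (le_trans (opnorm_le_sum _))// lerDl sum_normc_ge0.
  by rewrite (le_trans (opnorm_le_sum _))// lerDr sum_normc_ge0.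
- exists (\matrix_(i, j) c (inl (i, j)), \matrix_(i, j) c (inr (i, j))).
  by case=> -[i j]; rewrite /= mxE.
Qed.

HB.instance Definition _ := PreCStar_isComplete.Build R T mxsum_complete.

End MatrixSum.

Section QuantumCompactMetricSpaces.
Variable R : realType.
Implicit Types A B D : cstarType R.

Definition selfadjoint A : set A := [set a | star a = a].
Arguments selfadjoint : clear implicits.

Definition jordan A (a b : A) : A := 2^-1 *: (a * b + b * a).

Definition lie A (a b : A) : A := (2 * 'i)^-1 *: (a * b - b * a).

(* The weak* topology is the topology of pointwise convergence; as a type,
   [state_space A] carries the corresponding subset topology. *)
Definition state_space A : set {ptws A -> R[i]^o} :=
  [set phi | [/\ linear (phi : A -> R[i]^o),
                 forall a : A, 0 <= phi (star a * a) & phi 1 = 1]].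
Arguments state_space : clear implicits.

(* A seminorm defined on the subset [ldom] of A; the values of [lval] outside
   of [ldom] are never used. *)
Record partial_seminorm A := PartialSeminorm {
  ldom : set A;
  lval :> A -> R
}.

Definition mk A (L : partial_seminorm A) (phi psi : state_space A) : \bar R :=
  ereal_sup [set (normc (val phi a - val psi a))%:E |
             a in [set a | ldom L a /\ L a <= 1]].

Definition metrizes_weak_star A (d : state_space A -> state_space A -> \bar R)
    : Prop :=
  [/\ forall phi psi, d phi psi \is a fin_num,
      forall phi psi, d phi psi = 0%E -> phi = psi &
      forall phi, nbhs phi =
        [set U | exists2 e : R, 0 < e & [set psi | (d phi psi < e%:E)%E] `<=` U]].

(* [c%:C%:A] is the scalar multiple c1 of the unit. *)
Record is_qcms A (L : partial_seminorm A) : Prop := {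
  qcms_selfadjoint : ldom L `<=` selfadjoint A;
  qcms_dom0 : ldom L 0;
  qcms_domD : forall a b, ldom L a -> ldom L b -> ldom L (a + b);
  qcms_domZ : forall (t : R) a, ldom L a -> ldom L (t%:C *: a);
  qcms_dom_jordan : forall a b, ldom L a -> ldom L b -> ldom L (jordan a b);
  qcms_dom_lie : forall a b, ldom L a -> ldom L b -> ldom L (lie a b);
  qcms_dense : selfadjoint A `<=` closure (ldom L : set (ntop A));
  qcms_ge0 : forall a, ldom L a -> 0 <= L a;
  qcms_triangle : forall a b, ldom L a -> ldom L b -> L (a + b) <= L a + L b;
  qcms_homogeneous : forall (t : R) a, ldom L a -> L (t%:C *: a) = `|t| * L a;
  qcms_kernel : [set a | ldom L a /\ L a = 0] = [set t%:C%:A | t in [set: R]];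
  qcms_mk : metrizes_weak_star (mk L);
  qcms_leibniz : forall a b, ldom L a -> ldom L b ->
    Num.max (L (jordan a b)) (L (lie a b)) <= L a * cnorm b + cnorm a * L b;
  qcms_closed : closed ([set a | ldom L a /\ L a <= 1] : set (ntop A))
}.

Definition strongly_leibniz A (L : partial_seminorm A) : Prop :=
  forall a b : A, ldom L a -> a * b = 1 -> b * a = 1 ->
    ldom L b /\ L b <= cnorm b ^+ 2 * L a.

Definition star_morphism A B (f : A -> B) : Prop :=
  [/\ linear f, {morph f : x y / x * y} & {morph f : x / star x}].

Definition unital_star_morphism A B (f : A -> B) : Prop :=
  star_morphism f /\ f 1 = 1.

Definition quantum_isometry A B (LA : partial_seminorm A)
    (LB : partial_seminorm B) (f : A -> B) : Prop :=
  [/\ star_morphism f,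
      forall b, exists a, f a = b,
      f @` ldom LA `<=` ldom LB &
      forall b, ldom LB b ->
        (LB b)%:E = ereal_inf [set (LA a)%:E |
                               a in [set a | ldom LA a /\ f a = b]]].

Definition pullback_states D A (f : D -> A) : set (state_space D) :=
  [set phi | exists psi : state_space A, forall d, val phi d = val psi (f d)].

Definition hausdorff_dist (X : Type) (d : X -> X -> \bar R) (S T : set X)
    : \bar R :=
  maxe (ereal_sup [set ereal_inf [set d x y | y in T] | x in S])
       (ereal_sup [set ereal_inf [set d x y | x in S] | y in T]).

Definition is_tunnel A1 A2 (L1 : partial_seminorm A1)
    (L2 : partial_seminorm A2) D (L : partial_seminorm D)
    (p1 : D -> A1) (p2 : D -> A2) : Prop :=
  [/\ is_qcms L, quantum_isometry L L1 p1 & quantum_isometry L L2 p2].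

Definition extent A1 A2 D (L : partial_seminorm D)
    (p1 : D -> A1) (p2 : D -> A2) : \bar R :=
  maxe (hausdorff_dist (mk L) setT (pullback_states p1))
       (hausdorff_dist (mk L) setT (pullback_states p2)).

Definition LambdaSL A1 A2 (L1 : partial_seminorm A1)
    (L2 : partial_seminorm A2) : \bar R :=
  ereal_inf [set e | exists (D : cstarType R) (L : partial_seminorm D)
                            (p1 : D -> A1) (p2 : D -> A2),
    [/\ is_tunnel L1 L2 L p1 p2, strongly_leibniz L & e = extent L p1 p2]].

Definition cocone (A_ : nat -> cstarType R) (f : forall n, A_ n -> A_ n.+1)
    B (h : forall n, A_ n -> B) : Prop :=
  (forall n, unital_star_morphism (h n)) /\
  (forall n x, h n.+1 (f n x) = h n x).

Definition inductive_limit (A_ : nat -> cstarType R)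
    (f : forall n, A_ n -> A_ n.+1) A (g : forall n, A_ n -> A) : Prop :=
  cocone f g /\
  forall B (h : forall n, A_ n -> B), cocone f h ->
    exists! k : A -> B,
      unital_star_morphism k /\ (forall n x, k (g n x) = h n x).

(* Positive elements are written c^* c. *)
Record conditional_expectation A (S : set A) (E : A -> A) : Prop := {
  cexp_linear : linear E;
  cexp_range : forall a, S (E a);
  cexp_id : forall b, S b -> E b = b;
  cexp_contractive : forall a, cnorm (E a) <= cnorm a;
  cexp_positive : forall a, exists c, E (star a * a) = star c * c;
  cexp_bimodule : forall a b c, S b -> S c -> E (b * a * c) = b * E a * c
}.

Definition cexp_norm A (E : A -> A) (a : A) : R :=
  Num.sqrt (cnorm (E (star a * a))).

End QuantumCompactMetricSpaces.
Arguments selfadjoint {R} A.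
Arguments state_space {R} A.

Record quotients := Quotients {
  quot :> nat -> nat;
  quot0 : quot 0 = 0%N;
  quot_gt0 : forall n, (0 < quot n.+1)%N
}.

Section EffrosShen.
Variable R : realType.

(* [cf_value r n] is the finite continued fraction [r 0; r 1, ..., r n]. *)
Fixpoint cf_value (r : nat -> nat) (n : nat) : R :=
  match n with
  | 0 => (r 0)%:R
  | n'.+1 => (r 0)%:R + (cf_value (fun k => r k.+1) n')^-1
  end.

(* [cf_den r n] is (q_n, q_(n-1)) and [cf_num r n] is (p_n, p_(n-1)), starting
   from (q_0, q_(-1)) = (1, 0) and (p_0, p_(-1)) = (0, 1). *)
Fixpoint cf_den (r : nat -> nat) (n : nat) : nat * nat :=
  if n is n'.+1 then
    ((r n * (cf_den r n').1 + (cf_den r n').2)%N, (cf_den r n').1)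
  else (1%N, 0%N).

Fixpoint cf_num (r : nat -> nat) (n : nat) : nat * nat :=
  if n is n'.+1 then
    ((r n * (cf_num r n').1 + (cf_num r n').2)%N, (cf_num r n').1)
  else (0%N, 1%N).

Lemma cf_den_gt0 (r : quotients) n : (0 < (cf_den r n).1)%N.
Proof.
by elim: n => //= n IH; rewrite addn_gt0 muln_gt0 quot_gt0 IH.
Qed.

(* M_(q_n) (+) M_(q_(n-1)); for n = 0 this is M_1 (+) M_0, i.e. the complex
   numbers. *)
Definition es_stage (r : quotients) (n : nat) : cstarType R :=
  mxsum R (cf_den r n).2 (cf_den_gt0 r n).

(* diag(a, ..., a) with k copies of a *)
Fixpoint diag_copies (q k : nat) (a : 'M[R[i]]_q) : 'M[R[i]]_(k * q) :=
  if k is k'.+1 then block_mx a 0 0 (diag_copies k' a) else 0.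

Definition es_map (r : quotients) (n : nat) (x : es_stage r n)
    : es_stage r n.+1 :=
  (block_mx (diag_copies (r n.+1) x.1) 0 0 x.2, x.1).

(* theta q_n - p_n and theta q_(n-1) - p_(n-1) *)
Definition cf_err (th : R) (r : nat -> nat) (n : nat) : R :=
  th * (cf_den r n).1%:R - (cf_num r n).1%:R.

Definition cf_err_prev (th : R) (r : nat -> nat) (n : nat) : R :=
  th * (cf_den r n).2%:R - (cf_num r n).2%:R.

(* t(theta, n+1) *)
Definition es_weightS (th : R) (r : nat -> nat) (n : nat) : R :=
  (-1) ^+ n * (cf_den r n.+1).1%:R * cf_err_prev th r n.+1.

Definition es_beta (r : nat -> nat) (m : nat) : R :=
  ((cf_den r m).1 ^ 2 + (cf_den r m).2 ^ 2)%N%:R^-1.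

Definition es_kappa (th : R) (r : nat -> nat) (m : nat) : R :=
  Num.sqrt (cf_err th r m.+1 /
    (cf_err_prev th r m * (r m.+1)%:R * (r m.+1).+1%:R ^+ 2)).

(* The trace and the conditional expectations are uniquely determined by the
   conditions imposed on them. *)
Record effros_shen (th : R) := EffrosShen {
  es_quot : quotients;
  es_expansion : cf_value es_quot n @[n --> \oo] --> th;
  es_alg :> cstarType R;
  es_inj : forall n, es_stage es_quot n -> es_alg;
  es_limit : inductive_limit (@es_map es_quot) es_inj;
  es_inj_injective : forall n, injective (@es_inj n);
  es_trace : es_alg -> R[i];
  es_trace_state : state_space es_alg es_trace;
  es_trace_tracial : forall a b, es_trace (a * b) = es_trace (b * a);
  es_trace_faithful : forall a, es_trace (star a * a) = 0 -> a = 0;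
  es_traceE : forall n (x : es_stage es_quot n.+1),
    es_trace (es_inj x) =
      (es_weightS th es_quot n / (cf_den es_quot n.+1).1%:R)%:C * \tr x.1 +
      ((1 - es_weightS th es_quot n) / (cf_den es_quot n.+1).2%:R)%:C * \tr x.2;
  es_cexp : nat -> es_alg -> es_alg;
  es_cexpP : forall m, conditional_expectation (range (@es_inj m)) (es_cexp m);
  es_cexp_trace : forall m a, es_trace (es_cexp m a) = es_trace a;
  es_cexp_faithful : forall m a, es_cexp m (star a * a) = 0 -> a = 0
}.

Definition es_lip (th : R) (A : effros_shen th) (n : nat)
    (x : es_stage (es_quot A) n) : R :=
  let a := es_inj x in
  \big[Num.max/0]_(m < n)
    (Num.max (cexp_norm (es_cexp m) (a - es_cexp m a))
             (cexp_norm (es_cexp m) (star a - es_cexp m (star a)))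
     / (es_kappa th (es_quot A) m * es_beta (es_quot A) m)).

Definition es_seminorm (th : R) (A : effros_shen th) (n : nat)
    : partial_seminorm (es_stage (es_quot A) n) :=
  PartialSeminorm (selfadjoint _) (@es_lip th A n).

Definition irrational01 : set R := [set th | 0 < th < 1 /\ irrational th].

End EffrosShen.
Arguments irrational01 : clear implicits.

(* Main.v *)
(* When theta' is close to theta, their first n + 1 partial quotients agree, so
   the stages of index n + 1 are the same algebra M_q (+) M_q', and only the
   weights of the trace and the constants kappa change, continuously. With
   ||x||_2 the norm of the trace, one has ||a - E_m a||_{E_m} <= K iff every b in
   the m-th stage admits a c in the m-th stage with ||ab - c||_2 <= K ||b||_2.
   Hence a small change of the weights multiplies the seminorm of the stage by a
   factor close to 1.

   Two tunnels D1 and D2, from the limit algebras of theta and theta' to this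
   stage, are composed as in the triangle inequality for the propinquity: the
   direct sum of D1 and D2 carries the seminorm
     max(L1(d1), L2(d2), ||f d1 - g d2|| / delta),
   where f and g map to the common stage. It is strongly Leibniz because L1 and
   L2 are; the seminorms of the stages only need to be comparable. The extents of
   D1 and D2 are small uniformly in theta' because beta(j) <= 2^-j. *)
From HB Require Import structures.
Require Import Defs.
From mathcomp Require Import all_boot all_order all_algebra.
From mathcomp Require Import all_classical all_reals all_analysis.
From mathcomp Require Import complex ring lra zify.
Set Implicit Arguments.
Unset Strict Implicit.
Unset Printing Implicit Defensive.
Import Order.TTheory GRing.Theory Num.Theory.
Import numFieldNormedType.Exports.
Local Open Scope classical_set_scope.
Local Open Scope ring_scope.
Local Open Scope complex_scope.
Local Notation normc := Normc.normc.

(** * C*-algebras and positive functionals *)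

(** The triangle inequality cannot be applied with the common stage as middle space, since theta and
    theta' put two different seminorms on it. As these are comparable up to a factor, an element of
    the stage is contracted towards a scalar by the inverse of that factor before it is lifted to
    the other side. The move costs a multiple of the distance to the scalars, which the term m = 0
    of the seminorm bounds by C times the seminorm; delta absorbs it. Both directions contract in
    the stage of theta, so C belongs to the fixed theta and the neighbourhood of theta can be chosen
    after it. The conditional expectations of theta and theta' act on different algebras and
    preserve different traces, so they are never compared directly. The L^2 criterion removes them:
    it mentions only products, the substage and the two weights of the trace. Its delicate direction
    recovers an operator norm from L^2 estimates without picking up the constant that relates the
    two norms. *)

Lemma ntop_lt (R : realType) (A : preCStarType R) (x : A) (t : R) :
  (`|x : ntop A| < t%:C) = (cnorm x < t).
Proof. by rewrite ltcR. Qed.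

Lemma conj_imaginary (R : realType) : Num.conj 'i = - 'i :> R[i].
Proof. by apply/eqP; rewrite eq_complex /= oppr0 !eqxx. Qed.

Section CStarBasics.
Variables (R : realType) (A : cstarType R).
Implicit Types (x y a s : A) (t : R).

Lemma star0 : star (0 : A) = 0.
Proof. by rewrite -(scale0r (0 : A)) starZ rmorph0 !scale0r. Qed.

Lemma starN x : star (- x) = - star x.
Proof. by rewrite -scaleN1r starZ rmorphN rmorph1 scaleN1r. Qed.

Lemma starB x y : star (x - y) = star x - star y.
Proof. by rewrite starD starN. Qed.

Lemma star1 : star (1 : A) = 1.
Proof. by rewrite -[LHS]mulr1 -{2}[1](starK (1 : A)) -starM mulr1 starK. Qed.

Lemma starZr t x : star (t%:C *: x) = t%:C *: star x.
Proof. by rewrite starZ; congr (_ *: _); exact: conjc_real. Qed.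

Lemma normcr t : normc t%:C = `|t|.
Proof. by rewrite /= expr0n /= addr0 sqrtr_sqr. Qed.

Lemma cnormZr t x : cnorm (t%:C *: x) = `|t| * cnorm x.
Proof. by rewrite cnormZ normcr. Qed.

Lemma cnorm0 : cnorm (0 : A) = 0.
Proof. by rewrite -(scale0r (0 : A)) cnormZ Normc.normc0 mul0r. Qed.

Lemma cnormN x : cnorm (- x) = cnorm x.
Proof.
rewrite -scaleN1r (_ : -1 = (-1 : R)%:C) ?cnormZr ?normrN1 ?mul1r//.
by rewrite rmorphN rmorph1.
Qed.

Lemma cnorm_ge0 x : 0 <= cnorm x.
Proof.
have := cnormD x (- x); rewrite subrr cnorm0 cnormN.
by rewrite -mulr2n pmulrn_lge0.
Qed.

Lemma cnormB x y : cnorm (x - y) <= cnorm x + cnorm y.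
Proof. by rewrite (le_trans (cnormD _ _))// cnormN. Qed.

Lemma cnormC x y : cnorm (x - y) = cnorm (y - x).
Proof. by rewrite -cnormN opprB. Qed.

(** By the C*-identity and submultiplicativity, the square of ||y|| is at most ||[star y]|| ||y||;
    the involution exchanges the two sides. *)
Lemma cnorm_starE x : cnorm (star x) = cnorm x.
Proof.
suff H y : cnorm y <= cnorm (star y).
  by apply/le_anti; rewrite H andbT -{2}(starK x) H.
have [->|y0] := eqVneq (cnorm y) 0; first exact: cnorm_ge0.
have yp : 0 < cnorm y by rewrite lt_def y0 cnorm_ge0.
by rewrite -(ler_pM2r yp) -expr2 -cnorm_star cnormM.
Qed.

Lemma cnorm1 : cnorm (1 : A) = 1.
Proof.
have := cnorm_star (1 : A); rewrite star1 mulr1 => /eqP.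
rewrite expr2 -{1}[cnorm 1]mulr1 => /eqP /mulfI -> //.
by apply: contraNneq (oner_neq0 A) => /cnorm_eq0 ->.
Qed.

Lemma cnorm_scalar t : cnorm (t%:C%:A : A) = `|t|.
Proof. by rewrite cnormZr cnorm1 mulr1. Qed.

(** Norms on [ntop] take values in [R[i]], so radii of balls are complex numbers; positivity makes
    them real. *)
Lemma gt0_complexE (e : R[i]) : 0 < e -> exists2 t : R, 0 < t & e = t%:C.
Proof.
move=> e0.
have eE : e = (complex.Re e)%:C.
  by have := ger0_Im (ltW e0); case: (e) => u v /= ->.
by exists (complex.Re e); rewrite // -ltcR -eE.
Qed.

Lemma cstar_closureP (S : set A) x :
  closure (S : set (ntop A)) x <->
  forall e : R, 0 < e -> exists2 y, S y & cnorm (x - y) < e.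
Proof.
split=> [Sx e e0|H U /nbhs_ballP[e /= /gt0_complexE[t t0 ->] etU]].
  have [] := Sx (ball (x : ntop A) e%:C).
    by apply: nbhsx_ballx; rewrite ltcR.
  by move=> y []; rewrite -ball_normE /= ntop_lt => Sy xy; exists y.
have [y Sy xy] := H t t0; exists y; split => //; apply: etU.
by rewrite -ball_normE /= ntop_lt.
Qed.

Lemma cstar_cauchy_cvg (u : nat -> A) :
  (forall e : R, 0 < e -> exists N, forall m n, (N <= m)%N -> (N <= n)%N ->
     cnorm (u m - u n) < e) ->
  exists l, forall e : R, 0 < e -> \forall n \near \oo, cnorm (l - u n) < e.
Proof.
move=> H.
have : cvg ((u : nat -> ntop A) @ \oo).
  apply/cauchy_cvgP/cauchy_ballP => _ /gt0_complexE[t t0 ->].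
  have [N HN] := H t t0; near_simpl.
  exists ([set n | (N <= n)%N], [set n | (N <= n)%N]) => /=.
    by split; exists N.
  move=> [m n] /= [Nm Nn]; rewrite -ball_normE /= ntop_lt.
  exact: HN.
move=> /cvg_ex[l /cvgrPdist_lt ul]; exists l => e e0.
have := ul e%:C; rewrite ltcR => /(_ e0).
by apply: filterS => n; rewrite -ntop_lt.
Qed.

Lemma cnorm_lim_eq x y :
  (forall e : R, 0 < e -> cnorm (x - y) < e) -> x = y.
Proof.
move=> H; apply/eqP; rewrite -subr_eq0; apply/eqP/cnorm_eq0/le_anti.
rewrite cnorm_ge0 andbT; apply/ler_addgt0Pl => e e0.
by rewrite addr0 ltW// H.
Qed.

(* The square root of 1 - x is 1 - y, where y = (x + y^2)/2 is the fixed point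
   of a contraction of the ball of radius ||x||. *)
Section SquareRoot.
Variable x : A.
Hypotheses (xs : star x = x) (x1 : cnorm x < 1).
Let r := cnorm x.
Let step y : A := (2^-1 : R)%:C *: (x + y * y).
Let y_ n := iter n step 0.

Let step_ball y : cnorm y <= r -> cnorm (step y) <= r.
Proof.
move=> yr; rewrite cnormZr ger0_norm; last by rewrite invr_ge0.
have h := le_trans (cnormD x (y * y)) (lerD (lexx _) (cnormM y y)).
have y0 := cnorm_ge0 y; have r0 : 0 <= r := cnorm_ge0 x.
move: h yr y0 r0 x1; rewrite -/r; move: (cnorm _) (cnorm y) => u v.
nra.
Qed.

Let step_contr y z : cnorm y <= r -> cnorm z <= r ->
  cnorm (step y - step z) <= r * cnorm (y - z).
Proof.
move=> yr zr; rewrite /step -scalerBr cnormZr ger0_norm; last by rewrite invr_ge0.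
(* The difference of squares is factored without commutativity; each of the two terms contributes r,
   and the factor 1/2 leaves the Lipschitz constant r. *)
have -> : x + y * y - (x + z * z) = y * (y - z) + (y - z) * z.
  by rewrite mulrBr mulrBl addrA subrK opprD addrACA subrr add0r.
have := le_trans (cnormD _ _) (lerD (cnormM y (y - z)) (cnormM (y - z) z)).
have := cnorm_ge0 (y - z); move: yr zr.
move: (cnorm _) (cnorm (y - z)) (cnorm y) (cnorm z) => a b c d.
nra.
Qed.

Let y_ball n : cnorm (y_ n) <= r.
Proof.
elim: n => [|n IH]; first by rewrite /y_ /= cnorm0 cnorm_ge0.
by rewrite /y_ iterS step_ball.
Qed.

Let y_star n : star (y_ n) = y_ n.
Proof.
elim: n => [|n IH]; first exact: star0.
by rewrite /y_ iterS -/(y_ n) /step starZr starD starM IH xs.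
Qed.

Let y_dist n k : cnorm (y_ (n + k) - y_ n) <= r ^+ n.
Proof.
elim: n => [|n IH]; first by rewrite add0n subr0 expr0 (le_trans (y_ball k))// ltW.
rewrite addSn /y_ !iterS -/(y_ _) -/(y_ n) exprS.
by rewrite (le_trans (step_contr (y_ball _) (y_ball _)))// ler_wpM2l ?cnorm_ge0.
Qed.

Lemma one_sub_square : exists2 s, star s = s & 1 - x = s * s.
Proof.
have r0 : 0 <= r := cnorm_ge0 x.
have [l yl] : exists l, forall e : R, 0 < e ->
    \forall n \near \oo, cnorm (l - y_ n) < e.
  apply: cstar_cauchy_cvg => e e0.
  have /cvgrPdist_lt/(_ (e / 2)) : (fun n => r ^+ n) @ \oo --> (0 : R).
    by apply: cvg_expr; rewrite ger0_norm.
  case=> [|N _ HN]; first by rewrite divr_gt0.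
  have rN : r ^+ N < e / 2.
    by have := HN N (leqnn N); rewrite /= sub0r normrN ger0_norm// exprn_ge0.
  exists N => m n Nm Nn.
  have := cnormB (y_ m - y_ N) (y_ n - y_ N).
  have := y_dist N (m - N); have := y_dist N (n - N); rewrite !subnKC//.
  have -> : y_ m - y_ N - (y_ n - y_ N) = y_ m - y_ n.
    by rewrite opprB addrA subrK.
  move: rN; lra.
have lr : cnorm l <= r.
  apply/ler_addgt0Pr => e e0; have [N _ HN] := yl e e0.
  have := le_trans (cnormD (l - y_ N) (y_ N)) (lerD (ltW (HN N (leqnn N))) (y_ball N)).
  by rewrite subrK addrC.
have ls : star l = l.
  apply: cnorm_lim_eq => e e0.
  have e2 : 0 < e / 2 by rewrite divr_gt0.
  have [N _ HN] := yl (e / 2) e2.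
  have -> : star l - l = star (l - y_ N) - (l - y_ N).
    by rewrite starB y_star opprB addrA subrK.
  apply: le_lt_trans (cnormB _ _) _; rewrite cnorm_starE.
  by have := HN N (leqnn N) => /=; lra.
have lE : l = step l.
  apply: cnorm_lim_eq => e e0.
  have e2 : 0 < e / 2 by rewrite divr_gt0.
  have [N _ HN] := yl (e / 2) e2.
  have -> : l - step l = l - y_ N.+1 + (step (y_ N) - step l).
    by rewrite addrA subrK.
  apply: le_lt_trans (cnormD _ _) _.
  have := HN N.+1 (leqnSn N); have := HN N (leqnn N); rewrite /= (cnormC l (y_ N)).
  have := step_contr (y_ball N) lr.
  have : r * cnorm (y_ N - l) <= cnorm (y_ N - l).
    by rewrite ler_piMl ?cnorm_ge0 ?ltW.
  lra.
exists (1 - l); first by rewrite starB star1 ls.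
have /(congr1 (fun z => (2 : R)%:C *: z)) := lE.
rewrite scalerA -rmorphM mulfV// rmorph1 scale1r => l2.
have -> : x = (2 : R)%:C *: l - l * l by rewrite l2 addrK.
rewrite mulrBl mul1r mulrBr mulr1 rmorphD rmorph1 scalerDl scale1r.
by rewrite -addrA opprD addrA.
Qed.
End SquareRoot.

Lemma cartesian a : exists h k, [/\ star h = h, star k = k & a = h + 'i *: k].
Proof.
exists ((2^-1 : R)%:C *: (a + star a)), ((2^-1 : R)%:C *: ('i *: (star a - a))).
split.
- by rewrite starZr starD starK addrC.
- by rewrite starZr starZ starB starK conj_imaginary scaleNr -scalerN opprB.
- rewrite scalerA (mulrC 'i) -scalerA (scalerA 'i) -expr2 sqr_i scaleN1r opprB.
  rewrite -scalerDr addrACA subrr addr0.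
  have -> : a + a = (2 : R)%:C *: a by rewrite rmorphD rmorph1 scalerDl scale1r.
  by rewrite scalerA -rmorphM mulVf// rmorph1 scale1r.
Qed.

Definition positive_functional (psi : A -> R[i]) : Prop :=
  linear (psi : A -> R[i]^o) /\ forall a, 0 <= psi (star a * a).

Section PositiveFunctionals.
Variable psi : A -> R[i].
Hypothesis psiP : positive_functional psi.

Lemma pfunD x y : psi (x + y) = psi x + psi y.
Proof. by have := psiP.1 1 x y; rewrite !scale1r. Qed.

Lemma pfunZ (c : R[i]) x : psi (c *: x) = c * psi x.
Proof.
have p0 : psi 0 = 0.
  by have := pfunD 0 0; rewrite addr0 => /eqP; rewrite -subr_eq0 opprD addrA subrr sub0r oppr_eq0 => /eqP.
by have := psiP.1 c x 0; rewrite !addr0 p0 => ->; rewrite addr0.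
Qed.

Lemma pfun0 : psi 0 = 0.
Proof. by rewrite -(scale0r (0 : A)) pfunZ mul0r. Qed.

Lemma pfunN x : psi (- x) = - psi x.
Proof. by rewrite -scaleN1r pfunZ mulN1r. Qed.

Lemma pfunB x y : psi (x - y) = psi x - psi y.
Proof. by rewrite pfunD pfunN. Qed.

(** For K > ||a|| the element 1 - a/K is a square s s with s self-adjoint, so psi is nonnegative on
    [star (s * x) * (s * x)]; then K tends to ||a||. *)
Lemma pfun_bound a x : star a = a ->
  psi (star x * a * x) <= (cnorm a)%:C * psi (star x * x).
Proof.
move=> sa.
have H (K : R) : cnorm a < K -> psi (star x * a * x) <= K%:C * psi (star x * x).
  move=> aK; have K0 : 0 < K := le_lt_trans (cnorm_ge0 a) aK.
  have [|| s ss sE] := @one_sub_square (K^-1%:C *: a).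
  - by rewrite starZr sa.
  - by rewrite cnormZr gtr0_norm ?invr_gt0// mulrC ltr_pdivrMr// mul1r.
  have := psiP.2 (s * x).
  rewrite starM ss mulrA -(mulrA (star x) s s) -sE mulrBr mulr1 mulrBl pfunB.
  rewrite -scalerAr -scalerAl pfunZ subr_ge0.
  rewrite -(ler_pM2l (x := K%:C)) ?ltcR// mulrA -rmorphM mulfV ?gt_eqF//.
  by rewrite rmorph1 mul1r.
have [u u0 uE] : exists2 u : R, 0 <= u & psi (star x * x) = u%:C.
  have := psiP.2 x; case: (psi (star x * x)) => u v.
  by rewrite lecE /= => /andP[/eqP -> u0]; exists u.
rewrite uE in H *.
have lezE z (c : R) : (z <= c%:C * u%:C) = (complex.Im z == 0) && (complex.Re z <= c * u).
  by rewrite -rmorphM lecE /= eq_sym.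
have := H (cnorm a + 1); rewrite ltrDl ltr01 => /(_ isT).
rewrite !lezE => /andP[-> _] /=.
apply/ler_addgt0Pr => e e0.
(* Dividing by u + 1 instead of u covers u = 0. *)
have u1 : 0 < u + 1 by lra.
have := H (cnorm a + e / (u + 1)); rewrite ltrDl divr_gt0// => /(_ isT).
rewrite lezE => /andP[_] /le_trans -> //.
rewrite mulrDl lerD2l mulrAC ler_pdivrMr//.
by rewrite ler_wpM2l ?ltW//; lra.
Qed.

(** An inequality in [R[i]] includes the equality of imaginary parts, so the bound at x = 1 compares
    psi a with the real number ||a|| psi 1. *)
Lemma pfun_real a : star a = a -> (complex.Im (psi a)) = 0.
Proof.
move=> sa; have := @pfun_bound a 1 sa; have := psiP.2 1.
rewrite star1 !mul1r !mulr1; case: (psi 1) => u v; case: (psi a) => u' v' /=.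
by rewrite !lecE /= => /andP[/eqP -> _]; rewrite mul0r mulr0 addr0 => /andP[/eqP].
Qed.

Lemma pfun_norm a : star a = a -> normc (psi a) <= cnorm a * normc (psi 1).
Proof.
move=> sa; have := pfun_real sa; have := @pfun_bound (- a) 1; have := @pfun_bound a 1 sa.
rewrite starN sa cnormN => + /(_ erefl).
have := psiP.2 1; rewrite star1 !mulr1 !mul1r pfunN.
case: (psi 1) => u v; case: (psi a) => u' v' /=.
rewrite !lecE /= => /andP[/eqP -> u0].
rewrite !mul0r !subr0 => /andP[_ h1] /andP[_ h2] ->.
rewrite expr0n /= !addr0 !sqrtr_sqr (ger0_norm u0) ler_norml.
by apply/andP; split; lra.
Qed.

(** This settles a state carried by one summand of a direct sum: the functional it leaves on the
    other summand has mass 0. *)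
Lemma pfun_eq0 a : psi 1 = 0 -> psi a = 0.
Proof.
move=> p1.
have H h : star h = h -> psi h = 0.
  by move=> /pfun_norm; rewrite p1 Normc.normc0 mulr0 => h0;
    apply: Normc.eq0_normc; apply/le_anti; rewrite h0 normc_ge0.
have [h [k [/H h0 /H k0 ->]]] := cartesian a.
by rewrite pfunD pfunZ h0 k0 mulr0 addr0.
Qed.

Lemma pfun_star a : psi (star a) = (psi a)^*.
Proof.
have [h [k [sh sk ->]]] := cartesian a.
have := pfun_real sh; have := pfun_real sk.
rewrite starD starZ sh sk conj_imaginary !pfunD !pfunZ.
case: (psi h) => u v; case: (psi k) => u' v' /= -> ->.
by apply/eqP; rewrite eq_complex /=; apply/andP; split; apply/eqP; ring.
Qed.

End PositiveFunctionals.
End CStarBasics.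

(** * Direct sums of C*-algebras *)

Section DirectSum.
Variables (R : realType) (A B : cstarType R).

Definition dsum : Type := (A * B)%type.

HB.instance Definition _ := GRing.Algebra.copy dsum (A * B)%type.

Definition dsum_star (x : dsum) : dsum := (star x.1, star x.2).
Definition dsum_norm (x : dsum) : R := Num.max (cnorm x.1) (cnorm x.2).

Lemma dsum_starK : involutive dsum_star.
Proof. by case=> a b; rewrite /dsum_star /= !starK. Qed.
Lemma dsum_starD : {morph dsum_star : x y / x + y}.
Proof. by move=> x y; congr pair; rewrite starD. Qed.
Lemma dsum_starZ (c : R[i]) (x : dsum) : dsum_star (c *: x) = Num.conj c *: dsum_star x.
Proof. by congr pair; rewrite starZ. Qed.
Lemma dsum_starM (x y : dsum) : dsum_star (x * y) = dsum_star y * dsum_star x.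
Proof. by congr pair; rewrite starM. Qed.
Lemma dsum_normD (x y : dsum) : dsum_norm (x + y) <= dsum_norm x + dsum_norm y.
Proof.
by rewrite ge_max; apply/andP; split; rewrite (le_trans (cnormD _ _))// lerD//
  le_max lexx ?orbT.
Qed.
Lemma dsum_normZ (c : R[i]) (x : dsum) : dsum_norm (c *: x) = normc c * dsum_norm x.
Proof. by rewrite /dsum_norm !cnormZ maxr_pMr// normc_ge0. Qed.
Lemma dsum_norm_eq0 (x : dsum) : dsum_norm x = 0 -> x = 0.
Proof.
case: x => a b n0.
have /andP[ha hb] : (cnorm a <= 0) && (cnorm b <= 0) by rewrite -ge_max -n0.
by congr pair; apply: cnorm_eq0; apply/le_anti; rewrite ?ha ?hb cnorm_ge0.
Qed.
Lemma dsum_normM (x y : dsum) : dsum_norm (x * y) <= dsum_norm x * dsum_norm y.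
Proof.
by rewrite [leLHS]/dsum_norm ge_max; apply/andP; split;
  rewrite (le_trans (cnormM _ _))// ler_pM ?cnorm_ge0// le_max lexx ?orbT.
Qed.
Lemma dsum_norm_star (x : dsum) : dsum_norm (dsum_star x * x) = dsum_norm x ^+ 2.
Proof.
rewrite /dsum_norm !cnorm_star.
case: (leP (cnorm x.1) (cnorm x.2)) => h.
  by rewrite max_r// ler_pXn2r ?nnegrE ?cnorm_ge0.
by rewrite max_l// ler_pXn2r ?nnegrE ?cnorm_ge0// ltW.
Qed.

HB.instance Definition _ := isPreCStar.Build R dsum dsum_starK dsum_starD
  dsum_starZ dsum_starM dsum_normD dsum_normZ dsum_norm_eq0 dsum_normM
  dsum_norm_star.

Lemma dsum_cnorm_lt (x : dsum) (e : R) :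
  (cnorm x < e) = (cnorm x.1 < e) && (cnorm x.2 < e).
Proof. by rewrite -gt_max. Qed.

(** Both projections are contractive and keep a filter Cauchy; the pair of limits is a limit because
    the norm is a maximum. *)
Lemma dsum_complete (F : set_system (ntop dsum)) :
  ProperFilter F -> cauchy F -> cvg F.
Proof.
move=> FF /cauchy_ballP Fc.
have Hc (C : cstarType R) (p : ntop dsum -> ntop C) :
    (forall x y, cnorm (p x - p y : C) <= cnorm (x - y : dsum)) ->
    exists l : ntop C, p y @[y --> F] --> l.
  move=> p_le; apply/cvg_ex; apply: cauchy_cvg; apply/cauchy_ballP => e e0.
  rewrite near_map2; apply: filterS (Fc _ e0) => -[x y] /=.
  by rewrite -!ball_normE /ball_ /= => /(le_lt_trans _); apply; rewrite lecR.
have [|a aP] := Hc A fst.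
  by move=> x y; rewrite /cnorm /= /dsum_norm le_max lexx.
have [|b bP] := Hc B snd.
  by move=> x y; rewrite /cnorm /= /dsum_norm le_max lexx orbT.
apply/cvg_ex; exists ((a, b) : dsum); apply/cvgrPdist_lt => _ /gt0_complexE[e e0 ->].
have e0' : 0 < e%:C by rewrite ltcR.
have aF : F [set y | `|a - (y.1 : ntop A)| < e%:C] := (cvgrPdist_lt _ _).1 aP _ e0'.
have bF : F [set y | `|b - (y.2 : ntop B)| < e%:C] := (cvgrPdist_lt _ _).1 bP _ e0'.
near=> y; rewrite ntop_lt dsum_cnorm_lt -2!ntop_lt.
by apply/andP; split; near: y; [exact: aF|exact: bF].
Unshelve. all: by end_near. Qed.

HB.instance Definition _ := PreCStar_isComplete.Build R dsum dsum_complete.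

Lemma dsum_norm_le (x : dsum) : cnorm x.1 <= cnorm x /\ cnorm x.2 <= cnorm x.
Proof. by rewrite /cnorm /= /dsum_norm !le_max !lexx orbT. Qed.

End DirectSum.

(** * State spaces and the Monge-Kantorovich metric *)

Section States.
Variable R : realType.
Implicit Types A B : cstarType R.

Lemma stateP A (phi : state_space A) : positive_functional (val phi).
Proof. by have /set_mem[] := valP phi. Qed.

Lemma state1 A (phi : state_space A) : val phi 1 = 1.
Proof. by have /set_mem[] := valP phi. Qed.

Definition mkstate A (phi : A -> R[i]) (phiP : positive_functional phi)
    (phi1 : phi 1 = 1) : state_space A :=
  exist _ (phi : {ptws A -> R[i]^o}) (mem_set (And3 phiP.1 phiP.2 phi1)).

Lemma state_norm A (phi : state_space A) a : star a = a ->
  normc (val phi a) <= cnorm a.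
Proof.
by move=> /(pfun_norm (stateP phi)); rewrite state1 Normc.normc1 mulr1.
Qed.

Lemma state_eq A (phi psi : state_space A) :
  (forall a, val phi a = val psi a) -> phi = psi.
Proof. by move=> H; apply/val_inj/funext. Qed.

Lemma normcB (y z : R[i]) : normc (y - z) = normc (z - y).
Proof. by rewrite -opprB; case: (z - y) => u v /=; rewrite !sqrrN. Qed.

Lemma pfun_pull A B (f : A -> B) (psi : B -> R[i]) :
  star_morphism f -> positive_functional psi -> positive_functional (psi \o f).
Proof.
move=> [fl fm fs] [pl pp]; split=> [c x y|a] /=; first by rewrite fl pl.
by rewrite fm fs pp.
Qed.

Definition pull_state A B (f : A -> B) (fP : unital_star_morphism f)
    (psi : state_space B) : state_space A :=
  mkstate (pfun_pull fP.1 (stateP psi)) (etrans (congr1 _ fP.2) (state1 psi)).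

Lemma pfun_conv A (phi psi : A -> R[i]) (s t : R) : 0 <= s -> 0 <= t ->
  positive_functional phi -> positive_functional psi ->
  positive_functional (fun a => s%:C * phi a + t%:C * psi a).
Proof.
move=> s0 t0 phiP psiP; split=> [c x y|a].
  rewrite (pfunD phiP) (pfunD psiP) (pfunZ phiP) (pfunZ psiP).
  by rewrite /GRing.scale /=; ring.
by rewrite addr_ge0// mulr_ge0 ?phiP.2 ?psiP.2// ler0c.
Qed.

Lemma conv_state_subproof A (t : R) (phi psi : state_space A) :
  t%:C * val phi 1 + (1 - t)%:C * val psi 1 = 1.
Proof. by rewrite !state1 !mulr1 -rmorphD addrC subrK rmorph1. Qed.

Definition conv_state A (t : R) (t01 : 0 <= t <= 1) (phi psi : state_space A) :
    state_space A :=
  mkstate (pfun_conv (andP t01).1 (etrans (subr_ge0 _ _) (andP t01).2)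
    (stateP phi) (stateP psi)) (conv_state_subproof t phi psi).

Lemma norm_normc (z : R[i]) : `|z| = (normc z)%:C.
Proof. by rewrite normc_def; case: z. Qed.

Lemma state_eval_nbhs A (phi : state_space A) (a : A) (e : R) : 0 < e ->
  nbhs phi [set psi | normc (val phi a - val psi a) < e].
Proof.
move=> e0.
have vc : val @ nbhs phi --> (val phi : {ptws A -> R[i]^o}).
  exact: initial_continuous.
have : (fun psi : state_space A => val psi a : R[i]^o) @ nbhs phi --> (val phi a : R[i]^o).
  apply: (@cvg_comp _ _ _ _ (fun h : {ptws A -> R[i]^o} => h a) _ _ _ vc).
  exact: (@proj_continuous A (fun=> R[i]^o) a (val phi)).
move=> /cvgrPdist_lt/(_ e%:C); rewrite ltcR => /(_ e0).
by apply: filterS => psi; rewrite norm_normc ltcR.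
Qed.

(** The topology of pointwise convergence is the supremum of the initial topologies of the
    evaluations, so a filter only has to be tested on single evaluations. *)
Lemma nbhs_state_filter A (phi : state_space A) (F : set_system (state_space A)) :
  Filter F ->
  (forall (a : A) (e : R), 0 < e -> F [set psi | normc (val phi a - val psi a) < e]) ->
  nbhs phi `<=` F.
Proof.
move=> FF H U [_ /= [[B Bo <-] Bphi BU]].
apply: filterS BU _.
suff : {ptws, val @ F --> (val phi : {ptws A -> R[i]^o})}.
  by apply; exact: open_nbhs_nbhs.
apply/cvg_sup => a V [_ [[W oW <-] Wphi WV]].
apply: filterS WV _.
have /nbhs_ballP[_ /= /gt0_complexE[e e0 ->] eW] : nbhs (val phi a : R[i]^o) W.
  exact: open_nbhs_nbhs.
suff : F [set psi | W (val psi a)] by [].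
apply: filterS (H a e e0) => psi ?; apply: eW.
by rewrite -ball_normE /= norm_normc ltcR.
Qed.

End States.

Section MongeKantorovich.
Variables (R : realType) (A : cstarType R).
Implicit Types L : partial_seminorm A.

Lemma mk_leP L (phi psi : state_space A) (e : R) :
  (mk L phi psi <= e%:E)%E <->
  forall a, ldom L a -> L a <= 1 -> normc (val phi a - val psi a) <= e.
Proof.
split=> [H a da La|H]; last first.
  by apply: ge_ereal_sup => _ [a [da La] <-]; rewrite lee_fin H.
rewrite -lee_fin; apply: le_trans H; apply: ereal_sup_ubound.
by exists a.
Qed.

Lemma mkxx L phi : (mk L phi phi <= 0)%E.
Proof. by apply/mk_leP => a _ _; rewrite subrr Normc.normc0. Qed.

Section Metrizes.
Variable L : partial_seminorm A.
Hypotheses (L_self : ldom L `<=` selfadjoint A) (L0 : ldom L 0)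
  (L_domZ : forall (t : R) a, ldom L a -> ldom L (t%:C *: a))
  (L_dense : selfadjoint A `<=` closure (ldom L : set (ntop A)))
  (L_ge0 : forall a, ldom L a -> 0 <= L a)
  (L_homog : forall (t : R) a, ldom L a -> L (t%:C *: a) = `|t| * L a).

Lemma mk_ge0 phi psi : (0 <= mk L phi psi)%E.
Proof.
apply: ereal_sup_ubound; exists 0; last first.
  by rewrite !pfun0 ?subrr ?Normc.normc0//; exact: stateP.
by split=> //; rewrite -(scale0r 0) -(rmorph0 (real_complex R)) L_homog// normr0 mul0r.
Qed.

Lemma mk_dom_bound phi psi (e : R) a : (mk L phi psi <= e%:E)%E -> ldom L a ->
  normc (val phi a - val psi a) <= (L a + 1) * e.
Proof.
move=> /mk_leP H da.
(* Rescaling by L a + 1 brings a into the unit ball even when L a = 0. *)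
have La1 : 0 < L a + 1 by rewrite ltr_wpDl// L_ge0.
have := H ((L a + 1)^-1%:C *: a) (L_domZ _ da).
rewrite L_homog// gtr0_norm ?invr_gt0// ler_pdivrMl// mulr1 lerDl ler01 => /(_ isT).
rewrite !(pfunZ (stateP _)) -mulrBr Normc.normcM normcr gtr0_norm ?invr_gt0//.
by rewrite ler_pdivrMl.
Qed.

(** The two self-adjoint parts of a are approximated by elements of the domain. The approximation
    errors make up eta, since states are contractive on self-adjoint elements, and C is the same for
    all pairs of states. *)
Lemma mk_eval_bound a (eta : R) : 0 < eta -> exists2 C : R, 0 <= C &
  forall phi psi (e : R), (mk L phi psi <= e%:E)%E ->
    normc (val phi a - val psi a) <= eta + C * e.
Proof.
have H h (d : R) : star h = h -> 0 < d -> exists2 C : R, 0 <= C &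
    forall phi psi (e : R), (mk L phi psi <= e%:E)%E ->
    normc (val phi h - val psi h) <= d + C * e.
  move=> sh d0; have d2 : 0 < d / 2 by rewrite divr_gt0.
  have [x xL hx] := (cstar_closureP _ _).1 (L_dense sh) _ d2.
  exists (L x + 1) => [|phi psi e pe]; first by rewrite addr_ge0// L_ge0.
  have shx : star (h - x) = h - x by rewrite starB sh (L_self xL).
  have := state_norm phi shx; have := state_norm psi shx.
  have := mk_dom_bound pe xL.
  have -> : val phi h - val psi h =
      val phi (h - x) - val psi (h - x) + (val phi x - val psi x).
    by rewrite !(pfunB (stateP _)); ring.
  have := normcTr (val phi (h - x) - val psi (h - x)) (val phi x - val psi x).
  have := normcTr (val phi (h - x)) (- val psi (h - x)).
  rewrite -[- val psi _]sub0r normcB subr0 sub0r.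
  lra.
move=> eta0; have eta2 : 0 < eta / 2 by rewrite divr_gt0.
have [h [k [sh sk ->]]] := cartesian a.
have [C1 C10 H1] := H h _ sh eta2; have [C2 C20 H2] := H k _ sk eta2.
exists (C1 + C2) => [|phi psi e pe]; first by rewrite addr_ge0.
have := H1 _ _ _ pe; have := H2 _ _ _ pe.
rewrite !(pfunD (stateP _)) !(pfunZ (stateP _)) opprD addrACA -mulrBr.
have := normcTr (val phi h - val psi h) ('i * (val phi k - val psi k)).
rewrite Normc.normcM (_ : normc 'i = 1); last first.
  by rewrite /= expr0n add0r expr1n sqrtr1.
lra.
Qed.

(* Only one inclusion between the neighbourhood filters needs a hypothesis:
   evaluations are mk-continuous because the domain is dense. *)
Lemma metrizes_intro :
  (forall phi psi, mk L phi psi \is a fin_num) ->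
  (forall phi (e : R), 0 < e -> nbhs phi [set psi | (mk L phi psi < e%:E)%E]) ->
  metrizes_weak_star (mk L).
Proof.
move=> Lfin Lnbhs; split=> // [phi psi mk0|phi].
  apply: state_eq => a; apply/eqP; rewrite -subr_eq0; apply/eqP.
  apply: Normc.eq0_normc; apply/le_anti; rewrite normc_ge0 andbT.
  apply/ler_addgt0Pr => e e0; have [C _ HC] := mk_eval_bound a e0.
  by have := HC phi psi 0; rewrite mk0 mulr0 addr0 add0r => /(_ (lexx _)).
apply/seteqP; split=> [|U [e e0 eU]]; last exact: filterS eU (Lnbhs _ _ e0).
pose F := [set U | exists2 e : R, 0 < e & [set psi | (mk L phi psi < e%:E)%E] `<=` U].
have FF : Filter F.
  split=> [|U V [e e0 eU] [d d0 dV]|U V UV [e e0 eU]].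
  - by exists 1.
  - exists (Num.min e d) => [|psi /= pe]; first by rewrite lt_min e0.
    split; [apply: eU|apply: dV]; apply: (lt_le_trans pe);
      by rewrite lee_fin ge_min lexx ?orbT.
  - by exists e => //; exact: subset_trans UV.
apply: (@nbhs_state_filter _ _ phi F) => a e e0.
have e2 : 0 < e / 2 by rewrite divr_gt0.
have [C C0 HC] := mk_eval_bound a e2.
have C1 : 0 < C + 1 by rewrite ltr_wpDl.
exists (e / 2 / (C + 1)) => [|psi /ltW /HC /=]; first by rewrite divr_gt0.
move=> /le_lt_trans; apply; rewrite [ltRHS](splitr e) ltrD2l.
by rewrite mulrA ltr_pdivrMr// mulrC ltr_pM2l// ltrDl.
Qed.

End Metrizes.
End MongeKantorovich.

(** * Composition of tunnels *)

Section QuantumIsometries.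
Variable R : realType.
Implicit Types A B D : cstarType R.

Lemma closed_cstarP A (S : set A) :
  (forall x, (forall e : R, 0 < e -> exists2 y, S y & cnorm (x - y) < e) -> S x) ->
  closed (S : set (ntop A)).
Proof. by move=> H x /cstar_closureP; exact: H. Qed.

Lemma qiso_le A B (LA : partial_seminorm A) (LB : partial_seminorm B) (f : A -> B) a :
  quantum_isometry LA LB f -> ldom LA a -> LB (f a) <= LA a.
Proof.
move=> [_ _ fd fE] da; rewrite -lee_fin fE; last by apply: fd; exists a.
by apply: ereal_inf_lbound; exists a.
Qed.

Lemma qiso_lift A B (LA : partial_seminorm A) (LB : partial_seminorm B) (f : A -> B)
    b (e : R) : quantum_isometry LA LB f -> ldom LB b -> 0 < e ->
  exists a, [/\ ldom LA a, f a = b & LA a < LB b + e].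
Proof.
move=> [_ _ fd fE] db e0.
have : (ereal_inf [set (LA a)%:E | a in [set a | ldom LA a /\ f a = b]]
         < (LB b + e)%:E)%E by rewrite -fE// lte_fin ltrDl.
by move=> /ereal_inf_lt[_ [a [da fa] <-]]; rewrite lte_fin; exists a.
Qed.

(** The infimum of a quotient seminorm need not be attained, so lifts are allowed an arbitrarily
    small loss; the projections of a bridge are handled in this form. *)
Lemma qiso_intro A B (LA : partial_seminorm A) (LB : partial_seminorm B) (f : A -> B) :
  star_morphism f -> (forall b, exists a, f a = b) ->
  (forall a, ldom LA a -> ldom LB (f a) /\ LB (f a) <= LA a) ->
  (forall b (e : R), ldom LB b -> 0 < e ->
    exists a, [/\ ldom LA a, f a = b & LA a <= LB b + e]) ->
  quantum_isometry LA LB f.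
Proof.
move=> fM fS fle flift; split=> // [_ [a da <-]|b db]; first by case: (fle a da).
apply/le_anti/andP; split.
  by apply: le_ereal_inf_tmp => _ [a [da <-] <-]; rewrite lee_fin; case: (fle a da).
apply/lee_addgt0Pr => e e0; have [a [da fa La]] := flift b e db e0.
by apply: ge_ereal_inf; exists (LA a)%:E; [exists a|rewrite -EFinD lee_fin].
Qed.

Lemma star_morphism_comp A B D (f : A -> B) (g : B -> D) :
  star_morphism f -> star_morphism g -> star_morphism (g \o f).
Proof.
move=> [fl fm fs] [gl gm gs]; split=> [c x y|x y|x] /=; first by rewrite fl gl.
- by rewrite fm gm.
- by rewrite fs gs.
Qed.

Lemma qiso_comp A B D (LA : partial_seminorm A) (LB : partial_seminorm B)
    (LD : partial_seminorm D) (f : A -> B) (g : B -> D) :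
  quantum_isometry LA LB f -> quantum_isometry LB LD g ->
  quantum_isometry LA LD (g \o f).
Proof.
move=> qf qg; have [fM fS fd _] := qf; have [gM gS gd _] := qg.
apply: qiso_intro.
- exact: star_morphism_comp.
- by move=> d; have [b <-] := gS d; have [a <-] := fS b; exists a.
- move=> a da /=; have db : ldom LB (f a) by apply: fd; exists a.
  split; first by apply: gd; exists (f a).
  exact: le_trans (qiso_le qg db) (qiso_le qf da).
- move=> d e dd e0; have e2 : 0 < e / 2 by rewrite divr_gt0.
  have [b [db gb Lb]] := qiso_lift qg dd e2.
  have [a [da fa La]] := qiso_lift qf db e2.
  by exists a; rewrite /= fa; split=> //; lra.
Qed.

(** The image of 1 is a unit for the range, which is the whole of B. *)
Lemma surjective_star_unital A B (f : A -> B) :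
  star_morphism f -> (forall b, exists a, f a = b) -> unital_star_morphism f.
Proof.
move=> fM fS; split=> //; have [_ fm _] := fM; have [a fa] := fS 1.
by rewrite -fa -[f 1]mulr1 -fa -fm mul1r.
Qed.

Lemma qiso_unital A B (LA : partial_seminorm A) (LB : partial_seminorm B) (f : A -> B) :
  quantum_isometry LA LB f -> unital_star_morphism f.
Proof. by move=> [fM fS _ _]; exact: surjective_star_unital. Qed.

Lemma smorphB A B (f : A -> B) x y : star_morphism f -> f (x - y) = f x - f y.
Proof.
move=> [fl _ _]; rewrite addrC -scaleN1r fl scaleN1r addrC.
by [].
Qed.

Lemma smorph0 A B (f : A -> B) : star_morphism f -> f 0 = 0.
Proof. by move=> fM; rewrite -(subrr 0) smorphB// subrr. Qed.

Lemma smorphD A B (f : A -> B) x y : star_morphism f -> f (x + y) = f x + f y.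
Proof. by move=> [fl _ _]; have := fl 1 x y; rewrite !scale1r. Qed.

Lemma smorphZ A B (f : A -> B) c x : star_morphism f -> f (c *: x) = c *: f x.
Proof. by move=> fM; have [fl _ _] := fM; have := fl c x 0; rewrite (smorph0 fM) !addr0. Qed.

Lemma smorph_jordan A B (f : A -> B) x y : star_morphism f ->
  f (jordan x y) = jordan (f x) (f y).
Proof.
by move=> fM; have [_ fm _] := fM; rewrite /jordan smorphZ// smorphD// !fm.
Qed.

Lemma smorph_lie A B (f : A -> B) x y : star_morphism f ->
  f (lie x y) = lie (f x) (f y).
Proof.
by move=> fM; have [_ fm _] := fM; rewrite /lie smorphZ// smorphB// !fm.
Qed.

(** This is the Leibniz inequality for the term ||f d1 - g d2|| of the bridge: in a product one
    factor is replaced at a time, and the coefficient of modulus 1/2 averages the two orders of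
    multiplication. *)
Lemma jordan_dist A (x y x' y' : A) (u v dx dy : R) :
  cnorm x <= u -> cnorm x' <= u -> cnorm y <= v -> cnorm y' <= v ->
  cnorm (x - x') <= dx -> cnorm (y - y') <= dy ->
  cnorm (jordan x y - jordan x' y') <= dx * v + u * dy /\
  cnorm (lie x y - lie x' y') <= dx * v + u * dy.
Proof.
move=> xu xu' yv yv' xx yy.
have h1 : cnorm (x * y - x' * y') <= dx * v + u * dy.
  have -> : x * y - x' * y' = (x - x') * y + x' * (y - y').
    by rewrite mulrBl mulrBr addrA subrK.
  by rewrite (le_trans (cnormD _ _))// lerD// (le_trans (cnormM _ _))// ler_pM ?cnorm_ge0.
have h2 : cnorm (y * x - y' * x') <= dx * v + u * dy.
  have -> : y * x - y' * x' = (y - y') * x + y' * (x - x').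
    by rewrite mulrBl mulrBr addrA subrK.
  rewrite [leRHS]addrC (mulrC u) (mulrC dx).
  by rewrite (le_trans (cnormD _ _))// lerD// (le_trans (cnormM _ _))// ler_pM ?cnorm_ge0.
have n2 : normc (2^-1 : R[i]) = 2^-1.
  by rewrite Normc.normcV (_ : 2 = (2 : R)%:C) ?normcr ?normr_nat// rmorph_nat.
have n2i : normc ((2 * 'i)^-1 : R[i]) = 2^-1.
  rewrite invfM Normc.normcM n2 Normc.normcV (_ : normc 'i = 1) ?invr1 ?mulr1//.
  by rewrite /= expr0n add0r expr1n sqrtr1.
rewrite /jordan /lie -!scalerBr !cnormZ n2 n2i; split.
  have -> : x * y + y * x - (x' * y' + y' * x') =
    (x * y - x' * y') + (y * x - y' * x') by rewrite opprD addrACA.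
  by have := cnormD (x * y - x' * y') (y * x - y' * x'); lra.
have -> : x * y - y * x - (x' * y' - y' * x') =
  (x * y - x' * y') - (y * x - y' * x') by rewrite !opprD addrACA.
by have := cnormB (x * y - x' * y') (y * x - y' * x'); lra.
Qed.

End QuantumIsometries.

Section Bridge.
Variables (R : realType) (D1 D2 S : cstarType R).
Variables (L1 : partial_seminorm D1) (L2 : partial_seminorm D2).
Variables (f : D1 -> S) (g : D2 -> S) (delta : R).

Definition bridge : partial_seminorm (dsum D1 D2) :=
  @PartialSeminorm R (dsum D1 D2)
    [set d | ldom L1 d.1 /\ ldom L2 d.2]
    (fun d => Num.max (Num.max (L1 d.1) (L2 d.2)) (delta^-1 * cnorm (f d.1 - g d.2))).

Hypotheses (L1P : is_qcms L1) (L2P : is_qcms L2)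
  (fP : unital_star_morphism f) (gP : unital_star_morphism g)
  (f_le : forall x, cnorm (f x) <= cnorm x)
  (g_le : forall x, cnorm (g x) <= cnorm x)
  (delta0 : 0 < delta).
Variable chi : state_space S.

Lemma bridge_leP d (c : R) : bridge d <= c <->
  [/\ L1 d.1 <= c, L2 d.2 <= c & cnorm (f d.1 - g d.2) <= delta * c].
Proof.
rewrite /= !ge_max ler_pdivrMl//.
by split=> [/andP[/andP[-> ->] ->]|[-> -> ->]].
Qed.

Lemma bridge_le d : [/\ L1 d.1 <= bridge d, L2 d.2 <= bridge d &
  cnorm (f d.1 - g d.2) <= delta * bridge d].
Proof. by apply/bridge_leP. Qed.

Lemma bridge_self : ldom bridge `<=` selfadjoint (dsum D1 D2).
Proof.
move=> [a b] /= [da db]; congr pair; first exact: (qcms_selfadjoint L1P).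
exact: (qcms_selfadjoint L2P).
Qed.

Lemma bridge_domZ (t : R) a : ldom bridge a -> ldom bridge (t%:C *: a).
Proof.
by move=> [da db]; split; [exact: (qcms_domZ L1P)|exact: (qcms_domZ L2P)].
Qed.

Lemma bridge_dense :
  selfadjoint (dsum D1 D2) `<=` closure (ldom bridge : set (ntop (dsum D1 D2))).
Proof.
move=> [a b] /pair_equal_spec[sa sb]; apply/cstar_closureP => e e0.
have [x xL ax] := (cstar_closureP _ _).1 (qcms_dense L1P sa) e e0.
have [y yL bY] := (cstar_closureP _ _).1 (qcms_dense L2P sb) e e0.
by exists (x, y); [split|rewrite dsum_cnorm_lt; apply/andP].
Qed.

Lemma bridge_ge0 a : ldom bridge a -> 0 <= bridge a.
Proof. by move=> [da _]; rewrite /= !le_max (qcms_ge0 L1P da). Qed.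

Lemma bridge_homog (t : R) a : ldom bridge a -> bridge (t%:C *: a) = `|t| * bridge a.
Proof.
move=> [da db]; rewrite /= (qcms_homogeneous L1P)// (qcms_homogeneous L2P)//.
rewrite (smorphZ _ _ fP.1) (smorphZ _ _ gP.1) -scalerBr cnormZr.
by rewrite mulrCA !maxr_pMr// normr_ge0.
Qed.

Lemma bridge_fst_pfun (phi : state_space (dsum D1 D2)) :
  positive_functional (fun a : D1 => val phi (a, 0)).
Proof.
have [pl pp] := stateP phi; split=> [c x y|a].
  by rewrite -pl; congr (val phi _); congr pair; rewrite /= scaler0 addr0.
by have := pp (a, 0); congr (0 <= val phi _); congr pair; rewrite /= mulr0.
Qed.

Lemma bridge_snd_pfun (phi : state_space (dsum D1 D2)) :
  positive_functional (fun a : D2 => val phi (0, a)).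
Proof.
have [pl pp] := stateP phi; split=> [c x y|a].
  by rewrite -pl; congr (val phi _); congr pair; rewrite /= scaler0 addr0.
by have := pp (0, a); congr (0 <= val phi _); congr pair; rewrite /= mulr0.
Qed.

Lemma bridge_split (phi : state_space (dsum D1 D2)) a b :
  val phi (a, b) = val phi (a, 0) + val phi (0, b).
Proof.
rewrite -(pfunD (stateP phi)); congr (val phi _); congr pair => /=.
  by rewrite addr0.
by rewrite add0r.
Qed.

Lemma bridge_weight (phi : state_space (dsum D1 D2)) :
  exists2 t : R, 0 <= t <= 1 &
    val phi (1, 0) = t%:C /\ val phi (0, 1) = (1 - t)%:C.
Proof.
have [_ /(_ 1)] := bridge_fst_pfun phi; have [_ /(_ 1)] := bridge_snd_pfun phi.
rewrite !star1 !mulr1; have := state1 phi; rewrite bridge_split.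
case: (val phi (1, 0)) => t t'; case: (val phi (0, 1)) => s s' ts.
rewrite !lecE /= => /andP[/eqP s'0 s0] /andP[/eqP t'0 t0].
move: ts => /eqP; rewrite eq_complex /= => /andP[/eqP ts _].
exists t; first by rewrite t0 /=; lra.
by rewrite s'0 t'0; split=> //; congr Complex; lra.
Qed.

Lemma bridge_scalar (phi : state_space (dsum D1 D2)) (c d : R[i]) :
  val phi (c%:A, d%:A) = c * val phi (1, 0) + d * val phi (0, 1).
Proof.
rewrite bridge_split -!(pfunZ (stateP phi)).
by congr (val phi _ + val phi _); congr pair; rewrite /= scaler0.
Qed.

(** Padding a coordinate with 0 would give functionals of mass t or 1 - t, whose normalization is
    singular where the mass vanishes. Padding with the scalar that [chi] assigns through the stage
    gives genuine states that depend continuously on phi. *)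
Let xf (a : D1) : D2 := (val chi (f a))%:A.
Let xg (b : D2) : D1 := (val chi (g b))%:A.

Lemma blend_fst_pfun (phi : state_space (dsum D1 D2)) :
  positive_functional (fun a : D1 => val phi (a, xf a)).
Proof.
have [t /andP[t0 t1] [_ tE]] := bridge_weight phi.
have -> : (fun a => val phi (a, xf a)) = (fun a =>
    (1 : R)%:C * val phi (a, 0) + (1 - t)%:C * val (pull_state fP chi) a).
  apply/funext => a.
  rewrite bridge_split mul1r -tE [in RHS]mulrC -(pfunZ (stateP phi)).
  by congr (_ + val phi _); congr pair; rewrite /= scaler0.
apply: (pfun_conv _ _ (bridge_fst_pfun phi) (stateP _)) => //.
by rewrite subr_ge0.
Qed.

Lemma blend_snd_pfun (phi : state_space (dsum D1 D2)) :
  positive_functional (fun b : D2 => val phi (xg b, b)).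
Proof.
have [t /andP[t0 t1] [tE _]] := bridge_weight phi.
have -> : (fun b => val phi (xg b, b)) = (fun b =>
    (1 : R)%:C * val phi (0, b) + t%:C * val (pull_state gP chi) b).
  apply/funext => b.
  rewrite bridge_split addrC mul1r -tE [in RHS]mulrC -(pfunZ (stateP phi)).
  by congr (_ + val phi _); congr pair; rewrite /= scaler0.
exact: (pfun_conv _ _ (bridge_snd_pfun phi) (stateP _)).
Qed.

Lemma blend_fst1 (phi : state_space (dsum D1 D2)) : val phi (1, xf 1) = 1.
Proof. by rewrite /xf fP.2 state1 scale1r; exact: (state1 phi). Qed.

Lemma blend_snd1 (phi : state_space (dsum D1 D2)) : val phi (xg 1, 1) = 1.
Proof. by rewrite /xg gP.2 state1 scale1r; exact: (state1 phi). Qed.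

Let blend_fst phi := mkstate (blend_fst_pfun phi) (blend_fst1 phi).
Let blend_snd phi := mkstate (blend_snd_pfun phi) (blend_snd1 phi).

(* phi(a, b) = phi(a, chi(f a)) + phi(chi(g b), b) - phi(chi(g b), chi(f a)):
   the first two terms are states of D1 and D2 depending continuously on phi,
   and the last one only sees the weight of phi on the first summand. *)
Lemma bridge_mk_le phi psi (e1 e2 : R) :
  (mk L1 (blend_fst phi) (blend_fst psi) <= e1%:E)%E ->
  (mk L2 (blend_snd phi) (blend_snd psi) <= e2%:E)%E ->
  (mk bridge phi psi <=
    (e1 + e2 + delta * normc (val phi (1, 0) - val psi (1, 0)))%:E)%E.
Proof.
move=> /mk_leP H1 /mk_leP H2.
set w := normc (val phi (1, 0) - val psi (1, 0)).
apply/mk_leP => -[a b] [da db].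
move=> /bridge_leP[/= La Lb ab].
have h1 : normc (val phi (a, xf a) - val psi (a, xf a)) <= e1 := H1 a da La.
have h2 : normc (val phi (xg b, b) - val psi (xg b, b)) <= e2 := H2 b db Lb.
have E (theta : state_space (dsum D1 D2)) : val theta (a, b) = val theta (a, xf a) + val theta (xg b, b)
    - val theta (xg b, xf a).
  rewrite -(pfunD (stateP theta)) -(pfunB (stateP theta)).
  congr (val theta _); congr pair; rewrite /= ?addrK//.
  by rewrite addrAC subrr add0r.
rewrite !E !bridge_scalar.
have [t _ [t1 t2]] := bridge_weight phi; have [s _ [s1 s2]] := bridge_weight psi.
have wE : normc (t%:C - s%:C) = w by rewrite /w t1 s1.
rewrite t1 t2 s1 s2.
have -> : forall x y z v : R[i],
    x + y - (val chi (g b) * t%:C + val chi (f a) * (1 - t)%:C)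
    - (z + v - (val chi (g b) * s%:C + val chi (f a) * (1 - s)%:C))
  = (x - z) + (y - v) + (t%:C - s%:C) * val chi (f a - g b).
  by move=> x y z v; rewrite (pfunB (stateP chi)) !rmorphB !rmorph1; ring.
apply: (le_trans (normcTr _ _)).
rewrite lerD//; first by rewrite (le_trans (normcTr _ _))// lerD.
rewrite Normc.normcM mulrC wE ler_wpM2r ?normc_ge0//.
rewrite mulr1 in ab; apply: le_trans ab; apply: state_norm.
have [_ _ fs] := fP.1; have [_ _ gs] := gP.1.
by rewrite starB -fs -gs (qcms_selfadjoint L1P da) (qcms_selfadjoint L2P db).
Qed.

(** Evaluating [blend phi] at a is evaluating phi at [x a], so [blend] is weak* continuous and
    neighbourhoods can be pulled back along it. *)
Lemma blend_nbhs (A : cstarType R) (blend : state_space (dsum D1 D2) -> state_space A)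
    (x : A -> dsum D1 D2) (L : partial_seminorm A) phi (e : R) :
  (forall phi a, val (blend phi) a = val phi (x a)) ->
  metrizes_weak_star (mk L) -> 0 < e ->
  nbhs phi [set psi | (mk L (blend phi) (blend psi) < e%:E)%E].
Proof.
move=> bE [_ _ Lnbhs] e0.
have : nbhs (blend phi) [set psi | (mk L (blend phi) psi < e%:E)%E].
  by rewrite Lnbhs; exists e.
apply: (@nbhs_state_filter _ _ _ (blend @ nbhs phi)) => a r r0.
have := state_eval_nbhs phi (x a) r0.
by apply: filterS => psi /=; rewrite !bE.
Qed.

Lemma bridge_mk : metrizes_weak_star (mk bridge).
Proof.
have m1 := qcms_mk L1P; have m2 := qcms_mk L2P.
have d0 : ldom bridge 0 by split; [exact: qcms_dom0 L1P|exact: qcms_dom0 L2P].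
apply: (metrizes_intro bridge_self bridge_domZ bridge_dense bridge_ge0 bridge_homog).
  move=> phi psi.
  have fin_le (x : \bar R) : x \is a fin_num -> (x <= (fine x)%:E)%E by move=> /fineK ->.
  have [/(_ (blend_fst phi) (blend_fst psi))/fin_le h1 _ _] := m1.
  have [/(_ (blend_snd phi) (blend_snd psi))/fin_le h2 _ _] := m2.
  rewrite ge0_fin_numE; last exact: (mk_ge0 d0 bridge_homog).
  exact: le_lt_trans (bridge_mk_le h1 h2) (ltry _).
move=> phi e e0; have e4 : 0 < e / 4 by rewrite divr_gt0.
have ed : 0 < e / 4 / delta by rewrite divr_gt0.
have n1 := @blend_nbhs _ blend_fst (fun a => (a, xf a)) L1 phi _ (fun _ _ => erefl) m1 e4.
have n2 := @blend_nbhs _ blend_snd (fun b => (xg b, b)) L2 phi _ (fun _ _ => erefl) m2 e4.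
have n3 := state_eval_nbhs phi (1, 0) ed.
apply: filterS (filterI n1 (filterI n2 n3)) => psi [/= /ltW p1 [/ltW p2 p3]].
apply: le_lt_trans (bridge_mk_le p1 p2) _; rewrite lte_fin.
move: p3; rewrite ltr_pdivlMr// mulrC.
have : 0 < e by []. 
lra.
Qed.

Lemma bridge_qcms : is_qcms bridge.
Proof.
have d0 : ldom bridge 0 by split; [exact: qcms_dom0 L1P|exact: qcms_dom0 L2P].
split.
- exact: bridge_self.
- exact: d0.
- move=> a b [a1 a2] [b1 b2].
  by split; [exact: (qcms_domD L1P)|exact: (qcms_domD L2P)].
- exact: bridge_domZ.
- move=> a b [a1 a2] [b1 b2].
  by split; [exact: (qcms_dom_jordan L1P)|exact: (qcms_dom_jordan L2P)].
- move=> a b [a1 a2] [b1 b2].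
  by split; [exact: (qcms_dom_lie L1P)|exact: (qcms_dom_lie L2P)].
- exact: bridge_dense.
- exact: bridge_ge0.
- move=> a b [a1 a2] [b1 b2]; apply/bridge_leP.
  have [h1 h2 h3] := bridge_le a; have [k1 k2 k3] := bridge_le b.
  split.
  + by rewrite (le_trans (qcms_triangle L1P _ _))// lerD.
  + by rewrite (le_trans (qcms_triangle L2P _ _))// lerD.
  + rewrite (smorphD _ _ fP.1) (smorphD _ _ gP.1) opprD addrACA mulrDr.
    by rewrite (le_trans (cnormD _ _))// lerD.
- exact: bridge_homog.
- apply/seteqP; split=> [[a b] [[da db] L0]|_ [t _ <-]].
  + have /bridge_leP[/= La Lb ab] : bridge (a, b) <= 0 by rewrite L0.
    have {}La : L1 a = 0 by apply/le_anti; rewrite La (qcms_ge0 L1P).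
    have {}Lb : L2 b = 0 by apply/le_anti; rewrite Lb (qcms_ge0 L2P).
    have : [set x | ldom L1 x /\ L1 x = 0] a by [].
    have : [set x | ldom L2 x /\ L2 x = 0] b by [].
    rewrite (qcms_kernel L1P) (qcms_kernel L2P) => -[t _ tb] [s _ sa].
    exists s => //; congr pair => //.
    (* L1 and L2 alone would leave a kernel of dimension two; the third term of the bridge forces
       both scalars to be equal. *)
    suff -> : s = t by [].
    have : f a - g b = 0 by apply/cnorm_eq0/le_anti; rewrite cnorm_ge0 -(mulr0 delta) ab.
    rewrite -sa -tb (smorphZ _ _ fP.1) (smorphZ _ _ gP.1) fP.2 gP.2 -scalerBl.
    rewrite -rmorphB => /(congr1 cnorm); rewrite cnorm0 cnorm_scalar => /eqP.
    by rewrite normr_eq0 subr_eq0 => /eqP.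
  + have : [set t%:C%:A | t in [set: R]] (t%:C%:A : D1) by exists t.
    have : [set t%:C%:A | t in [set: R]] (t%:C%:A : D2) by exists t.
    rewrite -(qcms_kernel L1P) -(qcms_kernel L2P) => -[db Lb] [da La].
    split=> //; apply/le_anti/andP; split; last exact: bridge_ge0.
    apply/bridge_leP; rewrite /= La Lb lexx; split=> //.
    rewrite (smorphZ _ _ fP.1) (smorphZ _ _ gP.1) fP.2 gP.2 subrr cnorm0.
    by rewrite mulr0.
- exact: bridge_mk.
- move=> a b [da1 da2] [db1 db2].
  have [h1 h2 h3] := bridge_le a; have [k1 k2 k3] := bridge_le b.
  have [na1 na2] := dsum_norm_le a; have [nb1 nb2] := dsum_norm_le b.
  have La0 : 0 <= bridge a by exact: bridge_ge0.
  have Lb0 : 0 <= bridge b by exact: bridge_ge0.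
  have lz1 := qcms_leibniz L1P da1 db1; rewrite ge_max in lz1.
  have /andP[j1 l1] := lz1.
  have lz2 := qcms_leibniz L2P da2 db2; rewrite ge_max in lz2.
  have /andP[j2 l2] := lz2.
  have m1 : L1 a.1 * cnorm b.1 + cnorm a.1 * L1 b.1 <=
      bridge a * cnorm b + cnorm a * bridge b.
    by rewrite lerD// ler_pM ?cnorm_ge0// ?(qcms_ge0 L1P).
  have m2 : L2 a.2 * cnorm b.2 + cnorm a.2 * L2 b.2 <=
      bridge a * cnorm b + cnorm a * bridge b.
    by rewrite lerD// ler_pM ?cnorm_ge0// ?(qcms_ge0 L2P).
  (* The third term is estimated with the norms of a and b in the direct sum, which dominate those
     of the images because f and g are contractive. *)
  have [] := @jordan_dist _ _ (f a.1) (f b.1) (g a.2) (g b.2) (cnorm a) (cnorm b)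
    (delta * bridge a) (delta * bridge b).
  + exact: le_trans (f_le _) na1.
  + exact: le_trans (g_le _) na2.
  + exact: le_trans (f_le _) nb1.
  + exact: le_trans (g_le _) nb2.
  + exact: h3.
  + exact: k3.
  rewrite mulrCA -mulrA -mulrDr => j3 l3.
  rewrite ge_max; apply/andP; split; apply/bridge_leP; split.
  + exact: le_trans j1 m1.
  + exact: le_trans j2 m2.
  + by rewrite (smorph_jordan _ _ fP.1) (smorph_jordan _ _ gP.1).
  + exact: le_trans l1 m1.
  + exact: le_trans l2 m2.
  + by rewrite (smorph_lie _ _ fP.1) (smorph_lie _ _ gP.1).
- apply: closed_cstarP => x H.
  have c1 : [set a | ldom L1 a /\ L1 a <= 1] x.1.
    apply: (qcms_closed L1P); apply/cstar_closureP => e e0.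
    have [y [[dy _] /bridge_leP[Ly _ _]]] := H e e0.
    by rewrite dsum_cnorm_lt => /andP[? _]; exists y.1.
  have c2 : [set a | ldom L2 a /\ L2 a <= 1] x.2.
    apply: (qcms_closed L2P); apply/cstar_closureP => e e0.
    have [y [[_ dy] /bridge_leP[_ Ly _]]] := H e e0.
    by rewrite dsum_cnorm_lt => /andP[_ ?]; exists y.2.
  split; first by split; [case: c1|case: c2].
  apply/bridge_leP; split; [by case: c1|by case: c2|].
  apply/ler_addgt0Pr => e e0; have e2 : 0 < e / 2 by rewrite divr_gt0.
  have [y [_ /bridge_leP[_ _ Ly]]] := H _ e2.
  rewrite dsum_cnorm_lt => /andP[/= n1 n2].
  (* The term passes from x to a nearby y of the unit ball; the difference is controlled by the
     contractivity of f and g. *)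
  have -> : f x.1 - g x.2 = f (x.1 - y.1) - g (x.2 - y.2) + (f y.1 - g y.2).
    rewrite (smorphB _ _ fP.1) (smorphB _ _ gP.1).
    by rewrite opprD (addrACA (f x.1)) -opprD subrK.
  have := cnormD (f (x.1 - y.1) - g (x.2 - y.2)) (f y.1 - g y.2).
  have := cnormB (f (x.1 - y.1)) (g (x.2 - y.2)).
  have := f_le (x.1 - y.1); have := g_le (x.2 - y.2).
  rewrite mulr1 in Ly *; lra.
Qed.

Lemma bridge_strongly_leibniz : strongly_leibniz L1 -> strongly_leibniz L2 ->
  strongly_leibniz bridge.
Proof.
move=> S1 S2 a b [da1 da2] ab ba.
have [db1 Lb1] := S1 a.1 b.1 da1 (congr1 fst ab) (congr1 fst ba).
have [db2 Lb2] := S2 a.2 b.2 da2 (congr1 snd ab) (congr1 snd ba).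
split; first by [].
have [h1 h2 h3] := bridge_le a.
have [nb1 nb2] := dsum_norm_le b.
have La0 : 0 <= bridge a by exact: bridge_ge0.
have sq (x : R) : 0 <= x -> x <= cnorm b -> x ^+ 2 <= cnorm b ^+ 2.
  by move=> x0 xb; rewrite ler_pXn2r ?nnegrE ?cnorm_ge0.
apply/bridge_leP; split.
- apply: le_trans Lb1 _; rewrite ler_pM ?sqr_ge0 ?(qcms_ge0 L1P)//.
  by rewrite sq ?cnorm_ge0.
- apply: le_trans Lb2 _; rewrite ler_pM ?sqr_ge0 ?(qcms_ge0 L2P)//.
  by rewrite sq ?cnorm_ge0.
have [_ fm _] := fP.1; have [_ gm _] := gP.1.
have fba : f b.1 * f a.1 = 1 by rewrite -fm -fP.2; congr f; exact: (congr1 fst ba).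
have gab : g a.2 * g b.2 = 1 by rewrite -gm -gP.2; congr g; exact: (congr1 snd ab).
(* The resolvent identity: a difference of inverses is the difference of the original elements
   between the two inverses. *)
have -> : f b.1 - g b.2 = f b.1 * (g a.2 - f a.1) * g b.2.
  by rewrite mulrBr mulrBl fba mul1r -mulrA gab mulr1.
rewrite (le_trans (cnormM _ _))// (le_trans (ler_wpM2r (cnorm_ge0 _) (cnormM _ _)))//.
rewrite cnormC mulrAC expr2 mulrCA ler_pM ?mulr_ge0 ?cnorm_ge0//.
by rewrite ler_pM ?cnorm_ge0//; [exact: le_trans (f_le _) nb1|exact: le_trans (g_le _) nb2].
Qed.

End Bridge.

Section StateApproximation.
Variable R : realType.
Implicit Types A B D : cstarType R.

(** The nontrivial half of the Hausdorff distance; the other half compares a subset of the state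
    space with the whole and costs nothing. *)
Definition approximates D A (L : partial_seminorm D) (p : D -> A) (e : R) : Prop :=
  forall phi : state_space D, exists psi : state_space D,
    pullback_states p psi /\ (mk L phi psi <= e%:E)%E.

Lemma hausdorff_approximates D A (L : partial_seminorm D) (p : D -> A) (e : R) :
  (hausdorff_dist (mk L) setT (pullback_states p) < e%:E)%E -> approximates L p e.
Proof.
rewrite gt_max => /andP[+ _] phi.
have : (ereal_inf [set mk L phi y | y in pullback_states p] <=
    ereal_sup [set ereal_inf [set mk L x y | y in pullback_states p] | x in setT])%E.
  by apply: ereal_sup_ubound; exists phi.
move=> /le_lt_trans /[apply] /ereal_inf_lt[_ [psi ppsi <-]] /ltW ?.
by exists psi.
Qed.

Lemma approximates_hausdorff D A (L : partial_seminorm D) (p : D -> A) (e : R) :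
  0 <= e -> approximates L p e ->
  (hausdorff_dist (mk L) setT (pullback_states p) <= e%:E)%E.
Proof.
move=> e0 H; rewrite ge_max; apply/andP; split; apply: ge_ereal_sup => _ [phi _ <-].
  have [psi [ppsi pe]] := H phi.
  by apply: ge_ereal_inf; exists (mk L phi psi) => //; exists psi.
apply: ge_ereal_inf; exists (mk L phi phi); first by exists phi.
by apply: le_trans (mkxx L phi) _; rewrite lee_fin.
Qed.

Lemma normalize_pfun A (psi : A -> R[i]) (t : R) (chi : state_space A) :
  positive_functional psi -> 0 <= t -> psi 1 = t%:C ->
  exists phi : state_space A, forall a, psi a = t%:C * val phi a.
Proof.
move=> psiP t0 psi1; have [t0'|tn] := eqVneq t 0.
  (* Default value: psi has mass 0, hence vanishes, and any state represents it. *)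
  exists chi => a; rewrite t0' mul0r; apply: (pfun_eq0 psiP).
  by rewrite psi1 t0'.
(* Division by t is written as a combination with a zero coefficient to reuse [pfun_conv]. *)
have tP : positive_functional (fun a => t^-1%:C * psi a + (0 : R)%:C * psi a).
  by apply: pfun_conv => //; rewrite invr_ge0.
have t1 : t^-1%:C * psi 1 + (0 : R)%:C * psi 1 = 1.
  by rewrite mul0r addr0 psi1 -rmorphM mulVf// rmorph1.
exists (mkstate tP t1) => a; rewrite /= mul0r addr0 mulrA -rmorphM mulfV//.
by rewrite rmorph1 mul1r.
Qed.

Lemma unital_star_comp A B D (f : A -> B) (g : B -> D) :
  unital_star_morphism f -> unital_star_morphism g -> unital_star_morphism (g \o f).
Proof.
by move=> [fM f1] [gM g1]; split; [exact: star_morphism_comp|rewrite /= f1].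
Qed.

(** The component of a state on D1 is moved directly to the states of A. The component on D2 travels
    to the stage through g, crosses to f at cost delta, and reaches A through D1, for a total of e2
    + delta + e1; the convex combination costs no more. Leaving D, r and s general lets both ends of
    the tunnel use the lemma. *)
Lemma approximates_bridge D D1 D2 (S A : cstarType R) (L : partial_seminorm D)
    (L1 : partial_seminorm D1) (L2 : partial_seminorm D2)
    (r : D -> D1) (s : D -> D2) (f : D1 -> S) (g : D2 -> S) (p : D1 -> A)
    (e1 e2 delta : R) :
  ldom L `<=` selfadjoint D -> 0 <= delta ->
  unital_star_morphism r -> unital_star_morphism s ->
  unital_star_morphism f -> unital_star_morphism g -> unital_star_morphism p ->
  (forall d, ldom L d -> [/\ ldom L1 (r d), ldom L2 (s d), L1 (r d) <= L d,
     L2 (s d) <= L d & cnorm (f (r d) - g (s d)) <= delta * L d]) ->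
  (forall phi : state_space D, exists2 t : R, 0 <= t <= 1 &
    exists (phi1 : state_space D1) (phi2 : state_space D2),
    forall d, val phi d = t%:C * val phi1 (r d) + (1 - t)%:C * val phi2 (s d)) ->
  approximates L1 p e1 -> approximates L2 g e2 -> 0 <= e2 ->
  approximates L (p \o r) (e1 + e2 + delta).
Proof.
move=> L_self delta0 rP sP fP gP pP rs split ap1 ap2 e20 phi.
have [t t01 [phi1 [phi2 phiE]]] := split phi.
have [nu' [[nu nuE] m1]] := ap1 phi1.
have [chi' [[chi chiE] m2]] := ap2 phi2.
have [mu' [[mu muE] m3]] := ap1 (pull_state fP chi).
pose k := conv_state t01 nu mu.
exists (pull_state (unital_star_comp rP pP) k); split; first by exists k.
apply/mk_leP => d dd Ld.
have [d1 d2 L1d L2d fg] := rs d dd.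
have := (mk_leP _ _ _ _).1 m1 _ d1 (le_trans L1d Ld); rewrite nuE => h1.
have := (mk_leP _ _ _ _).1 m2 _ d2 (le_trans L2d Ld); rewrite chiE => h2.
have := (mk_leP _ _ _ _).1 m3 _ d1 (le_trans L1d Ld); rewrite muE /= => h3.
have h4 : normc (val chi (g (s d)) - val chi (f (r d))) <= delta.
  rewrite normcB -(pfunB (stateP chi)).
  have [[_ _ fs] _] := fP; have [[_ _ gs] _] := gP.
  have [[_ _ rS] _] := rP; have [[_ _ ss] _] := sP.
  have sd := L_self _ dd.
  have sx : star (f (r d) - g (s d)) = f (r d) - g (s d).
    by rewrite starB -fs -gs -rS -ss sd.
  apply: le_trans (state_norm chi sx) _; apply: (le_trans fg).
  by rewrite -[leRHS]mulr1 ler_wpM2l.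
have -> : val phi d - val (pull_state (unital_star_comp rP pP) k) d =
    t%:C * (val phi1 (r d) - val nu (p (r d))) +
    (1 - t)%:C * ((val phi2 (s d) - val chi (g (s d))) +
      ((val chi (g (s d)) - val chi (f (r d))) +
       (val chi (f (r d)) - val mu (p (r d))))).
  by rewrite phiE /=; ring.
have /andP[t0 t1] := t01.
apply: (le_trans (normcTr _ _)); rewrite !Normc.normcM !normcr !ger0_norm ?subr_ge0//.
have h5 : normc ((val phi2 (s d) - val chi (g (s d))) +
      ((val chi (g (s d)) - val chi (f (r d))) +
       (val chi (f (r d)) - val mu (p (r d))))) <= e2 + (delta + e1).
  by apply: (le_trans (normcTr _ _)); rewrite lerD// (le_trans (normcTr _ _))// lerD.
apply: le_trans (lerD (ler_wpM2l t0 h1) (ler_wpM2l _ h5)) _; rewrite ?subr_ge0//.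
have : 0 <= t * (e2 + delta) by rewrite mulr_ge0 ?addr_ge0.
by nra.
Qed.

End StateApproximation.

Section LambdaBridge.
Variables (R : realType) (D1 D2 S A1 A2 : cstarType R).
Variables (L1 : partial_seminorm D1) (L2 : partial_seminorm D2).
Variables (LA1 : partial_seminorm A1) (LA2 : partial_seminorm A2).
Variables (f : D1 -> S) (g : D2 -> S) (p : D1 -> A1) (q : D2 -> A2).

(* The composition of tunnels behind the triangle inequality, for middle spaces
   that are only approximately isometric: the two lifting hypotheses are exactly
   what makes the projections of the direct sum quantum isometries. *)
Lemma LambdaSL_bridge (e1 e2 delta : R) (chi : state_space S) :
  is_qcms L1 -> is_qcms L2 -> strongly_leibniz L1 -> strongly_leibniz L2 ->
  quantum_isometry L1 LA1 p -> quantum_isometry L2 LA2 q ->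
  unital_star_morphism f -> unital_star_morphism g ->
  (forall x, cnorm (f x) <= cnorm x) -> (forall x, cnorm (g x) <= cnorm x) ->
  0 < delta -> 0 <= e1 -> 0 <= e2 ->
  (forall d1 (e : R), ldom L1 d1 -> 0 < e -> exists d2, [/\ ldom L2 d2,
     L2 d2 <= L1 d1 + e & cnorm (f d1 - g d2) <= delta * (L1 d1 + e)]) ->
  (forall d2 (e : R), ldom L2 d2 -> 0 < e -> exists d1, [/\ ldom L1 d1,
     L1 d1 <= L2 d2 + e & cnorm (f d1 - g d2) <= delta * (L2 d2 + e)]) ->
  approximates L1 p e1 -> approximates L1 f e1 ->
  approximates L2 q e2 -> approximates L2 g e2 ->
  (LambdaSL LA1 LA2 <= (e1 + e2 + delta)%:E)%E.
Proof.
move=> L1P L2P SL1 SL2 pq qq fP gP f_le g_le delta0 e10 e20 lift12 lift21 ap af aq ag.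
pose L := bridge L1 L2 f g delta.
have LP : is_qcms L by exact: (bridge_qcms L1P L2P fP gP f_le g_le delta0 chi).
have L_le d : [/\ L1 d.1 <= L d, L2 d.2 <= L d & cnorm (f d.1 - g d.2) <= delta * L d].
  exact: bridge_le.
have fstP : unital_star_morphism (fst : dsum D1 D2 -> D1) by [].
have sndP : unital_star_morphism (snd : dsum D1 D2 -> D2) by [].
have qfst : quantum_isometry L L1 (fst : dsum D1 D2 -> D1).
  apply: qiso_intro => [|a|a [da _]|a e da e0]; first by case: fstP.
  - by exists (a, 0).
  - by split=> //; have [] := L_le a.
  - have [b [db Lb ab]] := lift12 a e da e0.
    exists (a, b); split=> //; apply/bridge_leP => //; split=> //.
    by rewrite lerDl ltW.
have qsnd : quantum_isometry L L2 (snd : dsum D1 D2 -> D2).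
  apply: qiso_intro => [|b|a [_ db]|b e db e0]; first by case: sndP.
  - by exists (0, b).
  - by split=> //; have [] := L_le a.
  - have [a [da La ab]] := lift21 b e db e0.
    exists (a, b); split=> //; apply/bridge_leP => //; split=> //.
    by rewrite lerDl ltW.
have split1 (phi : state_space (dsum D1 D2)) : exists2 t : R, 0 <= t <= 1 &
    exists (phi1 : state_space D1) (phi2 : state_space D2),
    forall d, val phi d = t%:C * val phi1 d.1 + (1 - t)%:C * val phi2 d.2.
  have [t t01 [tE tE']] := bridge_weight phi; have /andP[t0 t1] := t01.
  have [phi1 H1] := normalize_pfun (pull_state fP chi) (bridge_fst_pfun phi) t0 tE.
  have t'0 : 0 <= 1 - t by rewrite subr_ge0.
  have [phi2 H2] := normalize_pfun (pull_state gP chi) (bridge_snd_pfun phi) t'0 tE'.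
  by exists t => //; exists phi1, phi2 => -[a b]; rewrite bridge_split H1 H2.
have pP := qiso_unital pq; have qP := qiso_unital qq.
apply: ge_ereal_inf; exists (extent L (p \o fst) (q \o snd)).
  exists (dsum D1 D2), L, (p \o fst), (q \o snd); split=> //; last first.
    exact: (bridge_strongly_leibniz L1P L2P fP gP f_le g_le delta0).
  by split=> //; [exact: qiso_comp pq|exact: qiso_comp qq].
have sum0 : 0 <= e1 + e2 + delta by rewrite addr_ge0 ?addr_ge0 ?(ltW delta0).
rewrite ge_max; apply/andP; split; apply: approximates_hausdorff => //.
  apply: (approximates_bridge (L := L) (L1 := L1) (L2 := L2) (s := snd) (f := f)
    (g := g)) => //; first exact: (qcms_selfadjoint LP).
  - exact: ltW.
  - by move=> d [d1 d2]; have [] := L_le d.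
rewrite [e1 + e2]addrC.
apply: (approximates_bridge (L := L) (L1 := L2) (L2 := L1) (s := fst) (f := g)
  (g := f)) => //; first exact: (qcms_selfadjoint LP).
- exact: ltW.
- by move=> d [d1 d2]; have [] := L_le d; rewrite cnormC.
(* The roles of the summands are exchanged, so the weight becomes 1 - t. *)
- move=> phi; have [t t01 [phi1 [phi2 phiE]]] := split1 phi.
  exists (1 - t); first by move: t01; lra.
  exists phi2, phi1 => d; rewrite phiE addrC.
  by congr (_ + _%:C * _); rewrite opprB addrC subrK.
Qed.

End LambdaBridge.

(** * Continued fractions *)

Section ContinuedFractions.
Variable R : realType.
Implicit Types (r : nat -> nat) (x y th : R) (n k : nat).

(** Unlike in [quotients], r 0 is arbitrary, so tails of an expansion are covered: they expand the
    complete quotients. *)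
Definition cf_expands r x : Prop :=
  (forall k, (0 < r k.+1)%N) /\ cf_value R r n @[n --> \oo] --> x.

Lemma cf_value_bounds r n : (forall k, (0 < r k.+1)%N) ->
  (r 0)%:R <= cf_value R r n <= (r 0)%:R + 1.
Proof.
move=> rp; case: n => [|n] /=; first by rewrite lexx lerDl ler01.
elim: n r rp => [|n IH] r rp /=.
  have r1 : (1 : R) <= (r 1)%:R by rewrite ler1n rp.
  have r10 : (0 : R) < (r 1)%:R by rewrite ltr0n rp.
  by rewrite lerDl lerD2l invr_ge0 ltW//= invf_le1//.
have /andP[h1 _] := IH (fun k => r k.+1) (fun k => rp k.+1).
have h2 : 1 <= cf_value R (fun k => r k.+1) n.+1.
  by apply: le_trans h1; rewrite ler1n rp.
have h3 : 0 < cf_value R (fun k => r k.+1) n.+1 := lt_le_trans ltr01 h2.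
by rewrite lerDl lerD2l invr_ge0 ltW//= invf_le1//.
Qed.

Lemma irrational_natr x (n : nat) : irrational x -> x != n%:R.
Proof.
move=> xi; apply/eqP => xn; apply: xi; exists n%:R => //.
by rewrite xn ratr_nat.
Qed.

(** One step of the Gauss map. In the limit the bounds of [cf_value_bounds] are not strict;
    irrationality makes them strict, so r 0 is the floor of x. *)
Lemma cf_expands_step r x : cf_expands r x -> irrational x ->
  [/\ (r 0)%:R < x, x < (r 0)%:R + 1, irrational (x - (r 0)%:R)^-1 &
      cf_expands (fun k => r k.+1) (x - (r 0)%:R)^-1].
Proof.
move=> [rp rx] xi.
have x1 : (r 0)%:R < x.
  rewrite lt_neqAle eq_sym irrational_natr//=.
  apply: (cvgr_to_ge rx).
  by apply: nearW => n; have /andP[] := cf_value_bounds n rp.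
have x2 : x < (r 0)%:R + 1.
  rewrite natr1 lt_neqAle irrational_natr//=.
  apply: (cvgr_to_le rx).
  by apply: nearW => n; have /andP[] := cf_value_bounds n rp; rewrite natr1.
split=> //.
  move=> [z _ zE]; apply: xi; exists (z^-1 + (r 0)%:R) => //.
  by rewrite rmorphD fmorphV /= zE invrK ratr_nat subrK.
split=> [k|]; first exact: rp.
have -> : cf_value R (fun k => r k.+1) = fun n => (cf_value R r n.+1 - (r 0)%:R)^-1.
  by apply/funext => n /=; rewrite addrAC subrr add0r invrK.
apply: cvgV; first by rewrite subr_eq0 gt_eqF.
apply: cvgB; last exact: cvg_cst.
by rewrite (cvg_shiftS (cf_value R r)).
Qed.

(** The floor is locally constant at an irrational point and the Gauss map is continuous there, so
    the neighbourhood found for the tail is pulled back along the Gauss map. *)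
Lemma cf_digits_near n : forall r0 (x0 : R), cf_expands r0 x0 -> irrational x0 ->
  \forall x \near x0, forall r, cf_expands r x -> irrational x ->
    forall k, (k <= n)%N -> r k = r0 k.
Proof.
have head r0 (x0 : R) : cf_expands r0 x0 -> irrational x0 ->
    \forall x \near x0, forall r, cf_expands r x -> irrational x -> r 0 = r0 0.
  move=> rx0 xi0; have [l0 u0 _ _] := cf_expands_step rx0 xi0.
  near=> x => r rx xi; have [l u _ _] := cf_expands_step rx xi.
  have l' : (r0 0)%:R < x by near: x; exact: cvgr_gt cvg_id _ l0.
  have u' : x < (r0 0)%:R + 1 by near: x; exact: cvgr_lt cvg_id _ u0.
  apply/eqP; rewrite eqn_leq.
  apply/andP; split; rewrite -ltnS -(ltr_nat R) -natr1.
    exact: lt_trans l u'.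
  exact: lt_trans l' u.
elim: n => [|n IH] r0 x0 rx0 xi0.
  near=> x => r rx xi k; rewrite leqn0 => /eqP ->; move: r rx xi; near: x.
  exact: head.
have [l0 u0 yi0 ry0] := cf_expands_step rx0 xi0.
have yc : (x - (r0 0)%:R)^-1 @[x --> x0] --> (x0 - (r0 0)%:R)^-1.
  apply: cvgV; first by rewrite subr_eq0 gt_eqF.
  by apply: cvgB; [exact: cvg_id|exact: cvg_cst].
have := yc _ (IH _ _ ry0 yi0) => near_y.
near=> x => r rx xi [_|k kn].
  by move: r rx xi; near: x; exact: head.
have r00 : r 0 = r0 0 by move: r rx xi {kn}; near: x; exact: head.
have [_ _ yi ry] := cf_expands_step rx xi; rewrite r00 in yi ry.
have : forall r', cf_expands r' (x - (r0 0)%:R)^-1 -> irrational (x - (r0 0)%:R)^-1 ->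
  forall k, (k <= n)%N -> r' k = r0 k.+1 by near: x; exact: near_y.
by move=> /(_ _ ry yi k kn).
Unshelve. all: by end_near. Qed.

Lemma cf_den_ext r r' n : (forall k, (k <= n)%N -> r k = r' k) ->
  cf_den r n = cf_den r' n.
Proof.
elim: n => //= n IH H; rewrite IH => [|k kn]; last exact: H (leqW kn).
by rewrite H.
Qed.

Lemma cf_num_ext r r' n : (forall k, (k <= n)%N -> r k = r' k) ->
  cf_num r n = cf_num r' n.
Proof.
elim: n => //= n IH H; rewrite IH => [|k kn]; last exact: H (leqW kn).
by rewrite H.
Qed.

Lemma cf_errS th r n :
  cf_err th r n.+1 = (r n.+1)%:R * cf_err th r n + cf_err_prev th r n.
Proof. by rewrite /cf_err /cf_err_prev /= !natrD !natrM; ring. Qed.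

Lemma cf_err_prevS th r n : cf_err_prev th r n.+1 = cf_err th r n.
Proof. by []. Qed.

(* The errors alternate in sign because e_(n-1) = - y e_n, where y is the
   complete quotient [r_(n+1); r_(n+2), ...]. *)
Lemma cf_err_sign_complete th (r : quotients) n : cf_expands r th -> irrational th ->
  0 < (-1) ^+ n * cf_err th r n /\
  exists y, [/\ 0 < y, irrational y, cf_expands (fun k => r (n.+1 + k)%N) y &
    cf_err_prev th r n = - (y * cf_err th r n)].
Proof.
move=> rth ith; elim: n => [|n [IH [y [y0 yi ry yE]]]].
  have := cf_expands_step rth ith; rewrite quot0 subr0 => -[th0 _ yi ry].
  rewrite expr0 mul1r /cf_err /cf_err_prev /= mulr1 subr0 mulr0 sub0r.
  by split=> //; exists th^-1; rewrite mulVf ?gt_eqF// invr_gt0.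
have := cf_expands_step ry yi; rewrite addn0 => -[ly uy zi rz].
have eE : cf_err th r n.+1 = - ((y - (r n.+1)%:R) * cf_err th r n).
  by rewrite cf_errS yE; ring.
have d0 : 0 < y - (r n.+1)%:R by rewrite subr_gt0.
split.
  by rewrite eE exprS mulN1r mulNr mulrN opprK mulrCA mulr_gt0.
exists (y - (r n.+1)%:R)^-1; split=> //; first by rewrite invr_gt0.
- by under eq_fun do rewrite addSnnS.
- by rewrite cf_err_prevS eE mulrN opprK mulrA mulVf ?gt_eqF// mul1r.
Qed.

Lemma cf_err_sign th (r : quotients) n : cf_expands r th -> irrational th ->
  0 < (-1) ^+ n * cf_err th r n.
Proof. by move=> rth ith; case: (cf_err_sign_complete n rth ith). Qed.

Lemma cf_err_prev_sign th (r : quotients) n : cf_expands r th -> irrational th ->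
  0 < (-1) ^+ n.+1 * cf_err_prev th r n.
Proof.
move=> rth ith; have [e0 [y [y0 _ _ ->]]] := cf_err_sign_complete n rth ith.
by rewrite exprS mulN1r mulNr mulrN opprK mulrCA mulr_gt0.
Qed.

(** theta cancels on the left, leaving the determinant identity q_n p_(n+1) - q_(n+1) p_n =
    (-1)^n. *)
Lemma cf_det th r n :
  (cf_den r n.+1).1%:R * cf_err th r n - (cf_den r n).1%:R * cf_err th r n.+1 =
  (-1) ^+ n.
Proof.
elim: n => [|n IH]; first by rewrite /cf_err /= expr0; ring.
rewrite (cf_errS _ _ n.+1) exprS -IH cf_err_prevS /= !natrD !natrM; ring.
Qed.

Lemma es_weight_gt0 th (r : quotients) n : cf_expands r th -> irrational th ->
  0 < es_weightS th r n.
Proof.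
move=> rth ith; rewrite /es_weightS cf_err_prevS mulrAC.
by rewrite mulr_gt0 ?ltr0n ?cf_den_gt0// cf_err_sign.
Qed.

Lemma es_weight_lt1 th (r : quotients) n : cf_expands r th -> irrational th ->
  es_weightS th r n < 1.
Proof.
move=> rth ith; rewrite -subr_gt0.
have -> : 1 - es_weightS th r n = (cf_den r n).1%:R * ((-1) ^+ n.+1 * cf_err th r n.+1).
  have s2 : (-1 : R) ^+ n * (-1) ^+ n = 1 by rewrite -expr2 sqrr_sign.
  rewrite /es_weightS cf_err_prevS -[X in X - _]s2 -[X in _ * X - _](cf_det th r n).
  by rewrite exprS; ring.
by rewrite mulr_gt0 ?ltr0n ?cf_den_gt0// cf_err_sign.
Qed.

(** Errors two steps apart have the same sign; inserting that sign in numerator and denominator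
    makes both positive. *)
Lemma es_kappa_gt0 th (r : quotients) m : cf_expands r th -> irrational th ->
  0 < es_kappa th r m.
Proof.
move=> rth ith; rewrite sqrtr_gt0.
have h1 := cf_err_sign m.+1 rth ith; have h2 := cf_err_prev_sign m rth ith.
have -> : cf_err th r m.+1 / (cf_err_prev th r m * (r m.+1)%:R * (r m.+1).+1%:R ^+ 2) =
    ((-1) ^+ m.+1 * cf_err th r m.+1) / ((-1) ^+ m.+1 * cf_err_prev th r m) /
    ((r m.+1)%:R * (r m.+1).+1%:R ^+ 2).
  have sE (a b : R) : ((-1) ^+ m.+1 * a) / ((-1) ^+ m.+1 * b) = a / b.
    by rewrite -mulf_div mulfV ?signr_eq0// mul1r.
  by rewrite sE !invfM !mulrA.
by rewrite !divr_gt0// mulr_gt0 ?exprn_gt0 ?ltr0n// quot_gt0.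
Qed.

Lemma cf_den_mono (r : quotients) n : ((cf_den r n).2 <= (cf_den r n).1)%N.
Proof.
case: n => //= n; rewrite (leq_trans _ (leq_addr _ _))// leq_pmull//.
exact: quot_gt0.
Qed.

(** The dimension at least doubles at each step. The worst case is a quotient equal to 1, where (u +
    v)^2 + u^2 >= 2 (u^2 + v^2) because v <= u. *)
Lemma es_beta_le (r : quotients) n : es_beta R r n <= 2^-1 ^+ n.
Proof.
have H : (2 ^ n <= (cf_den r n).1 ^ 2 + (cf_den r n).2 ^ 2)%N.
  elim: n => [|n IH]; first by [].
  have m := cf_den_mono r n; have rp := quot_gt0 r n.
  rewrite expnS /=; move: IH m rp.
  move: (cf_den r n).1 (cf_den r n).2 (r n.+1) (2 ^ n)%N => u v c w IH vu c0.
  apply: (leq_trans (leq_mul (leqnn 2) IH)).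
  have : (u + v <= c * u + v)%N by rewrite leq_add2r leq_pmull.
  move=> h; apply: leq_trans (_ : (u + v) ^ 2 + u ^ 2 <= _)%N; last first.
    by rewrite leq_add2r leq_exp2r.
  by nia.
rewrite /es_beta exprVn -natrX lef_pV2 ?posrE ?ltr0n ?expn_gt0// ?ler_nat//.
by rewrite addn_gt0 expn_gt0 cf_den_gt0.
Qed.

End ContinuedFractions.

(** * Conditional expectations and weighted Hilbert-Schmidt norms *)

Section ConditionalExpectationNorm.
Variables (R : realType) (A : cstarType R).
Variables (tau : A -> R[i]) (B : set A) (E : A -> A).
Hypotheses (tauP : positive_functional tau) (EP : conditional_expectation B E)
  (tauE : forall a, tau (E a) = tau a)
  (B1 : B 1) (BM : forall b c, B b -> B c -> B (b * c))
  (BB : forall b c, B b -> B c -> B (b - c)) (BS : forall b, B b -> B (star b)).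

Definition sqnorm2 (x : A) : R := complex.Re (tau (star x * x)).

Lemma sqnorm2E x : tau (star x * x) = (sqnorm2 x)%:C.
Proof.
rewrite /sqnorm2; have := tauP.2 x; case: (tau _) => u v.
by rewrite lecE /= => /andP[/eqP -> _].
Qed.

Lemma sqnorm2_ge0 x : 0 <= sqnorm2 x.
Proof. by have := tauP.2 x; rewrite sqnorm2E ler0c. Qed.

(** Pythagoras; the other cross term vanishes by conjugation. *)
Lemma sqnorm2_addl u v : tau (star v * u) = 0 ->
  sqnorm2 (u + v) = sqnorm2 u + sqnorm2 v.
Proof.
move=> vu; have uv : tau (star u * v) = 0.
  by rewrite -[X in tau X]starK starM starK (pfun_star tauP) vu conjc0.
have /(congr1 (@complex.Re R)) : (sqnorm2 (u + v))%:C = (sqnorm2 u + sqnorm2 v)%:C :> R[i].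
  rewrite -sqnorm2E starD mulrDl !mulrDr !(pfunD tauP) uv vu addr0 add0r.
  by rewrite !sqnorm2E rmorphD.
by [].
Qed.

(** E is the orthogonal projection of L^2 onto B and commutes with multiplication by B, so (a - E a)
    b is orthogonal to B. *)
Lemma cexp_orthogonal a b v : B b -> B v -> tau (star v * ((a - E a) * b)) = 0.
Proof.
move=> Bb Bv; rewrite -tauE mulrA (cexp_bimodule EP)//; last exact: BS.
have El := cexp_linear EP.
have -> : E (a - E a) = 0.
  rewrite addrC -scaleN1r El scaleN1r (cexp_id EP); last exact: (cexp_range EP).
  by rewrite addNr.
by rewrite mulr0 mul0r (pfun0 tauP).
Qed.

(** This turns the L^2 norm of (a - E a) b into the quadratic form of one positive element of B,
    whose operator norm is [cexp_norm E (a - E a) ^+ 2]. *)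
Lemma cexp_sqnorm2 a b : B b ->
  tau (star b * E (star (a - E a) * (a - E a)) * b) = (sqnorm2 ((a - E a) * b))%:C.
Proof.
move=> Bb; rewrite -sqnorm2E starM -(cexp_bimodule EP)//; last exact: BS.
by rewrite tauE !mulrA.
Qed.

Lemma cexp_norm_sq y : cexp_norm E y ^+ 2 = cnorm (E (star y * y)).
Proof. by rewrite sqr_sqrtr ?cnorm_ge0. Qed.

Lemma cexp_norm_ge0 y : 0 <= cexp_norm E y.
Proof. exact: sqrtr_ge0. Qed.

Lemma cexp_norm_approx a (K : R) b : cexp_norm E (a - E a) <= K -> B b ->
  exists2 c, B c & sqnorm2 (a * b - c) <= K ^+ 2 * sqnorm2 b.
Proof.
move=> aK Bb; exists (E a * b); first by apply: BM => //; exact: (cexp_range EP).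
rewrite -mulrBl -lecR -cexp_sqnorm2// rmorphM /= -sqnorm2E.
have [d dE] := cexp_positive EP (a - E a).
have K0 : 0 <= K := le_trans (cexp_norm_ge0 _) aK.
apply: le_trans (pfun_bound tauP _ _) _; first by rewrite dE starM starK.
rewrite ler_wpM2r ?tauP.2// lecR -cexp_norm_sq.
by rewrite ler_pXn2r ?nnegrE ?cexp_norm_ge0.
Qed.

(** If u/v were 1 + e with e > 0, its powers of exponent 2^k would be unbounded by a Bernoulli
    estimate. This is how the constant M between the two norms disappears. *)
Lemma exp_bound_le (u v M : R) : 0 <= u -> 0 <= v ->
  (forall k, u ^+ (2 ^ k) <= M * v ^+ (2 ^ k)) -> u <= v.
Proof.
move=> u0 v0 H; rewrite leNgt; apply/negP => vu.
have [v00|vn] := eqVneq v 0.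
  by have := H 0; rewrite v00 !expr1 mulr0 leNgt -v00 vu.
have vp : 0 < v by rewrite lt_def vn.
set e := u / v - 1.
have e0 : 0 < e by rewrite subr_gt0 ltr_pdivlMr// mul1r.
have uvE : u / v = 1 + e by rewrite /e addrC subrK.
have low k : 1 + k.+1%:R * e <= (1 + e) ^+ (2 ^ k).
  elim: k => [|k IH]; first by rewrite mul1r.
  have p0 : 0 <= 1 + k.+1%:R * e by rewrite addr_ge0// mulr_ge0 ?ltW.
  rewrite expnS mulnC exprM; apply: le_trans (_ : (1 + k.+1%:R * e) ^+ 2 <= _); last first.
    by rewrite ler_pXn2r ?nnegrE// exprn_ge0// addr_ge0// ltW.
  rewrite -[k.+2%:R]natr1; have : 1 <= k.+1%:R :> R by rewrite ler1n.
  move: (k.+1%:R) => c c1; nra.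
have up k : (1 + e) ^+ (2 ^ k) <= M.
  by rewrite -uvE expr_div_n ler_pdivrMr ?exprn_gt0.
(* With k the integer part of M/e, the lower bound 1 + (k + 1) e exceeds M. *)
have := le_trans (low (Num.trunc (M / e))) (up _).
have := Num.Theory.truncnS_gt (M / e).
rewrite ltr_pdivrMr//; lra.
Qed.

Lemma cnorm_exp2 (z : A) k : star z = z -> cnorm (z ^+ (2 ^ k)) = cnorm z ^+ (2 ^ k).
Proof.
move=> sz; elim: k => [|k IH]; first by rewrite !expr1.
have sX n : star (z ^+ n) = z ^+ n.
  by elim: n => [|n IHn]; [rewrite expr0 star1|rewrite exprSr starM IHn sz -exprS exprSr].
by rewrite expnS mulnC !exprM -IH -cnorm_star sX expr2.
Qed.

Section Converse.
Variable M : R.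
Hypotheses (normB : forall b, B b -> cnorm b ^+ 2 <= M * sqnorm2 b)
  (tau1 : tau 1 = 1).

(* The operator of left multiplication by z on L^2(B, tau) has norm at most K^2;
   the C*-identity then bounds the norm of z through its powers z^(2^k). *)
Lemma cexp_norm_approx_le a (K : R) : 0 <= K ->
  (forall b, B b -> exists2 c, B c & sqnorm2 (a * b - c) <= K ^+ 2 * sqnorm2 b) ->
  cexp_norm E (a - E a) <= K.
Proof.
move=> K0 H.
(* [E a * b] is the best L^2 approximation of [a * b] in B, so it does at least as well as c. *)
have yb b : B b -> sqnorm2 ((a - E a) * b) <= K ^+ 2 * sqnorm2 b.
  move=> Bb; have [c Bc /(le_trans _)] := H b Bb; apply.
  have Bv : B (E a * b - c) by apply: BB => //; apply: BM => //; exact: (cexp_range EP).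
  have -> : a * b - c = (a - E a) * b + (E a * b - c) by rewrite mulrBl addrA subrK.
  by rewrite sqnorm2_addl ?cexp_orthogonal// lerDl sqnorm2_ge0.
set z := E (star (a - E a) * (a - E a)).
have Bz : B z := cexp_range EP _.
have [d dE] := cexp_positive EP (a - E a); rewrite -/z in dE.
have sz : star z = z by rewrite dE starM starK.
have db b : B b -> sqnorm2 (d * b) <= K ^+ 2 * sqnorm2 b.
  move=> Bb; apply: le_trans (yb b Bb); rewrite -lecR -cexp_sqnorm2// -/z dE.
  by rewrite -sqnorm2E starM !mulrA.
have zb b : B b -> sqnorm2 (z * b) <= K ^+ 4 * sqnorm2 b.
  move=> Bb.
  (* The expansion of ||d z b - s d b||_2^2 >= 0, where z is [star d * d]. The value s = K^2 plays
     the part of Cauchy-Schwarz and gives ||z b||_2 <= K^2 ||b||_2. *)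
  have cross (s : R) : 0 <= sqnorm2 (d * (z * b)) - 2 * s * sqnorm2 (z * b)
      + s ^+ 2 * sqnorm2 (d * b).
    have -> : sqnorm2 (d * (z * b)) - 2 * s * sqnorm2 (z * b) + s ^+ 2 * sqnorm2 (d * b)
        = sqnorm2 (d * (z * b) - s%:C *: (d * b)).
      have /(congr1 (@complex.Re R)) // : (sqnorm2 (d * (z * b)) - 2 * s * sqnorm2 (z * b)
         + s ^+ 2 * sqnorm2 (d * b))%:C = (sqnorm2 (d * (z * b) - s%:C *: (d * b)))%:C :> R[i].
      rewrite -[RHS]sqnorm2E starB starZr mulrBl !mulrBr !(pfunB tauP).
      rewrite -!scalerAl -!scalerAr !(pfunZ tauP).
      have c1 : tau (star (d * (z * b)) * (d * b)) = (sqnorm2 (z * b))%:C.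
        by rewrite -sqnorm2E !starM sz !mulrA -[_ * star d * d]mulrA -dE.
      have c2 : tau (star (d * b) * (d * (z * b))) = (sqnorm2 (z * b))%:C.
        by rewrite -sqnorm2E !starM sz !mulrA -[_ * star d * d]mulrA -dE.
      by rewrite c1 c2 !sqnorm2E !rmorphD !rmorphN !rmorphM /=; ring.
    exact: sqnorm2_ge0.
  have h1 := db _ (BM Bz Bb); have h2 := db _ Bb; have h3 := sqnorm2_ge0 b.
  have h4 := sqnorm2_ge0 (z * b).
  (* The choice s = K^2 degenerates at K = 0, where s = 1 is taken. *)
  have [K00|Kn] := eqVneq K 0.
    have := cross 1; rewrite K00 !expr0n /= in h1 h2 *; lra.
  have Kp : 0 < K ^+ 2 by rewrite exprn_gt0// lt_def Kn.
  rewrite -(ler_pM2l Kp); have := cross (K ^+ 2).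
  have -> : K ^+ 2 * (K ^+ 4 * sqnorm2 b) = (K ^+ 2) ^+ 2 * (K ^+ 2 * sqnorm2 b) by ring.
  have := ler_wpM2l (sqr_ge0 (K ^+ 2)) h2.
  lra.
have zX n : B (z ^+ n) /\ sqnorm2 (z ^+ n) <= (K ^+ 4) ^+ n.
  elim: n => [|n [Bn IH]].
    by split=> //; rewrite !expr0 /sqnorm2 star1 mulr1 tau1.
  rewrite [z ^+ _]exprS [_ ^+ n.+1]exprS; split; first exact: BM.
  by apply: le_trans (zb _ Bn) _; rewrite ler_wpM2l ?exprn_ge0.
have M0 : 0 <= M.
  have := normB B1; rewrite cnorm1 expr1n /sqnorm2 star1 mulr1 tau1 /= mulr1.
  exact: le_trans.
have zK : cnorm z ^+ 2 <= (K ^+ 2) ^+ 2.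
  apply: (@exp_bound_le _ _ M) => [||k]; rewrite ?sqr_ge0//.
  rewrite -exprM mulnC exprM -cnorm_exp2//; have [Bk zk] := zX (2 ^ k)%N.
  apply: le_trans (normB Bk) _; rewrite ler_wpM2l//.
  by rewrite -[(K ^+ 2) ^+ 2]exprM.
rewrite -(@ler_pXn2r _ 2) ?nnegrE ?cexp_norm_ge0// cexp_norm_sq.
by rewrite -(@ler_pXn2r _ 2) ?nnegrE ?cnorm_ge0 ?sqr_ge0.
Qed.

End Converse.
End ConditionalExpectationNorm.

Section MatrixSums.
Variables (R : realType) (k l : nat) (k_gt0 : (0 < k)%N).
Local Notation T := (mxsum R l k_gt0).

(** Each vector v defines a positive functional on D by v* g(f d) v; [pfun_bound] for it at
    [star x * x] bounds ||g(f x) v|| by ||x|| ||v||. *)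
Lemma mxsum_contractive (D : cstarType R) (f : D -> T) x :
  unital_star_morphism f -> cnorm (f x) <= cnorm x.
Proof.
move=> [[fl fm fs] f1].
have H p (g : T -> 'M[R[i]]_p) : linear g -> {morph g : x y / x * y >-> x *m y} ->
    (forall y, g (star y) = adjmx (g y)) -> g 1 = 1%:M ->
    opnorm (g (f x)) <= cnorm x.
  move=> gl gm gs g1; apply: opnorm_le => [|v]; first exact: cnorm_ge0.
  pose psi d := (adjmx v *m g (f d) *m v) 0 0.
  have psiE d : psi (star d * d) = (l2norm (g (f d) *m v) ^+ 2)%:C.
    by rewrite -adjmx_mul_self adjmxM /psi fm gm fs gs !mulmxA.
  have psiP : positive_functional psi.
    split=> [c a b|a]; last by rewrite psiE ler0c sqr_ge0.
    by rewrite /psi fl gl mulmxDr mulmxDl -scalemxAr -scalemxAl !mxE.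
  have := @pfun_bound _ _ _ psiP (star x * x) 1.
  rewrite starM starK star1 mul1r !mulr1 psiE cnorm_star => /(_ erefl).
  rewrite -[X in psi X]mulr1 -{1}(star1 D) psiE f1 g1 mul1mx -rmorphM lecR -exprMn.
  by rewrite ler_pXn2r ?nnegrE ?mulr_ge0 ?l2norm_ge0 ?cnorm_ge0.
rewrite ge_max; apply/andP; split.
  exact: (H k fst).
exact: (H l snd).
Qed.

Lemma mxsum_linear_bound (V : cstarType R) (F : T -> V) : linear F ->
  exists2 C : R, 0 <= C & forall (x : T) (c : R),
    (forall i j, normc (x.1 i j) <= c) -> (forall i j, normc (x.2 i j) <= c) ->
    cnorm (F x) <= C * c.
Proof.
move=> Fl.
have F0 : F 0 = 0.
  by have := Fl (-1) 0 0; rewrite scaleN1r oppr0 addr0 scaleN1r addNr.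
have FD x y : F (x + y) = F x + F y by have := Fl 1 x y; rewrite !scale1r.
have FZ c x : F (c *: x) = c *: F x by have := Fl c x 0; rewrite F0 !addr0.
have normS (I : finType) (G : I -> V) : cnorm (\sum_i G i) <= \sum_i cnorm (G i).
  elim/big_ind2: _ => [|x x' y y' h h'|//]; first by rewrite cnorm0.
  exact: le_trans (cnormD _ _) (lerD h h').
have H p (G : 'M[R[i]]_p -> V) : linear G -> exists2 C : R, (0 <= C) &
    forall (a : 'M[R[i]]_p) (c : R), (forall i j, normc (a i j) <= c) -> (cnorm (G a) <= C * c).
  move=> Gl.
  have G0 : G 0 = 0.
    by have := Gl (-1) 0 0; rewrite scaleN1r oppr0 addr0 scaleN1r addNr.
  have GD x y : G (x + y) = G x + G y by have := Gl 1 x y; rewrite !scale1r.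
  have GZ c x : G (c *: x) = c *: G x by have := Gl c x 0; rewrite G0 !addr0.
  exists (\sum_i \sum_j cnorm (G (delta_mx i j))) => [|a c ac].
    by apply: sumr_ge0 => i _; apply: sumr_ge0 => j _; exact: cnorm_ge0.
  rewrite [a]matrix_sum_delta (big_morph G GD G0) mulr_suml.
  apply: le_trans (normS _ _) _; apply: ler_sum => i _.
  rewrite (big_morph G GD G0) mulr_suml.
  apply: le_trans (normS _ _) _; apply: ler_sum => j _.
  by rewrite GZ cnormZ mulrC ler_wpM2l ?cnorm_ge0.
have [|C1 C10 H1] := H k (fun a => F (a, 0)).
  move=> c x y; rewrite -FZ -FD; congr F; congr pair.
  by rewrite /= scaler0 addr0.
have [|C2 C20 H2] := H l (fun a => F (0, a)).
  move=> c x y; rewrite -FZ -FD; congr F; congr pair.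
  by rewrite /= scaler0 addr0.
exists (C1 + C2) => [|[a b] c ac bc]; first by rewrite addr_ge0.
have -> : (a, b) = ((a, 0) : T) + (0, b).
  by congr pair; rewrite /= ?addr0 ?add0r.
rewrite FD mulrDl; apply: le_trans (cnormD _ _) _.
by rewrite lerD ?H1 ?H2.
Qed.

End MatrixSums.

Section HilbertSchmidt.
Variables (R : realType) (k l : nat) (k_gt0 : (0 < k)%N).
Local Notation T := (mxsum R l k_gt0).
Implicit Types (x : T) (a b s : R).

Definition hs_sq p (M : 'M[R[i]]_p) : R := \sum_i \sum_j normc (M i j) ^+ 2.

(** With the weights of the trace this is the squared L^2 norm on a stage, as [es_sqnorm2] shows;
    theta enters through a and b alone. *)
Definition whs a b x : R := a * hs_sq x.1 + b * hs_sq x.2.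

Lemma hs_sq_ge0 p (M : 'M[R[i]]_p) : 0 <= hs_sq M.
Proof. by apply: sumr_ge0 => i _; apply: sumr_ge0 => j _; rewrite sqr_ge0. Qed.

Lemma hs_sq_entry p (M : 'M[R[i]]_p) i j : normc (M i j) ^+ 2 <= hs_sq M.
Proof.
rewrite /hs_sq (bigD1 i)//= (bigD1 j)//= -addrA lerDl addr_ge0//.
  by apply: sumr_ge0 => ? _; rewrite sqr_ge0.
by apply: sumr_ge0 => ? _; apply: sumr_ge0 => ? _; rewrite sqr_ge0.
Qed.

Lemma hs_sq_trace p (M : 'M[R[i]]_p) : \tr (adjmx M *m M) = (hs_sq M)%:C.
Proof.
rewrite /mxtrace /hs_sq exchange_big rmorph_sum; apply: eq_bigr => j _.
rewrite mxE rmorph_sum; apply: eq_bigr => i _; rewrite !mxE mulrC.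
by rewrite -sqr_normc rmorphXn.
Qed.

Lemma whs_ge0 a b x : 0 <= a -> 0 <= b -> 0 <= whs a b x.
Proof. by move=> a0 b0; rewrite addr_ge0// mulr_ge0 ?hs_sq_ge0. Qed.

Lemma whs_trace a b x :
  a%:C * \tr (star x * x).1 + b%:C * \tr (star x * x).2 = (whs a b x)%:C.
Proof. by rewrite !hs_sq_trace -!rmorphM -rmorphD. Qed.

Lemma whs_le a b a' b' s x : a <= s * a' -> b <= s * b' ->
  whs a b x <= s * whs a' b' x.
Proof. by move=> aa bb; rewrite mulrDr lerD// mulrA ler_wpM2r// hs_sq_ge0. Qed.

Lemma whs_entries a b x : 0 < a -> 0 < b ->
  let c := Num.sqrt (whs a b x / Num.min a b) in
  (forall i j, normc (x.1 i j) <= c) /\ (forall i j, normc (x.2 i j) <= c).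
Proof.
move=> a0 b0 c; have m0 : 0 < Num.min a b by rewrite lt_min a0.
have H p (M : 'M[R[i]]_p) d : Num.min a b <= d -> d * hs_sq M <= whs a b x ->
    forall i j, normc (M i j) <= c.
  move=> md dM i j; rewrite -[leLHS](ger0_norm (normc_ge0 _)) -sqrtr_sqr ler_wsqrtr//.
  rewrite ler_pdivlMr// mulrC; apply: le_trans dM.
  by rewrite ler_pM ?(ltW m0) ?sqr_ge0 ?hs_sq_entry.
split; [apply: (H _ _ a)|apply: (H _ _ b)]; rewrite ?ge_min ?lexx ?orbT//.
  by rewrite lerDl mulr_ge0 ?hs_sq_ge0 ?ltW.
by rewrite lerDr mulr_ge0 ?hs_sq_ge0 ?ltW.
Qed.

(** Finite dimension enters here: a linear map is bounded in terms of matrix entries, and positive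
    weights bound the entries. *)
Lemma whs_linear_bound (V : cstarType R) (F : T -> V) a b : 0 < a -> 0 < b ->
  linear F -> exists2 C : R, 0 <= C & forall x, cnorm (F x) ^+ 2 <= C * whs a b x.
Proof.
move=> a0 b0 /mxsum_linear_bound[C C0 H].
have m0 : 0 < Num.min a b by rewrite lt_min a0.
exists (C ^+ 2 / Num.min a b) => [|x]; first by rewrite divr_ge0 ?sqr_ge0 ?ltW.
have [h1 h2] := whs_entries x a0 b0.
have := H x _ h1 h2; set c := Num.sqrt _ => Fx.
have c2 : c ^+ 2 = whs a b x / Num.min a b.
  by rewrite sqr_sqrtr// divr_ge0 ?whs_ge0 ?ltW.
rewrite mulrAC -mulrA -c2 -exprMn ler_pXn2r ?nnegrE ?cnorm_ge0//.
by rewrite mulr_ge0 ?sqrtr_ge0.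
Qed.

End HilbertSchmidt.

Section Cast.
Variable R : realType.

(** The stages of theta and theta' have sizes that are equal only propositionally, so their
    identification is a transport. *)
Definition mxsum_cast k l k' l' (k_gt0 : (0 < k)%N) (k'_gt0 : (0 < k')%N)
    (ek : k = k') (el : l = l') (x : mxsum R l k_gt0) : mxsum R l' k'_gt0 :=
  (castmx (ek, ek) x.1, castmx (el, el) x.2).

Section Facts.
Variables (k l k' l' : nat) (k_gt0 : (0 < k)%N) (k'_gt0 : (0 < k')%N).
Variables (ek : k = k') (el : l = l').
Local Notation c := (@mxsum_cast k l k' l' k_gt0 k'_gt0 ek el).

Lemma mxsum_cast_unital : unital_star_morphism c.
Proof.
subst k' l'; split.
  split=> [a x y|x y|x]; rewrite /mxsum_cast !castmx_id; by [|case: x|case: x => ? ?].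
by rewrite /mxsum_cast !castmx_id.
Qed.

Lemma mxsum_cast_whs a b x : whs a b (c x) = whs a b x.
Proof. by subst k' l'; rewrite /mxsum_cast !castmx_id; case: x. Qed.

Lemma mxsum_castK (ek' : k' = k) (el' : l' = l) x :
  @mxsum_cast k' l' k l k'_gt0 k_gt0 ek' el' (c x) = x.
Proof. by subst k' l'; rewrite /mxsum_cast !castmx_id; case: x. Qed.

End Facts.

Lemma castmx_block_diag c c' q q' l l' (a : 'M[R[i]]_q) (b : 'M[R[i]]_l)
    (ec : c = c') (eq : q = q') (el : l = l') (E : (c * q + l = c' * q' + l')%N) :
  castmx (E, E) (block_mx (diag_copies c a) 0 0 b) =
  block_mx (diag_copies c' (castmx (eq, eq) a)) 0 0 (castmx (el, el) b).
Proof. by subst c' q' l'; rewrite !castmx_id. Qed.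

Definition es_cast (r r' : quotients) n (e : cf_den r n = cf_den r' n) :
    es_stage R r n -> es_stage R r' n :=
  mxsum_cast _ (congr1 fst e) (congr1 snd e).

Lemma es_cast_unital (r r' : quotients) n (e : cf_den r n = cf_den r' n) :
  unital_star_morphism (es_cast e).
Proof. exact: mxsum_cast_unital. Qed.

Lemma es_castK (r r' : quotients) n (e : cf_den r n = cf_den r' n)
  (e' : cf_den r' n = cf_den r n) : cancel (es_cast e) (es_cast e').
Proof. by move=> x; exact: mxsum_castK. Qed.

Lemma es_cast_map (r r' : quotients) n (e : cf_den r n = cf_den r' n)
    (e' : cf_den r n.+1 = cf_den r' n.+1) (x : es_stage R r n) :
  r n.+1 = r' n.+1 -> es_cast e' (es_map x) = es_map (es_cast e x).
Proof.
move=> rr; congr pair; first exact: castmx_block_diag.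
by congr (castmx (_, _) _); exact: eq_irrelevance.
Qed.

(* The image of the m-th stage in the n-th one; only meaningful for m <= n. *)
Fixpoint es_sub (r : quotients) (m n : nat) : set (es_stage R r n) :=
  match n return set (es_stage R r n) with
  | 0 => setT
  | n'.+1 => if m == n'.+1 then setT else [set es_map y | y in @es_sub r m n']
  end.

Lemma es_sub_cast (r r' : quotients) m n (e : cf_den r n = cf_den r' n) x :
  (forall k, (k <= n)%N -> r k = r' k) ->
  es_sub m x -> es_sub m (es_cast e x).
Proof.
elim: n e x => //= n IH e x rr; case: ifP => // mn [y ym <-].
have e' : cf_den r n = cf_den r' n by apply: cf_den_ext => k kn; exact: rr (leqW kn).
rewrite (es_cast_map e'); last exact: rr.
by exists (es_cast e' y) => //; apply: IH => // k kn; exact: rr (leqW kn).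
Qed.

End Cast.

Section Stages.
Variables (R : realType) (th : R) (A : effros_shen th).
Local Notation r := (es_quot A).
Local Notation h := (@es_inj R th A).

Lemma es_inj_unital n : unital_star_morphism (@h n).
Proof. by have [[H _] _] := es_limit A; exact: H. Qed.

Lemma es_inj_map n (x : es_stage R r n) : h (es_map x) = h x.
Proof. by have [[_ H] _] := es_limit A; exact: H. Qed.

(** [es_sub] stays inside the finite stages and can be transported from theta to theta', whereas the
    range lives in the limit algebra. Injectivity of the canonical maps gives the converse
    inclusion. *)
Lemma es_subP m n (x : es_stage R r n) : (m <= n)%N ->
  es_sub m x <-> range (@h m) (h x).
Proof.
move=> mn; split.
  elim: n x mn => [|n IH] x mn /=.
    by move: mn; rewrite leqn0 => /eqP ->; exists x.
  case: eqP => [->|/eqP nmn]; first by exists x.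
  move=> [y ym <-]; rewrite es_inj_map; apply: IH => //.
  by move: mn; rewrite leq_eqVlt (negbTE nmn).
suff H y : exists2 x' : es_stage R r n, es_sub m x' & h x' = @h m y.
  by move=> [y _ yx]; have [x' x'm x'E] := H y; rewrite -(es_inj_injective (etrans x'E yx)).
elim: n mn y {x} => [|n IH] mn y /=.
  by move: mn y; rewrite leqn0 => /eqP -> y; exists y.
case: eqP => [mE|/eqP nmn]; first by move: y; rewrite mE => y; exists y.
have mn' : (m <= n)%N by move: mn; rewrite leq_eqVlt (negbTE nmn).
have [x' x'm x'E] := IH mn' y.
by exists (es_map x'); [exists x'|rewrite es_inj_map].
Qed.

Lemma es_cf_expands : cf_expands r th.
Proof. by split; [exact: quot_gt0|exact: es_expansion]. Qed.

Definition es_weight1 n : R := es_weightS th r n / (cf_den r n.+1).1%:R.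
Definition es_weight2 n : R := (1 - es_weightS th r n) / (cf_den r n.+1).2%:R.

Lemma es_weight1_gt0 n : irrational th -> 0 < es_weight1 n.
Proof.
move=> ith; rewrite divr_gt0 ?ltr0n ?cf_den_gt0//.
exact: (es_weight_gt0 _ es_cf_expands).
Qed.

Lemma es_weight2_gt0 n : irrational th -> 0 < es_weight2 n.
Proof.
move=> ith; rewrite divr_gt0 ?ltr0n ?cf_den_gt0// subr_gt0.
exact: (es_weight_lt1 _ es_cf_expands).
Qed.

Lemma es_trace_pfun : positive_functional (@es_trace R th A).
Proof. by have [] := es_trace_state A. Qed.

Lemma es_trace1 : @es_trace R th A 1 = 1.
Proof. by have [] := es_trace_state A. Qed.

Lemma es_sqnorm2 n (x : es_stage R r n.+1) :
  sqnorm2 (@es_trace R th A) (h x) = whs (es_weight1 n) (es_weight2 n) x.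
Proof.
rewrite /sqnorm2; have [[_ hm hs] _] := es_inj_unital n.+1.
by rewrite -hs -hm es_traceE whs_trace.
Qed.

(** The right-hand side speaks of a finite stage only, so it can be compared across two
    parameters. *)
Lemma es_cexp_normP m n (x : es_stage R r n.+1) (K : R) : irrational th ->
  (m <= n.+1)%N -> 0 <= K ->
  cexp_norm (@es_cexp R th A m) (h x - es_cexp m (h x)) <= K <->
  forall b, es_sub m b -> exists2 c, es_sub m c &
    whs (es_weight1 n) (es_weight2 n) (x * b - c) <=
    K ^+ 2 * whs (es_weight1 n) (es_weight2 n) b.
Proof.
move=> ith mn K0.
have hU := es_inj_unital n.+1; have [hM h1] := hU; have [hl hm hs] := hM.
have [mM m1] := es_inj_unital m; have [_ mm ms] := mM.
pose B := range (@h m).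
have B1 : B 1 by exists 1.
have BM b c : B b -> B c -> B (b * c).
  by move=> [b' _ <-] [c' _ <-]; exists (b' * c').
have BB b c : B b -> B c -> B (b - c).
  by move=> [b' _ <-] [c' _ <-]; exists (b' - c') => //; rewrite smorphB.
have BS b : B b -> B (star b).
  by move=> [b' _ <-]; exists (star b').
have [M _ HM] := whs_linear_bound (es_weight1_gt0 n ith) (es_weight2_gt0 n ith) hl.
have BN b : B b -> exists2 b', es_sub m b' & b = @h n.+1 b'.
  move=> Bb; suff [b' bE] : range (@h n.+1) b.
    by move=> bE'; exists b' => //; apply/(es_subP _ mn); rewrite bE'.
  move: Bb => [y _ <-]; elim: (n.+1) mn => [|p IH].
    by rewrite leqn0 => /eqP mE; move: y; rewrite mE => y; exists y.
  rewrite leq_eqVlt => /predU1P[mE {IH}|/IH[y' _ <-]].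
    by move: y; rewrite mE => y; exists y.
  by exists (es_map y') => //; rewrite es_inj_map.
split=> [xK b bm|H].
  have Bb : B (@h n.+1 b) by apply/(es_subP _ mn).
  have [c Bc cE] := cexp_norm_approx es_trace_pfun (@es_cexpP _ _ A m)
    (@es_cexp_trace _ _ A m) BM BS xK Bb.
  have [c' c'm c'E] := BN c Bc; exists c' => //; move: cE.
  by rewrite c'E -hm -smorphB// !es_sqnorm2.
apply: (cexp_norm_approx_le es_trace_pfun (@es_cexpP _ _ A m) (@es_cexp_trace _ _ A m)
  B1 BM BB BS (M := M)) => //.
- by move=> b Bb; have [b' _ ->] := BN b Bb; rewrite es_sqnorm2.
- exact: es_trace1.
- move=> b Bb; have [b' b'm ->] := BN b Bb; have [c cm cE] := H b' b'm.
  exists (@h n.+1 c); first by apply/(es_subP _ mn).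
  by rewrite -hm -smorphB// !es_sqnorm2.
Qed.

End Stages.

(** * Seminorms on the finite stages *)

Section Lip.
Variables (R : realType) (th : R) (A : effros_shen th).
Hypothesis ith : irrational th.
Local Notation r := (es_quot A).
Local Notation h := (@es_inj R th A).

Definition es_dev m n (x : es_stage R r n) : R :=
  cexp_norm (@es_cexp R th A m) (h x - es_cexp m (h x)).

Definition es_scale m : R := es_kappa th r m * es_beta R r m.

Lemma es_beta_gt0 (q : quotients) m : 0 < es_beta R q m.
Proof. by rewrite invr_gt0 ltr0n addn_gt0 expn_gt0 cf_den_gt0. Qed.

Lemma es_scale_gt0 m : 0 < es_scale m.
Proof. by rewrite mulr_gt0 ?es_beta_gt0// (es_kappa_gt0 _ (es_cf_expands A)). Qed.

Lemma es_lip_ge0 n (x : es_stage R r n) : 0 <= es_lip x.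
Proof. exact: bigmax_ge_id. Qed.

Lemma es_lip_leP n (x : es_stage R r n) (c : R) : 0 <= c ->
  es_lip x <= c <-> forall m, (m < n)%N ->
    es_dev m x <= c * es_scale m /\ es_dev m (star x) <= c * es_scale m.
Proof.
move=> c0; have [[_ _ hs] _] := es_inj_unital A n.
have E (m : 'I_n) : (Num.max (cexp_norm (@es_cexp R th A m) (h x - es_cexp m (h x)))
      (cexp_norm (@es_cexp R th A m) (star (h x) - es_cexp m (star (h x))))
     / (es_kappa th r m * es_beta R r m) <= c) =
    (es_dev m x <= c * es_scale m) && (es_dev m (star x) <= c * es_scale m).
  by rewrite ler_pdivrMr ?es_scale_gt0// ge_max -hs.
split=> [/bigmax_leP[_ H] m mn|H].
  by apply/andP; have := H (Ordinal mn) isT; rewrite E.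
by apply/bigmax_leP; split=> // m _; rewrite E; apply/andP/H.
Qed.

(** E_m fixes the scalars, so a translation by a scalar leaves the deviation unchanged; this is what
    permits contracting towards a scalar. *)
Lemma es_dev_affine m n (x : es_stage R r n) (t c : R) :
  es_dev m (t%:C *: x + c%:C%:A) = `|t| * es_dev m x.
Proof.
have [[hl hm hs] h1] := es_inj_unital A n; have [_ m1] := es_inj_unital A m.
have EP := @es_cexpP R th A m; have El := cexp_linear EP.
have E1 : @es_cexp R th A m 1 = 1 by apply: (cexp_id EP); exists 1.
have E0 : @es_cexp R th A m 0 = 0.
  by have := El (-1) 0 0; rewrite scaleN1r oppr0 addr0 scaleN1r addNr.
have EZ a y : @es_cexp R th A m (a *: y) = a *: es_cexp m y.
  by have := El a y 0; rewrite E0 !addr0.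
have hZ a : h (a%:A : es_stage R r n) = a%:A.
  by rewrite (smorphZ _ _ (es_inj_unital A n).1) h1.
rewrite /es_dev hl El hZ EZ E1 opprD addrACA subrr addr0 -scalerBr.
rewrite /cexp_norm starZr -scalerAl -scalerAr !EZ !cnormZr mulrA -expr2.
by rewrite sqrtrM ?sqr_ge0// sqrtr_sqr normr_id.
Qed.

Lemma es_lip_affine n (x : es_stage R r n) (t c : R) :
  es_lip (t%:C *: x + c%:C%:A) <= `|t| * es_lip x.
Proof.
have := (es_lip_leP x (es_lip_ge0 x)).1 (lexx _) => H.
apply/es_lip_leP => [|m mn]; first by rewrite mulr_ge0 ?es_lip_ge0.
have -> : star (t%:C *: x + c%:C%:A) = t%:C *: star x + c%:C%:A.
  by rewrite starD !starZr star1.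
by rewrite !es_dev_affine -!mulrA; have [h1 h2] := H m mn; split; rewrite ler_wpM2l.
Qed.

Lemma es_stage0_scalar (y : es_stage R r 0) : y = (y.1 ord0 ord0)%:A.
Proof.
case: y => a b; congr pair.
  by apply/matrixP => i j; rewrite !mxE !ord1 eqxx mulr1.
by rewrite [RHS]thinmx0 [b]thinmx0.
Qed.

(* The term m = 0 of the seminorm controls the distance to the scalars. *)
Lemma es_lip_scalar_bound n : exists2 C : R, 0 <= C &
  forall x : es_stage R r n.+1, star x = x ->
    exists c : R, cnorm (x - c%:C%:A) <= C * es_lip x.
Proof.
have hU := es_inj_unital A n.+1; have [hM h1] := hU.
have idl : linear (@idfun (es_stage R r n.+1)) by [].
have w1 := es_weight1_gt0 A n ith; have w2 := es_weight2_gt0 A n ith.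
have [C C0 HC] := whs_linear_bound w1 w2 idl.
exists (Num.sqrt C * es_scale 0) => [|x sx].
  by rewrite mulr_ge0 ?sqrtr_ge0 ?(ltW (es_scale_gt0 0)).
set K := es_lip x * es_scale 0.
have K0 : 0 <= K by rewrite mulr_ge0 ?es_lip_ge0 ?(ltW (es_scale_gt0 0)).
have [d0 _] := (es_lip_leP x (es_lip_ge0 x)).1 (lexx _) 0 isT.
have s1 : es_sub 0 (1 : es_stage R r n.+1).
  by apply/es_subP => //; exists 1 => //; rewrite h1 (es_inj_unital A 0).2.
(* At b = 1 the criterion for m = 0 provides an element of stage 0, a scalar, that is L^2-close to
   x. *)
have [c c0] := (es_cexp_normP x ith (leq0n _) K0).1 d0 1 s1.
have [y _ yc] := (es_subP c (leq0n _)).1 c0.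
have [mu cE] : exists mu : R[i], c = mu%:A.
  exists (y.1 ord0 ord0); apply: es_inj_injective.
  rewrite -yc [in LHS](es_stage0_scalar y).
  by rewrite (smorphZ _ _ (es_inj_unital A 0).1) (smorphZ _ _ hM) h1 (es_inj_unital A 0).2.
have -> : whs (es_weight1 A n) (es_weight2 A n) (1 : es_stage R r n.+1) = 1.
  by rewrite -es_sqnorm2 h1 /sqnorm2 star1 mulr1 es_trace1.
rewrite !mulr1 => xc; exists (complex.Re mu).
have xcK : cnorm (x - c) <= Num.sqrt C * K.
  rewrite -(@ler_pXn2r _ 2) ?nnegrE ?cnorm_ge0 ?(mulr_ge0 (sqrtr_ge0 C) K0)//.
  by rewrite exprMn sqr_sqrtr// (le_trans (HC _))// ler_wpM2l.
(* As x is self-adjoint, averaging x - c with its adjoint replaces the complex scalar by its real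
   part without increasing the norm. *)
rewrite (_ : x - _ = 2^-1%:C *: ((x - c) + star (x - c))); last first.
  have -> : x - c + star (x - c) = (2 : R)%:C *: (x - (complex.Re mu)%:C%:A).
    rewrite starB sx cE starZ star1 addrACA -opprD -scalerDl scalerBr.
    rewrite [in (2 : R)%:C *: x]rmorphD rmorph1 [(1 + 1) *: x]scalerDl scale1r.
    congr (_ - _); rewrite scalerA; congr (_ *: _); case: (mu) => u v.
    by apply/eqP; rewrite eq_complex /= subrr; apply/andP; split; apply/eqP; ring.
  by rewrite scalerA -rmorphM mulVf// rmorph1 scale1r.
rewrite cnormZr ger0_norm ?invr_ge0//.
rewrite ler_pdivrMl// -mulrA (mulrC (es_scale 0)) -/K mulr_natl mulr2n.
by rewrite (le_trans (cnormD _ _))// cnorm_starE lerD.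
Qed.

End Lip.

Section Compare.
Variables (R : realType) (th th' : R) (A : effros_shen th) (A' : effros_shen th').
Hypotheses (ith : irrational th) (ith' : irrational th').
Local Notation r := (es_quot A).
Local Notation r' := (es_quot A').
Variables (n : nat) (s : R).
Hypotheses (s1 : 1 <= s) (rr' : forall k, (k <= n.+1)%N -> r k = r' k).
Hypotheses (w1 : es_weight1 A n <= s * es_weight1 A' n)
  (w1' : es_weight1 A' n <= s * es_weight1 A n)
  (w2 : es_weight2 A n <= s * es_weight2 A' n)
  (w2' : es_weight2 A' n <= s * es_weight2 A n)
  (kk : forall m, (m < n.+1)%N -> es_kappa th r m <= s * es_kappa th' r' m).
Variable e : cf_den r n.+1 = cf_den r' n.+1.

(** Weights are changed twice, once for xb - c and once for b. Each change costs s on squared norms,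
    hence s in total on the deviation. *)
Lemma es_dev_compare m (x : es_stage R r n.+1) : (m <= n.+1)%N ->
  es_dev m (es_cast e x) <= s * es_dev m x.
Proof.
move=> mn; have s0 : 0 <= s by rewrite (le_trans ler01).
have d0 : 0 <= es_dev m x by exact: cexp_norm_ge0.
apply/es_cexp_normP => // [|b' b'm]; first by rewrite mulr_ge0.
have bm : es_sub m (es_cast (esym e) b').
  by apply: es_sub_cast => // k kn; rewrite rr'.
have [c cm xbc] := (es_cexp_normP x ith mn d0).1 (lexx _) _ bm.
set b := es_cast _ b' in bm xbc *.
have b'E : b' = es_cast e b by rewrite es_castK.
exists (es_cast e c); first exact: es_sub_cast.
have [cM _] := es_cast_unital R e; have [_ cm' _] := cM.
rewrite b'E -cm' -smorphB// !mxsum_cast_whs.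
apply: le_trans (whs_le _ w1' w2') _.
have hb : whs (es_weight1 A n) (es_weight2 A n) b <=
    s * whs (es_weight1 A' n) (es_weight2 A' n) b'.
  by apply: le_trans (whs_le _ w1 w2) _; rewrite mxsum_cast_whs.
have -> (d W : R) : (s * d) ^+ 2 * W = s * (d ^+ 2 * (s * W)) by ring.
by rewrite ler_wpM2l// (le_trans xbc)// ler_wpM2l ?sqr_ge0.
Qed.

(** One factor s comes from the deviations and one from kappa; beta agrees because the quotients
    do. *)
Lemma es_lip_compare (x : es_stage R r n.+1) :
  es_lip (es_cast e x) <= s ^+ 2 * es_lip x.
Proof.
have s0 : 0 <= s by rewrite (le_trans ler01).
have [[_ _ cs] _] := es_cast_unital R e.
apply/es_lip_leP => // [|m mn]; first by rewrite mulr_ge0 ?sqr_ge0 ?es_lip_ge0.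
have [h1 h2] := (es_lip_leP ith x (es_lip_ge0 x)).1 (lexx _) m mn.
have bE : es_beta R r m = es_beta R r' m.
  rewrite /es_beta (cf_den_ext (r := r) (r' := r'))// => k km.
  by rewrite rr'// (leq_trans km)// ltnW.
have sc : es_scale A m <= s * es_scale A' m.
  by rewrite /es_scale bE mulrA ler_wpM2r ?(ltW (es_beta_gt0 _ _ _))// kk.
have H (y : es_stage R r n.+1) : es_dev m y <= es_lip x * es_scale A m ->
    es_dev m (es_cast e y) <= s ^+ 2 * es_lip x * es_scale A' m.
  move=> hy; apply: le_trans (es_dev_compare y (ltnW mn)) _.
  rewrite expr2 -!mulrA ler_wpM2l//; apply: (le_trans hy).
  by rewrite [leRHS]mulrCA ler_wpM2l ?es_lip_ge0.
by rewrite -cs; split; exact: H.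
Qed.

End Compare.

(** * Tunnels between nearby parameters *)

Section Tunnels.
Variable R : realType.

Lemma LambdaSL_tunnel (A1 A2 : cstarType R) (LA1 : partial_seminorm A1)
    (LA2 : partial_seminorm A2) (e : R) : (LambdaSL LA1 LA2 < e%:E)%E ->
  exists (D : cstarType R) (L : partial_seminorm D) (p1 : D -> A1) (p2 : D -> A2),
    [/\ is_tunnel LA1 LA2 L p1 p2, strongly_leibniz L,
        approximates L p1 e & approximates L p2 e].
Proof.
move=> /ereal_inf_lt[_ [D [L [p1 [p2 [T SL ->]]]]]].
rewrite gt_max => /andP[h1 h2]; exists D, L, p1, p2.
by split=> //; exact: hausdorff_approximates.
Qed.

Section Shrink.
Variables (th : R) (A : effros_shen th) (n : nat) (C rho : R).
Hypotheses (ith : irrational th) (rho1 : 1 <= rho)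
  (HC : forall x : es_stage R (es_quot A) n.+1, star x = x ->
    exists c : R, cnorm (x - c%:C%:A) <= C * es_lip x).

(** The point y divides the segment from x to its scalar c: the seminorm is scaled by 1/rho, and the
    displacement is (1 - 1/rho) (x - c). *)
Lemma es_shrink (x : es_stage R (es_quot A) n.+1) : star x = x ->
  exists y : es_stage R (es_quot A) n.+1, [/\ star y = y,
    es_lip y <= rho^-1 * es_lip x &
    cnorm (x - y) <= (rho - 1) * C * (rho^-1 * es_lip x)].
Proof.
move=> sx; have [c xc] := HC sx.
have rp : 0 < rho := lt_le_trans ltr01 rho1.
exists (rho^-1%:C *: x + ((1 - rho^-1) * c)%:C%:A); split.
- by rewrite starD !starZr star1 sx.
- by apply: le_trans (es_lip_affine ith _ _ _) _; rewrite ger0_norm// invr_ge0 ltW.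
have r1 : 0 <= 1 - rho^-1 by rewrite subr_ge0 invf_le1.
rewrite (_ : x - _ = (1 - rho^-1)%:C *: (x - c%:C%:A)); last first.
  rewrite scalerBr scalerA -rmorphM opprD addrA; congr (_ - _).
  by rewrite rmorphB rmorph1 scalerBl scale1r.
rewrite cnormZr ger0_norm//.
have -> : (rho - 1) * C * (rho^-1 * es_lip x) = (1 - rho^-1) * (C * es_lip x).
  by field; rewrite gt_eqF.
by rewrite ler_wpM2l.
Qed.

End Shrink.

Lemma LambdaSL_stages (th th' : R) (A : effros_shen th) (A' : effros_shen th')
    (LA : partial_seminorm A) (LA' : partial_seminorm A') (n : nat) (s C e delta : R) :
  irrational th -> irrational th' -> 1 <= s ->
  (forall k, (k <= n.+1)%N -> es_quot A k = es_quot A' k) ->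
  es_weight1 A n <= s * es_weight1 A' n -> es_weight1 A' n <= s * es_weight1 A n ->
  es_weight2 A n <= s * es_weight2 A' n -> es_weight2 A' n <= s * es_weight2 A n ->
  (forall m, (m < n.+1)%N -> es_kappa th (es_quot A) m <= s * es_kappa th' (es_quot A') m /\
     es_kappa th' (es_quot A') m <= s * es_kappa th (es_quot A) m) ->
  0 <= C ->
  (forall x : es_stage R (es_quot A) n.+1, star x = x ->
    exists c : R, cnorm (x - c%:C%:A) <= C * es_lip x) ->
  0 < e -> 0 < delta -> (s ^+ 2 - 1) * C <= delta ->
  (LambdaSL LA (es_seminorm A n.+1) < e%:E)%E ->
  (LambdaSL LA' (es_seminorm A' n.+1) < e%:E)%E ->
  (LambdaSL LA LA' <= (e + e + delta)%:E)%E.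
Proof.
move=> ith ith' s1 qq w1 w1' w2 w2' kk C0 HC e0 delta0 sC.
move=> /LambdaSL_tunnel[D1 [L1 [p1 [p2 [[L1P qp1 qp2] SL1 ap1 ap2]]]]].
move=> /LambdaSL_tunnel[D2 [L2 [q1 [q2 [[L2P qq1 qq2] SL2 aq1 aq2]]]]].
have ce : cf_den (es_quot A) n.+1 = cf_den (es_quot A') n.+1 by exact: cf_den_ext.
pose ec := @es_cast R _ _ _ (esym ce).
have s2 : 1 <= s ^+ 2 by rewrite exprn_ege1.
have s2p : 0 < s ^+ 2 := lt_le_trans ltr01 s2.
have p2P := qiso_unital qp2; have q2P := qiso_unital qq2.
have ecP : unital_star_morphism ec by exact: es_cast_unital.
have gP : unital_star_morphism (ec \o q2) by exact: unital_star_comp.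
have cmp x : es_lip (es_cast ce x) <= s ^+ 2 * es_lip x.
  by apply: es_lip_compare => // m mn; case: (kk m mn).
have cmp' x : es_lip (ec x) <= s ^+ 2 * es_lip x.
  apply: es_lip_compare => // [k kn|m mn]; first by rewrite qq.
  by case: (kk m mn).
have [[_ _ cs] _] := @es_cast_unital R _ _ _ ce.
have [[_ _ ecs] _] := ecP.
(* The reference state of the bridge is the trace restricted to the stage. *)
have chi : state_space (es_stage R (es_quot A) n.+1).
  exact: (pull_state (es_inj_unital A n.+1)
    (mkstate (es_trace_pfun A) (es_trace1 A))).
have bound (l l' c : R) : 0 <= c -> l <= c -> l' <= (s ^+ 2 - 1) * C * l ->
    l' <= delta * c.
  move=> c0 lc /le_trans; apply; apply: (le_trans (ler_wpM2l _ lc)).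
    by rewrite mulr_ge0 ?subr_ge0.
  by rewrite ler_wpM2r.
apply: (LambdaSL_bridge (f := p2) (g := ec \o q2) chi L1P L2P SL1 SL2 qp1 qq1) => //.
- by move=> x; exact: mxsum_contractive.
- by move=> x; exact: mxsum_contractive.
- exact: ltW.
- exact: ltW.
- move=> d1 eta dd1 eta0.
  have sx : star (p2 d1) = p2 d1 by have [_ _ H _] := qp2; apply: H; exists d1.
  have lx : es_lip (p2 d1) <= L1 d1 := qiso_le qp2 dd1.
  (* Contracting by s^2 first compensates the factor s^2 of [cmp], so the lift of y to D2 does not
     exceed L1 d1 by more than eta. *)
  have [y [sy ly xy]] := es_shrink ith s2 HC sx.
  have sly : star (es_cast ce y) = es_cast ce y by rewrite -cs sy.
  have [d2 [dd2 d2y Ld2]] := qiso_lift qq2 sly eta0.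
  have lcy : es_lip (es_cast ce y) <= L1 d1.
    apply: le_trans (cmp y) _; apply: le_trans lx.
    by rewrite -ler_pdivlMl.
  exists d2; split=> //; first by rewrite (le_trans (ltW Ld2))// lerD2r.
  rewrite /= d2y /ec es_castK; apply: bound xy.
    by rewrite addr_ge0 ?(ltW eta0)// (qcms_ge0 L1P).
  rewrite (le_trans _ (_ : es_lip (p2 d1) <= _))//.
    by rewrite ler_piMl ?es_lip_ge0// invf_le1.
  by rewrite (le_trans lx)// lerDl ltW.
- move=> d2 eta dd2 eta0.
  have sx' : star (q2 d2) = q2 d2 by have [_ _ H _] := qq2; apply: H; exists d2.
  have sx : star (ec (q2 d2)) = ec (q2 d2) by rewrite -ecs sx'.
  have lx : es_lip (q2 d2) <= L2 d2 := qiso_le qq2 dd2.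
  (* The contraction again takes place in the stage of A, after transport, so the constant C of A
     serves here too. *)
  have [y [sy ly xy]] := es_shrink ith s2 HC sx.
  have ll : (s ^+ 2)^-1 * es_lip (ec (q2 d2)) <= L2 d2.
    by rewrite ler_pdivrMl// (le_trans (cmp' _))// ler_wpM2l// ltW.
  have [d1 [dd1 d1y Ld1]] := qiso_lift qp2 sy eta0.
  exists d1; split=> //.
    by rewrite (le_trans (ltW Ld1))// lerD2r (le_trans ly).
  rewrite /= d1y cnormC; apply: bound xy.
    by rewrite addr_ge0 ?(ltW eta0)// (qcms_ge0 L2P).
  by rewrite (le_trans ll)// lerDl ltW.
move=> phi; have [psi [[nu nuE] m]] := aq2 phi; exists psi; split=> //.
exists (pull_state (@es_cast_unital R _ _ _ ce) nu) => d.
by rewrite nuE /= /ec es_castK.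
Qed.

End Tunnels.

(** * Continuity of the parameters in theta *)

Section Near.
Variables (R : realType) (A : forall th : irrational01 R, effros_shen (val th)).
Variable th0 : irrational01 R.
Local Notation r th := (es_quot (A th)).
Local Notation r0 := (es_quot (A th0)).

Lemma irrational01_irr (th : irrational01 R) : irrational (val th).
Proof. by have /set_mem[] := valP th. Qed.

Lemma near_val (P : set R) :
  (\forall x \near val th0, P x) -> \forall th \near th0, P (val th).
Proof. by move=> H; have := @initial_continuous _ _ (val : irrational01 R -> R) th0 P H. Qed.

Lemma ratio_near (f : R -> R) (x0 s : R) : f x @[x --> x0] --> f x0 -> 0 < f x0 ->
  1 < s -> \forall x \near x0, f x0 <= s * f x /\ f x <= s * f x0.
Proof.
move=> fc f0 s1; have s0 : 0 < s := lt_trans ltr01 s1.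
near=> x; split; last by apply: ltW; near: x; apply: (cvgr_lt _ fc); rewrite ltr_pMl.
rewrite -ler_pdivrMl// ltW//; near: x; apply: (cvgr_gt _ fc).
by rewrite ltr_pdivrMl// ltr_pMl.
Unshelve. all: by end_near. Qed.

Lemma es_digits_near n : \forall th \near th0,
  forall k, (k <= n)%N -> r0 k = r th k.
Proof.
have := cf_digits_near n (es_cf_expands (A th0)) (@irrational01_irr th0).
move=> /near_val; apply: filterS => th H k kn.
by rewrite -(H _ (es_cf_expands (A th)) (@irrational01_irr th) k kn).
Qed.

Lemma cf_err_ext (th : R) (q q' : nat -> nat) m : (forall k, (k <= m)%N -> q k = q' k) ->
  cf_err th q m = cf_err th q' m /\ cf_err_prev th q m = cf_err_prev th q' m.
Proof.
move=> qq; rewrite /cf_err /cf_err_prev.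
by rewrite (cf_den_ext qq) (cf_num_ext qq).
Qed.

Lemma cf_err_cvg (q : nat -> nat) m (x0 : R) :
  cf_err x q m @[x --> x0] --> cf_err x0 q m.
Proof.
rewrite /cf_err; apply: cvgB; last exact: cvg_cst.
by apply: cvgM; [exact: cvg_id|exact: cvg_cst].
Qed.

Lemma cf_err_prev_cvg (q : nat -> nat) m (x0 : R) :
  cf_err_prev x q m @[x --> x0] --> cf_err_prev x0 q m.
Proof.
rewrite /cf_err_prev; apply: cvgB; last exact: cvg_cst.
by apply: cvgM; [exact: cvg_id|exact: cvg_cst].
Qed.

Lemma es_weightS_cvg (q : nat -> nat) m (x0 : R) :
  es_weightS x q m @[x --> x0] --> es_weightS x0 q m.
Proof. by apply: cvgM; [exact: cvg_cst|exact: cf_err_prev_cvg]. Qed.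

(** The quotients vary with theta, but near [th0] the relevant ones are those of [th0]. With the
    quotients frozen, the weights are continuous functions of a real variable. *)
Lemma es_weights_near n (s : R) : 1 < s -> \forall th \near th0,
  (es_weight1 (A th0) n <= s * es_weight1 (A th) n /\
   es_weight1 (A th) n <= s * es_weight1 (A th0) n) /\
  (es_weight2 (A th0) n <= s * es_weight2 (A th) n /\
   es_weight2 (A th) n <= s * es_weight2 (A th0) n).
Proof.
move=> s1.
have n1 : \forall x \near val th0,
    es_weight1 (A th0) n <= s * (es_weightS x r0 n / (cf_den r0 n.+1).1%:R) /\
    es_weightS x r0 n / (cf_den r0 n.+1).1%:R <= s * es_weight1 (A th0) n.
  apply: (ratio_near (f := fun x => es_weightS x r0 n / (cf_den r0 n.+1).1%:R)) => //.
    by apply: cvgM; [exact: es_weightS_cvg|exact: cvg_cst].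
  exact: (es_weight1_gt0 (A th0) n (@irrational01_irr th0)).
have n2 : \forall x \near val th0,
    es_weight2 (A th0) n <= s * ((1 - es_weightS x r0 n) / (cf_den r0 n.+1).2%:R) /\
    (1 - es_weightS x r0 n) / (cf_den r0 n.+1).2%:R <= s * es_weight2 (A th0) n.
  apply: (ratio_near (f := fun x => (1 - es_weightS x r0 n) / (cf_den r0 n.+1).2%:R)) => //.
    apply: cvgM; last exact: cvg_cst.
    by apply: cvgB; [exact: cvg_cst|exact: es_weightS_cvg].
  exact: (es_weight2_gt0 (A th0) n (@irrational01_irr th0)).
apply: filterS (filterI (es_digits_near n.+1) (filterI (near_val n1) (near_val n2))).
move=> th [rr [h1 h2]].
have dE : cf_den (r th) n.+1 = cf_den r0 n.+1 by apply/esym/cf_den_ext.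
have wE : es_weightS (val th) (r th) n = es_weightS (val th) r0 n.
  by rewrite /es_weightS dE (cf_err_ext _ rr).2.
by rewrite [es_weight1 (A th) n]/es_weight1 [es_weight2 (A th) n]/es_weight2 wE dE.
Qed.

(** Again the quotients are frozen; m + 1 of them enter kappa, and the sign of the errors keeps the
    denominator nonzero. *)
Lemma es_kappa_near m (s : R) : 1 < s -> \forall th \near th0,
  es_kappa (val th0) r0 m <= s * es_kappa (val th) (r th) m /\
  es_kappa (val th) (r th) m <= s * es_kappa (val th0) r0 m.
Proof.
move=> s1; have ith0 := @irrational01_irr th0.
have kc : es_kappa x r0 m @[x --> val th0] --> es_kappa (val th0) r0 m.
  rewrite /es_kappa; apply: continuous_cvg; first exact: sqrt_continuous.
  apply: cvgM; first exact: cf_err_cvg.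
  apply: cvgV.
    have p := cf_err_prev_sign m (es_cf_expands (A th0)) ith0.
    rewrite !mulf_neq0 ?expf_neq0 ?pnatr_eq0 -?lt0n ?quot_gt0//.
    by apply: contraTneq p => ->; rewrite mulr0 ltxx.
  apply: cvgM; last exact: cvg_cst.
  by apply: cvgM; [exact: cf_err_prev_cvg|exact: cvg_cst].
have := ratio_near kc (es_kappa_gt0 m (es_cf_expands (A th0)) ith0) s1.
move=> /near_val nk; apply: filterS (filterI (es_digits_near m.+1) nk) => th [rr].
suff -> : es_kappa (val th) (r th) m = es_kappa (val th) r0 m by [].
rewrite /es_kappa -(cf_err_ext _ rr).1 -rr//.
by rewrite (cf_err_ext (q := r th) (q' := r0) (m := m) _ _).2// => k km; rewrite rr// leqW.
Qed.

End Near.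

Lemma es_beta_tail (R : realType) (q : quotients) n :
  (4%:E * \sum_(n <= j <oo) (es_beta R q j)%:E <= (8 * 2^-1 ^+ n)%:E)%E.
Proof.
have part k : \sum_(n <= j < n + k) (2^-1 : R) ^+ j = 2 * 2^-1 ^+ n - 2 * 2^-1 ^+ (n + k).
  elim: k => [|k IH]; first by rewrite addn0 big_geq// subrr.
  rewrite addnS big_nat_recr ?leq_addr//= IH exprSr.
  by field.
have H : (\sum_(n <= j <oo) (es_beta R q j)%:E <= (2 * 2^-1 ^+ n)%:E)%E.
  apply: lime_le.
    by apply: is_cvg_nneseries => i _ _; rewrite lee_fin invr_ge0.
  apply: nearW => m; rewrite sumEFin lee_fin.
  have [mn|/ltnW nm] := leqP m n; first by rewrite big_geq// mulr_ge0// exprn_ge0.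
  apply: le_trans (_ : \sum_(n <= j < m) (2^-1 : R) ^+ j <= _).
    by apply: ler_sum => j _; exact: es_beta_le.
  by rewrite -(subnKC nm) part lerBlDr lerDl mulr_ge0 ?exprn_ge0.
apply: le_trans (lee_wpmul2l _ H) _ => //.
by rewrite -EFinM lee_fin mulrA -natrM.
Qed.

Theorem theorem3p8 (R : realType)
    (A : forall th : irrational01 R, effros_shen (val th))
    (L : forall th : irrational01 R, partial_seminorm (A th))
    (L_qcms : forall th, is_qcms (L th))
    (L_leibniz : forall th, strongly_leibniz (L th))
    (L_approx : forall (th : irrational01 R) (n : nat),
      (LambdaSL (L th) (es_seminorm (A th) n) <=
       4%:E * \sum_(n <= j <oo) (es_beta R (es_quot (A th)) j)%:E)%E) :
  forall (th0 : irrational01 R) (eps : R), 0 < eps ->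
    \forall th \near th0, (LambdaSL (L th0) (L th) < eps%:E)%E.
Proof.
move=> th0 eps eps0; have ith0 := @irrational01_irr R th0.
have e0 : 0 < eps / 8 by rewrite divr_gt0.
have delta0 : 0 < eps / 4 by rewrite divr_gt0.
have [n tail] : exists n, 8 * 2^-1 ^+ n.+1 < eps / 8.
  have /cvgrPdist_lt/(_ (eps / 8 / 8)) : (2^-1 : R) ^+ n @[n --> \oo] --> (0 : R).
    by apply: cvg_expr; rewrite ger0_norm ?invr_ge0// invf_lt1 ?ltr1n.
  case=> [|N _ HN]; first by rewrite divr_gt0.
  exists N; have := HN N.+1 (leqnSn N).
  rewrite /= sub0r normrN ger0_norm ?exprn_ge0 ?invr_ge0//.
  by rewrite ltr_pdivlMr// mulrC.
have Ltail th : (LambdaSL (L th) (es_seminorm (A th) n.+1) < (eps / 8)%:E)%E.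
  apply: le_lt_trans (L_approx th n.+1) _.
  by apply: le_lt_trans (es_beta_tail _ _ _) _; rewrite lte_fin.
have [C C0 HC] := es_lip_scalar_bound (A th0) ith0 n.
(* Since t <= 1, (1 + t)^2 - 1 = t (t + 2) <= 3 t; C + 1 keeps the denominator positive when C =
   0. *)
pose t := Num.min 1 (eps / 4 / (3 * (C + 1))).
have C1 : 0 < 3 * (C + 1) by rewrite mulr_gt0// ltr_wpDl.
have t0 : 0 < t by rewrite lt_min ltr01 divr_gt0.
have t1 : t <= 1 by rewrite ge_min lexx.
have tC : t * (3 * (C + 1)) <= eps / 4 by rewrite -ler_pdivlMr// ge_min lexx orbT.
have s1 : 1 < 1 + t by rewrite ltrDl.
have sC : ((1 + t) ^+ 2 - 1) * C <= eps / 4.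
  apply: le_trans tC; rewrite (_ : _ - 1 = t * (t + 2)); last by ring.
  rewrite -mulrA ler_wpM2l ?(ltW t0)//.
  apply: le_trans (_ : 3 * C <= _); last by rewrite ler_wpM2l// lerDl.
  by rewrite ler_wpM2r//; lra.
pose close_kappa (m : 'I_n.+1) := [set th : irrational01 R |
    es_kappa (val th0) (es_quot (A th0)) m <=
      (1 + t) * es_kappa (val th) (es_quot (A th)) m /\
    es_kappa (val th) (es_quot (A th)) m <=
      (1 + t) * es_kappa (val th0) (es_quot (A th0)) m].
have kappas : nbhs th0 [set th | forall m, close_kappa m th].
  by apply: (@filter_forall _ _ close_kappa (nbhs th0)) => m; exact: es_kappa_near.
apply: filterS (filterI (es_digits_near A th0 n.+1)
  (filterI (es_weights_near A th0 n s1) kappas)) => th [digits [[[w1 w1'] [w2 w2']] kk]].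
(* The three contributions add up to eps/2, which leaves room for the strict inequality. *)
have /le_lt_trans -> // : (LambdaSL (L th0) (L th) <= (eps / 8 + eps / 8 + eps / 4)%:E)%E.
  apply: (LambdaSL_stages ith0 (@irrational01_irr R th) (ltW s1) digits w1 w1' w2 w2' _
    C0 HC e0 delta0 sC (Ltail th0) (Ltail th)) => m mn.
  exact: (kk (Ordinal mn)).
by rewrite lte_fin; lra.
Qed.
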